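(* Let $u\in H(\mathbb D)$ and $\varphi\in S(\mathbb D)$ be such that $uC_\varphi:\mathcal B\to\mathcal B$ is bounded. Then \[ \|uC_\varphi\|_{e,\mathcal B\to\mathcal B}\approx \limsup_{n\to\infty}\|u\varphi^n\|_{\mathcal B}+\limsup_{|\varphi(a)|\to1}\|uC_\varphi g_a\|_{\mathcal B} \approx \tilde\alpha+\tilde\beta+\tilde\gamma \approx \tilde\alpha+\limsup_{|\varphi(a)|\to1}\|uC_\varphi g_a\|_{\mathcal B}+\tilde\gamma \approx \limsup_{n\to\infty}\|u\varphi^n\|_{\mathcal B}+\tilde\beta, \] where $\tilde\alpha=\limsup_{|\varphi(a)|\to1}|u(a)|\,\|\sigma_{\varphi(a)}\circ\varphi\circ\sigma_a\|_{A^2}$, $\tilde\beta=\limsup_{|\varphi(a)|\to1}\log\frac{2}{1-|\varphi(a)|^2}\,\|u\circ\sigma_a-u(a)\|_{A^2}$, \[ \tilde\gamma=\limsup_{r\to1}\limsup_{t\to1}\sup_{|\varphi(a)|\le r}\Big(\int_{E(\varphi,a,t)}|u(\sigma_a(z))|^4\,dA(z)\Big)^{1/4}, \] with $E(\varphi,a,t)=\{z\in\mathbb D:|(\sigma_{\varphi(a)}\circ\varphi\circ\sigma_a)(z)|>t\}$ for $t\in(0,1)$, and \[ g_a(z)=\Big(\log\frac{2}{1-\overline{\varphi(a)}z}\Big)^2\Big(\log\frac{2}{1-|\varphi(a)|^2}\Big)^{-1}. \]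
   Context: $\mathbb D$ is the open unit disk, $H(\mathbb D)$ the analytic functions on $\mathbb D$, and $S(\mathbb D)$ the set of analytic self-maps of $\mathbb D$. For $a\in\mathbb D$, $\sigma_a(z)=\frac{a-z}{1-\bar a z}$. $dA=\frac1\pi\,dx\,dy$ is normalized area measure on $\mathbb D$, and $\|f\|_{A^2}=(\int_{\mathbb D}|f|^2\,dA)^{1/2}$. The Bloch space $\mathcal B$ consists of $f\in H(\mathbb D)$ with $\sup_{z\in\mathbb D}(1-|z|^2)|f'(z)|<\infty$, normed by $\|f\|_{\mathcal B}=|f(0)|+\sup_{z}(1-|z|^2)|f'(z)|$. $(uC_\varphi f)(z)=u(z)f(\varphi(z))$ and $u\varphi^n$ denotes $z\mapsto u(z)\varphi(z)^n$. The logarithm is the principal branch. The essential norm $\|T\|_{e,\mathcal B\to\mathcal B}$ of a bounded operator $T$ on $\mathcal B$ is $\inf\{\|T-K\|_{\mathcal B\to\mathcal B}: K \text{ compact on }\mathcal B\}$. For a quantity $Q(a)$, $\limsup_{|\varphi(a)|\to1}Q(a)=\lim_{s\to1^-}\sup\{Q(a): a\in\mathbb D,\ |\varphi(a)|>s\}$. $X\approx Y$ means there are positive constants $c,C$ independent of $u$ and $\varphi$ with $cY\le X\le CY$. *)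

(* Defs.v *)
From HB Require Import structures.
From mathcomp Require Import all_boot all_order all_algebra.
From mathcomp Require Import all_classical all_reals all_analysis.
From mathcomp Require Import complex.
Import ComplexField.
Import Order.TTheory GRing.Theory Num.Theory.
Import numFieldNormedType.Exports.

Set Implicit Arguments.
Unset Strict Implicit.
Unset Printing Implicit Defensive.

Local Open Scope classical_set_scope.
Local Open Scope ring_scope.

Definition cmod {R : realType} (z : R[i]) : R :=
  Num.sqrt (complex.Re z ^+ 2 + complex.Im z ^+ 2).

Definition cconj {R : realType} (z : R[i]) : R[i] :=
  Complex (complex.Re z) (- complex.Im z).

Definition disk {R : realType} : set R[i] := [set z | cmod z < 1].

Definition sigma {R : realType} (a z : R[i]) : R[i] :=
  (a - z) / (1 - cconj a * z).

Definition has_cderiv {R : realType} (f : R[i] -> R[i]) (z l : R[i]) : Prop :=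
  forall e : R, 0 < e -> exists2 d : R, 0 < d &
    forall h : R[i], h != 0 -> cmod h < d ->
      cmod ((f (z + h) - f z) / h - l) < e.

Definition holo_disk {R : realType} (f : R[i] -> R[i]) : Prop :=
  forall z, disk z -> exists l, has_cderiv f z l.

Definition self_map {R : realType} (phi : R[i] -> R[i]) : Prop :=
  holo_disk phi /\ forall z, disk z -> disk (phi z).

Definition carg {R : realType} (z : R[i]) : R :=
  let x := complex.Re z in let y := complex.Im z in
  if 0 < x then atan (y / x)
  else if x < 0 then (if 0 <= y then atan (y / x) + pi else atan (y / x) - pi)
  else if 0 < y then pi / 2 else if y < 0 then - (pi / 2) else 0.

Definition clog {R : realType} (z : R[i]) : R[i] :=
  Complex (ln (cmod z)) (carg z).

Definition bloch_semi {R : realType} (f : R[i] -> R[i]) : \bar R :=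
  ereal_sup [set x : \bar R | exists z l, [/\ disk z, has_cderiv f z l &
                                 x = ((1 - cmod z ^+ 2) * cmod l)%:E]].

Definition bloch_norm {R : realType} (f : R[i] -> R[i]) : \bar R :=
  ((cmod (f 0))%:E + bloch_semi f)%E.

Definition in_bloch {R : realType} (f : R[i] -> R[i]) : Prop :=
  holo_disk f /\ (bloch_norm f < +oo)%E.

(* operators acting on functions; only their action on B matters *)
Definition op_sub {R : realType} (T K : (R[i] -> R[i]) -> (R[i] -> R[i])) :=
  fun f z => T f z - K f z.

Definition op_norm {R : realType} (T : (R[i] -> R[i]) -> (R[i] -> R[i])) : \bar R :=
  ereal_sup [set bloch_norm (T f) | f in [set f | in_bloch f /\ (bloch_norm f <= 1)%E]].

Definition bounded_bloch {R : realType} (T : (R[i] -> R[i]) -> (R[i] -> R[i])) : Prop :=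
  (forall f, in_bloch f -> in_bloch (T f)) /\ (op_norm T < +oo)%E.

(* K is a compact (linear) operator on B: it is well defined on B (depends
   only on the values of f on D), linear, maps B into B, and maps every
   bounded sequence of B to a sequence having a subsequence convergent in B *)
Definition compact_bloch {R : realType} (K : (R[i] -> R[i]) -> (R[i] -> R[i])) : Prop :=
  [/\ (forall f g, in_bloch f -> in_bloch g ->
         (forall z, disk z -> f z = g z) -> forall z, disk z -> K f z = K g z),
      (forall f g (a b : R[i]), in_bloch f -> in_bloch g ->
         forall z, disk z -> K (fun w => a * f w + b * g w) z = a * K f z + b * K g z),
      (forall f, in_bloch f -> in_bloch (K f)) &
      (forall (fs : nat -> R[i] -> R[i]) (M : R),
         (forall n, in_bloch (fs n) /\ (bloch_norm (fs n) <= M%:E)%E) ->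
         exists (s : nat -> nat) (g : R[i] -> R[i]),
           [/\ (forall n, (s n < s n.+1)%N), in_bloch g &
               (fun n => bloch_norm (fun z => K (fs (s n)) z - g z)) @ \oo --> 0%E])].

Definition ess_norm {R : realType} (T : (R[i] -> R[i]) -> (R[i] -> R[i])) : \bar R :=
  ereal_inf [set op_norm (op_sub T K) | K in [set K | compact_bloch K]].

Definition wcomp {R : realType} (u phi : R[i] -> R[i]) :
  (R[i] -> R[i]) -> (R[i] -> R[i]) := fun f z => u z * f (phi z).

Definition area_int {R : realType} (S : set R[i]) (f : R[i] -> \bar R) : \bar R :=
  ((pi^-1)%:E *
   \int[((@lebesgue_measure R) \x (@lebesgue_measure R))%E]_(p in
        [set p : R * R | S (Complex p.1 p.2)]) f (Complex p.1 p.2))%E.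

Definition A2norm {R : realType} (f : R[i] -> R[i]) : \bar R :=
  poweR (area_int disk (fun z => ((cmod (f z)) ^+ 2)%:E)) (2^-1).

(* sup of a family of nonnegative quantities, with sup of empty set = 0 *)
Definition sup0 {R : realType} (A : set (\bar R)) : \bar R :=
  ereal_sup (0%E |` A).

Definition limsup_phi {R : realType} (phi : R[i] -> R[i]) (Q : R[i] -> \bar R)
  : \bar R :=
  lim ((fun s : R => sup0 [set Q a | a in [set a | disk a /\ s < cmod (phi a)]])
         @ (1:R)^'-).

Definition limsup_left1 {R : realType} (F : R -> \bar R) : \bar R :=
  limf_esup F ((1:R)^'-).

Definition alpha_t {R : realType} (u phi : R[i] -> R[i]) : \bar R :=
  limsup_phi phi (fun a =>
    ((cmod (u a))%:E * A2norm (fun z => sigma (phi a) (phi (sigma a z))))%E).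

Definition beta_t {R : realType} (u phi : R[i] -> R[i]) : \bar R :=
  limsup_phi phi (fun a =>
    ((ln (2 / (1 - cmod (phi a) ^+ 2)))%:E *
     A2norm (fun z => (u (sigma a z) - u a)%R))%E).

Definition Eset {R : realType} (phi : R[i] -> R[i]) (a : R[i]) (t : R) : set R[i] :=
  [set z | disk z /\ t < cmod (sigma (phi a) (phi (sigma a z)))].

Definition gamma_t {R : realType} (u phi : R[i] -> R[i]) : \bar R :=
  limsup_left1 (fun r =>
    limsup_left1 (fun t =>
      sup0 [set poweR (area_int (Eset phi a t)
                         (fun z => ((cmod (u (sigma a z))) ^+ 4)%:E)) (4^-1)
           | a in [set a | disk a /\ cmod (phi a) <= r]])).

Definition g_test {R : realType} (phi : R[i] -> R[i]) (a : R[i]) : R[i] -> R[i] :=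
  fun z => (clog (2%:R / (1 - cconj (phi a) * z))) ^+ 2
           * ((ln (2 / (1 - cmod (phi a) ^+ 2)))^-1)%:C%C.

Definition limsup_pow {R : realType} (u phi : R[i] -> R[i]) : \bar R :=
  limn_esup (fun n => bloch_norm (fun z => u z * phi z ^+ n)).

Definition limsup_g {R : realType} (u phi : R[i] -> R[i]) : \bar R :=
  limsup_phi phi (fun a => bloch_norm (wcomp u phi (g_test phi a))).

(* Main.v *)
Require Import Defs.
From HB Require Import structures.
From mathcomp Require Import all_boot all_order all_algebra.
From mathcomp Require Import all_classical all_reals all_analysis.
From mathcomp Require Import complex measurable_realfun.
From mathcomp Require Import ring lra.
Import ComplexField.
Import Order.TTheory GRing.Theory Num.Theory.
Import numFieldNormedType.Exports.
Local Open Scope classical_set_scope.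
Local Open Scope ring_scope.

Set Implicit Arguments.
Unset Strict Implicit.
Unset Printing Implicit Defensive.

(* The two pointwise quantities
     A(z) = |u(z)| (1 - |z|^2) |phi'(z)| / (1 - |phi(z)|^2),
     B(z) = (1 - |z|^2) |u'(z)| log (2 / (1 - |phi(z)|^2))
   govern everything: each right-hand side, and the essential norm, is comparable
   to limsup A + limsup B as |phi(z)| -> 1.
   Upper bound of the essential norm: subtract the compact operators
   f |-> u . f(r phi); for |phi| away from 1 the difference is small uniformly on
   the unit ball, and elsewhere it is at most 2 A + 6 B.
   Lower bound: the monomials z^n and the functions g_a are bounded in the Bloch
   space, lie in the little Bloch space and tend to 0 locally uniformly, so a gliding
   hump argument shows that a compact operator makes some of them small.
   The norms of u phi^n control A, as n x^(n-1) (1 - x^2) peaks where |phi(z)| = x, and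
   those of uC_phi g_a control B up to A.
   The quantities alpha and beta dominate A and B because |h'(0)| is at most a constant times
   the A^2 norm of h when h(0) = 0.  Conversely, integrating along radii bounds the
   integrands at z by values of A and B at points sigma_a(v), |v| <= |z|, times
   powers of 1 + log (1 / (1 - |z|)), and these weights have uniformly small integral
   near the unit circle. *)

(** * Complex moduli and derivatives *)

(** The constants of the theorem may not depend on the operator norm [M], yet where |phi| stays away
    from 1 only bounds in terms of [M] are at hand. So each area integral over z is split at a
    radius rho. For |z| <= rho, once |phi(a)| is close enough to 1, phi(sigma_a(v)) is still near
    the circle for every |v| <= |z|, because phi is Lipschitz for the hyperbolic distance; there the
    limsup bounds of A and B apply. On the remaining collar the bound by [M] is used, and rho is
    chosen after [M] so that this part contributes at most e. Thus [M] influences thresholds only.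
    Compactness is given by subsequences on the whole Bloch space, while the test functions tend to
    0 only locally uniformly; the gliding hump takes the place of an appeal to duality with the
    little Bloch space. The Cauchy estimate comes from rectangles, which suit a product measure: the
    crude lower bound 4 replaces 2 pi, and Fubini selects good sides. All later constants descend
    from this estimate and from the norms 3 of the monomials and 46 of the logarithmic test
    functions. *)

Section Modulus.
Context {R : realType}.
Implicit Types (z w : R[i]) (x y : R).

Lemma cmod_normc z : cmod z = Normc.normc z.
Proof. by case: z. Qed.

Lemma cmod0 : cmod (0 : R[i]) = 0.
Proof. by rewrite cmod_normc Normc.normc0. Qed.

Lemma cmod1 : cmod (1 : R[i]) = 1.
Proof. by rewrite cmod_normc Normc.normc1. Qed.

Lemma cmodM z w : cmod (z * w) = cmod z * cmod w.
Proof. by rewrite !cmod_normc Normc.normcM. Qed.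

Lemma cmodV z : cmod z^-1 = (cmod z)^-1.
Proof. by rewrite !cmod_normc Normc.normcV. Qed.

Lemma cmod_div z w : cmod (z / w) = cmod z / cmod w.
Proof. by rewrite cmodM cmodV. Qed.

Lemma cmodN z : cmod (- z) = cmod z.
Proof. by rewrite !cmod_normc normcN. Qed.

Lemma cmod_distC z w : cmod (z - w) = cmod (w - z).
Proof. by rewrite -cmodN opprB. Qed.

Lemma cmodD z w : cmod (z + w) <= cmod z + cmod w.
Proof. by rewrite !cmod_normc le_normcD. Qed.

Lemma cmodB z w : cmod (z - w) <= cmod z + cmod w.
Proof. by rewrite -(cmodN w) cmodD. Qed.

Lemma cmod_lerB z w : cmod z - cmod w <= cmod (z - w).
Proof. by rewrite lerBlDr; have := cmodD (z - w) w; rewrite subrK. Qed.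

Lemma cmod_ge0 z : 0 <= cmod z.
Proof. exact: sqrtr_ge0. Qed.

Lemma cmodX z n : cmod (z ^+ n) = cmod z ^+ n.
Proof. by elim: n => [|n IH]; rewrite ?expr0 ?cmod1 // !exprS cmodM IH. Qed.

Lemma cmod_eq0 z : (cmod z == 0) = (z == 0).
Proof.
apply/eqP/eqP => [|->]; last exact: cmod0.
by rewrite cmod_normc => /Normc.eq0_normc.
Qed.

Lemma cmod_gt0 z : (0 < cmod z) = (z != 0).
Proof. by rewrite lt_def cmod_ge0 andbT cmod_eq0. Qed.

Lemma cmod_sqr z : cmod z ^+ 2 = complex.Re z ^+ 2 + complex.Im z ^+ 2.
Proof. by rewrite sqr_sqrtr // addr_ge0 ?sqr_ge0. Qed.

Lemma cmod_real x : cmod x%:C%C = `|x|.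
Proof. by rewrite /cmod /= expr0n addr0 sqrtr_sqr. Qed.

Lemma cmod_conj z : cmod (cconj z) = cmod z.
Proof. by rewrite /cmod /= sqrrN. Qed.

Lemma abs_Re_le z : `|complex.Re z| <= cmod z.
Proof. by rewrite -sqrtr_sqr ler_wsqrtr // lerDl sqr_ge0. Qed.

Lemma abs_Im_le z : `|complex.Im z| <= cmod z.
Proof. by rewrite -sqrtr_sqr ler_wsqrtr // lerDr sqr_ge0. Qed.

Lemma cmod_le_ReIm z : cmod z <= `|complex.Re z| + `|complex.Im z|.
Proof.
rewrite -(ger0_norm (addr_ge0 (normr_ge0 (complex.Re z)) (normr_ge0 (complex.Im z)))).
rewrite -sqrtr_sqr ler_wsqrtr // sqrrD !real_normK ?num_real //.
by have := mulr_ge0 (normr_ge0 (complex.Re z)) (normr_ge0 (complex.Im z)); lra.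
Qed.

Lemma cReD z w : complex.Re (z + w) = complex.Re z + complex.Re w.
Proof. by case: z; case: w. Qed.

Lemma cReN z : complex.Re (- z) = - complex.Re z.
Proof. by case: z. Qed.

Lemma cReB z w : complex.Re (z - w) = complex.Re z - complex.Re w.
Proof. by rewrite cReD cReN. Qed.

Lemma cImD z w : complex.Im (z + w) = complex.Im z + complex.Im w.
Proof. by case: z; case: w. Qed.

Lemma cImN z : complex.Im (- z) = - complex.Im z.
Proof. by case: z. Qed.

Lemma cImB z w : complex.Im (z - w) = complex.Im z - complex.Im w.
Proof. by rewrite cImD cImN. Qed.

Lemma cReM z w : complex.Re (z * w) =
  complex.Re z * complex.Re w - complex.Im z * complex.Im w.
Proof. by case: z; case: w. Qed.

Lemma cImM z w : complex.Im (z * w) =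
  complex.Re z * complex.Im w + complex.Im z * complex.Re w.
Proof. by case: z => a b; case: w => c d /=; ring. Qed.

Lemma ReIm_eq z w : complex.Re z = complex.Re w -> complex.Im z = complex.Im w -> z = w.
Proof. by case: z; case: w => a b c d /= -> ->. Qed.

Lemma Re_mul_real x z : complex.Re (x%:C%C * z) = x * complex.Re z.
Proof. by rewrite cReM /= mul0r subr0. Qed.

Lemma mul_cconj z : z * cconj z = (cmod z ^+ 2)%:C%C.
Proof. by apply: ReIm_eq; rewrite ?cReM ?cImM ?cmod_sqr /=; ring. Qed.

(** Reduces bounds on a modulus to bounds on the real part of a rotated quantity, where real
    calculus applies. *)
Lemma unimodular_rotation z : exists2 c : R[i], cmod c = 1 & c * z = (cmod z)%:C%C.
Proof.
have [->|z0] := eqVneq z 0; first by exists 1; rewrite ?cmod1 // mulr0 cmod0.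
have m0 : (cmod z)%:C%C != 0 :> R[i].
  by rewrite -cmod_eq0 cmod_real normr_eq0 cmod_eq0.
exists (cconj z / (cmod z)%:C%C).
  rewrite cmod_div cmod_conj cmod_real (ger0_norm (cmod_ge0 z)) divff //.
  by rewrite cmod_eq0.
by rewrite mulrAC [cconj z * z]mulrC mul_cconj rmorphXn /= expr2 mulfK.
Qed.

End Modulus.

(** * Continuity and complex differentiability at a point *)

Section ComplexDerivative.
Context {R : realType}.
Implicit Types (f g q : R[i] -> R[i]) (z w l m : R[i]).

Definition ccont f z := forall e : R, 0 < e -> exists2 d : R, 0 < d &
  forall w, cmod (w - z) < d -> cmod (f w - f z) < e.

Lemma ccont_cst l z : ccont (fun _ => l) z.
Proof. by move=> e e0; exists 1 => // w _; rewrite subrr cmod0. Qed.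

Lemma ccont_id z : ccont id z.
Proof. by move=> e e0; exists e. Qed.

Lemma ccontD f g z : ccont f z -> ccont g z -> ccont (fun w => f w + g w) z.
Proof.
move=> cf cg e e0; have e2 : 0 < e / 2 by rewrite divr_gt0.
have [d1 d10 h1] := cf _ e2; have [d2 d20 h2] := cg _ e2.
exists (Num.min d1 d2); first by rewrite lt_min d10.
move=> w; rewrite lt_min => /andP[/h1 a1 /h2 a2].
have -> : f w + g w - (f z + g z) = (f w - f z) + (g w - g z) by ring.
by apply: le_lt_trans (cmodD _ _) _; rewrite (splitr e) ltrD.
Qed.

Lemma ccont_bounded f z : ccont f z -> exists2 d : R, 0 < d &
  forall w, cmod (w - z) < d -> cmod (f w) < cmod (f z) + 1.
Proof.
move=> /(_ 1 ltr01)[d d0 h]; exists d => // w /h hw.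
by rewrite -ltrBlDl (le_lt_trans (cmod_lerB _ _)).
Qed.

Lemma ccontM f g z : ccont f z -> ccont g z -> ccont (fun w => f w * g w) z.
Proof.
move=> cf cg e e0; have [d0 d00 h0] := ccont_bounded cf.
pose M := cmod (f z) + cmod (g z) + 1.
have M0 : 0 < M by rewrite ltr_wpDl // addr_ge0 ?cmod_ge0.
have e2 : 0 < e / 2 / M by rewrite !divr_gt0.
have [d1 d10 h1] := cf _ e2; have [d2 d20 h2] := cg _ e2.
exists (Num.min d0 (Num.min d1 d2)); first by rewrite !lt_min d00 d10.
move=> w; rewrite !lt_min => /and3P[/h0 a0 /h1 a1 /h2 a2].
have -> : f w * g w - f z * g z = f w * (g w - g z) + (f w - f z) * g z by ring.
apply: le_lt_trans (cmodD _ _) _; rewrite !cmodM [e]splitr.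
apply: ltr_leD.
  rewrite -[X in _ < X](mulfVK (lt0r_neq0 M0)) [X in _ < X]mulrC.
  apply: ltr_pM => //; rewrite ?cmod_ge0 //.
  by apply: lt_le_trans a0 _; rewrite /M addrAC lerDl cmod_ge0.
rewrite -[leRHS](mulfVK (lt0r_neq0 M0)).
apply: ler_pM; rewrite ?cmod_ge0 //; first exact: ltW.
by rewrite /M -addrA [cmod (f z) + _]addrC -addrA lerDl addr_ge0 ?cmod_ge0.
Qed.

Lemma ccont_comp f g z : ccont f z -> ccont g (f z) -> ccont (fun w => g (f w)) z.
Proof.
move=> cf cg e e0; have [d d0 h] := cg _ e0; have [d' d'0 h'] := cf _ d0.
by exists d' => // w /h' /h.
Qed.

Lemma ccontV z : z != 0 -> ccont (fun w => w^-1) z.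
Proof.
move=> z0 e e0; have c0 : 0 < cmod z by rewrite cmod_gt0.
exists (Num.min (cmod z / 2) (e * (cmod z ^+ 2 / 2))).
  by rewrite lt_min !mulr_gt0 ?exprn_gt0 ?invr_gt0.
move=> w; rewrite lt_min => /andP[h1 h2].
have hw : cmod z / 2 < cmod w.
  have := cmod_lerB z w; rewrite cmod_distC => h3.
  have := le_lt_trans h3 h1; rewrite ltrBlDr -ltrBlDl; apply: le_lt_trans; lra.
have w0 : w != 0 by rewrite -cmod_gt0; apply: lt_trans hw; rewrite divr_gt0.
have -> : w^-1 - z^-1 = - (w - z) / (w * z).
  by field; rewrite z0 w0.
rewrite cmod_div cmodN cmodM ltr_pdivrMr; last first.
  by rewrite mulr_gt0 // cmod_gt0.
apply: lt_le_trans h2 _; rewrite ler_wpM2l ?(ltW e0) //.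
by rewrite expr2 mulrAC ler_wpM2r ?(ltW c0) ?ltW.
Qed.

Lemma ccont_near f g z (r : R) : 0 < r ->
  (forall w, cmod (w - z) < r -> f w = g w) -> ccont f z -> ccont g z.
Proof.
move=> r0 fg cf e e0; have [d d0 h] := cf _ e0.
exists (Num.min d r); first by rewrite lt_min d0.
move=> w; rewrite lt_min => /andP[/h hw /fg <-].
by rewrite -(fg z) // subrr cmod0.
Qed.

(** Caratheodory's form of the derivative: the difference quotient, given the value l at z, is
    continuous there. Sum, product and chain rules then become algebra of continuous functions, and
    the chain rule needs no separate case for f(w) = f(z). *)
Lemma has_cderivP f z l : has_cderiv f z l <->
  exists q, [/\ ccont q z, q z = l & forall w, f w - f z = q w * (w - z)].
Proof.
split=> [h|[q [cq <- hq]] e e0]; last first.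
  have [d d0 hd] := cq _ e0; exists d => // k k0 kd.
  rewrite hq [z + k - z]addrAC subrr add0r mulfK //.
  by apply: hd; rewrite addrAC subrr add0r.
exists (fun w => if w == z then l else (f w - f z) / (w - z)); split.
- move=> e e0; have [d d0 hd] := h _ e0; exists d => // w wd.
  rewrite eqxx; case: eqVneq => [_|wz]; first by rewrite subrr cmod0.
  have := hd (w - z); rewrite subr_eq0 => /(_ wz wd).
  by rewrite addrCA subrr addr0.
- by rewrite eqxx.
- move=> w; case: eqVneq => [->|wz]; first by rewrite !subrr mulr0.
  by rewrite mulfVK // subr_eq0.
Qed.

Lemma has_cderiv_cont f z l : has_cderiv f z l -> ccont f z.
Proof.
move=> /has_cderivP[q [cq _ hq]].
have : ccont (fun w => f z + q w * (w - z)) z.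
  apply: ccontD; first exact: ccont_cst.
  apply: ccontM => //; apply: (@ccontD id (fun=> - z)); first exact: ccont_id.
  exact: ccont_cst.
by apply: (@ccont_near _ _ _ 1) => // w _; rewrite -hq addrC subrK.
Qed.

Lemma has_cderiv_near f g z l (r : R) : 0 < r ->
  (forall w, cmod (w - z) < r -> f w = g w) -> has_cderiv f z l -> has_cderiv g z l.
Proof.
move=> r0 fg h e e0; have [d d0 hd] := h _ e0.
exists (Num.min d r); first by rewrite lt_min d0.
move=> k k0; rewrite lt_min => /andP[kd kr].
rewrite -!fg ?subrr ?cmod0 //; first exact: hd.
by rewrite addrAC subrr add0r.
Qed.

Lemma has_cderiv_eq f z l m : l = m -> has_cderiv f z l -> has_cderiv f z m.
Proof. by move=> ->. Qed.

Lemma has_cderiv_ext f g z l : f =1 g -> has_cderiv f z l -> has_cderiv g z l.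
Proof. by move=> fg; apply: (@has_cderiv_near _ _ _ _ 1). Qed.

Lemma has_cderiv_cst l z : has_cderiv (fun _ => l) z 0.
Proof.
apply/has_cderivP; exists (fun=> 0); split=> [||w] //; first exact: ccont_cst.
by rewrite subrr mul0r.
Qed.

Lemma has_cderiv_id z : has_cderiv id z 1.
Proof.
apply/has_cderivP; exists (fun=> 1); split=> [||w] //; first exact: ccont_cst.
by rewrite mul1r.
Qed.

Lemma has_cderivD f g z l m : has_cderiv f z l -> has_cderiv g z m ->
  has_cderiv (fun w => f w + g w) z (l + m).
Proof.
move=> /has_cderivP[q [cq <- hq]] /has_cderivP[p [cp <- hp]].
apply/has_cderivP; exists (fun w => q w + p w); split=> [||w] //.
  exact: ccontD.
by rewrite mulrDl -hq -hp; ring.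
Qed.

Lemma has_cderivM f g z l m : has_cderiv f z l -> has_cderiv g z m ->
  has_cderiv (fun w => f w * g w) z (l * g z + f z * m).
Proof.
move=> fl gm; have cg := has_cderiv_cont gm.
move: fl gm => /has_cderivP[q [cq <- hq]] /has_cderivP[p [cp <- hp]].
apply/has_cderivP; exists (fun w => q w * g w + f z * p w); split=> [||w] //.
  by apply: ccontD; apply: ccontM => //; exact: ccont_cst.
have -> : (q w * g w + f z * p w) * (w - z) =
  (q w * (w - z)) * g w + f z * (p w * (w - z)) by ring.
by rewrite -hq -hp; ring.
Qed.

Lemma has_cderiv_comp f g z l m : has_cderiv f z l -> has_cderiv g (f z) m ->
  has_cderiv (fun w => g (f w)) z (m * l).
Proof.
move=> fl gm; have cf := has_cderiv_cont fl.
move: fl gm => /has_cderivP[q [cq <- hq]] /has_cderivP[p [cp <- hp]].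
apply/has_cderivP; exists (fun w => p (f w) * q w); split=> [||w] //.
  by apply: ccontM => //; exact: ccont_comp.
by rewrite -mulrA -hq -hp.
Qed.

Lemma has_cderivV z : z != 0 -> has_cderiv (fun w => w^-1) z (- z ^- 2).
Proof.
(* The criterion asks for its identity at every w, and 0^-1 = 0 breaks it at w = 0; the inverse is
   first altered there, to the value of its tangent at z, which changes nothing near z. *)
move=> z0; apply: (@has_cderiv_near (fun w => if w == 0 then z^-1 + (- z ^- 2) * (w - z) else w^-1) _ _ _ (cmod z)).
- by rewrite cmod_gt0.
- move=> w; case: eqVneq => [->|//]; by rewrite sub0r cmodN ltxx.
apply/has_cderivP; exists (fun w => if w == 0 then - z^-2 else - (w^-1 * z^-1)); split.
- apply: (@ccont_near (fun w => (- z^-1) * w^-1) _ _ (cmod z)); first by rewrite cmod_gt0.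
    move=> w; case: eqVneq => [->|w0 _]; first by rewrite sub0r cmodN ltxx.
    by rewrite mulrC mulrN.
  by apply: ccontM; [exact: ccont_cst|exact: ccontV].
- by rewrite (negbTE z0) expr2 invfM.
- move=> w; rewrite (negbTE z0); case: eqVneq => [->|w0].
    by rewrite addrAC subrr add0r.
  by field; rewrite w0 z0.
Qed.

Lemma has_cderivN f z l : has_cderiv f z l -> has_cderiv (fun w => - f w) z (- l).
Proof.
move=> h; have := has_cderivM (has_cderiv_cst (-1) z) h.
rewrite mul0r add0r mulN1r; apply: has_cderiv_ext => w; by rewrite mulN1r.
Qed.

Lemma has_cderivB f g z l m : has_cderiv f z l -> has_cderiv g z m ->
  has_cderiv (fun w => f w - g w) z (l - m).
Proof. by move=> fl /has_cderivN; exact: has_cderivD. Qed.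

Lemma has_cderivZ (c : R[i]) f z l : has_cderiv f z l ->
  has_cderiv (fun w => c * f w) z (c * l).
Proof.
by move=> h; have := has_cderivM (has_cderiv_cst c z) h; rewrite mul0r add0r.
Qed.

Lemma has_cderivX f z l n : has_cderiv f z l ->
  has_cderiv (fun w => f w ^+ n) z (n%:R * f z ^+ n.-1 * l).
Proof.
move=> h; elim: n => [|n IH].
  by rewrite !mul0r; apply: has_cderiv_cst.
have H := has_cderivM h IH.
apply: (has_cderiv_eq _ (has_cderiv_ext _ H)) => [|w]; last by rewrite exprS.
case: n {IH H} => [|n] /=; first by rewrite !expr0; ring.
by rewrite !exprS -[n.+2]addn1 -[n.+1]addn1 !natrD; ring.
Qed.

Lemma has_cderiv_div f g z l m : g z != 0 -> has_cderiv f z l -> has_cderiv g z m ->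
  has_cderiv (fun w => f w / g w) z ((l * g z - f z * m) / g z ^+ 2).
Proof.
move=> g0 hf hg; have := has_cderivM hf (has_cderiv_comp hg (has_cderivV g0)).
by apply: has_cderiv_eq; field.
Qed.

Lemma has_cderiv_unique f z l m : has_cderiv f z l -> has_cderiv f z m -> l = m.
Proof.
move=> fl fm; apply/eqP; rewrite -subr_eq0 -cmod_eq0; apply/negPn/negP => lm.
have e0 : 0 < cmod (l - m) / 2 by rewrite divr_gt0 // lt_def lm cmod_ge0.
have [d d0 h] := fl _ e0; have [d' d'0 h'] := fm _ e0.
pose k : R[i] := (Num.min d d' / 2)%:C%C.
have k0 : 0 < Num.min d d' / 2 by rewrite divr_gt0 // lt_min d0.
have kE : cmod k = Num.min d d' / 2 by rewrite cmod_real gtr0_norm.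
have kn : k != 0 by rewrite -cmod_gt0 kE.
have kd : cmod k < Num.min d d' by rewrite kE; lra.
move: kd; rewrite lt_min => /andP[/(h _ kn) a /(h' _ kn) b].
have := cmodB ((f (z + k) - f z) / k - m) ((f (z + k) - f z) / k - l).
have -> : (f (z + k) - f z) / k - m - ((f (z + k) - f z) / k - l) = l - m by ring.
by apply/negP; rewrite -ltNge [ltRHS]splitr addrC ltrD.
Qed.

Definition cderiv f z : R[i] := xget 0 [set l | has_cderiv f z l].

Lemma cderivE f z l : has_cderiv f z l -> cderiv f z = l.
Proof.
move=> h; rewrite /cderiv; case: xgetP => [y _ /= hy|/(_ l)//].
exact: has_cderiv_unique hy h.
Qed.

Lemma cderivP f z : (exists l, has_cderiv f z l) -> has_cderiv f z (cderiv f z).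
Proof. by case=> l h; rewrite (cderivE h). Qed.

Lemma holo_cderiv f z : holo_disk f -> disk z -> has_cderiv f z (cderiv f z).
Proof. by move=> hf /hf /cderivP. Qed.

End ComplexDerivative.

(** * Goursat's lemma on rectangles *)

Section SegmentCalculus.
Context {R : realType}.
Implicit Types (f : R[i] -> R[i]) (F psi dpsi : R -> R).

Lemma is_derive_dist F (t l : R) :
  (forall e, 0 < e -> exists2 d : R, 0 < d & forall h, h != 0 -> `|h| < d ->
     `|(F (t + h) - F t) / h - l| < e) -> is_derive (t : R) (1 : R) F l.
Proof.
move=> H.
have C : (fun h : R => h^-1 *: ((F \o shift t) (h *: (1:R)) - F t)) @ 0^' --> l.
  apply/cvgrPdist_lt => e e0; have [d d0 hd] := H e e0.
  near=> h.
  have h0 : h != 0 by near: h; exact: nbhs_dnbhs_neq.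
  have hd' : `|h| < d by near: h; apply: dnbhs0_lt.
  have := hd h h0 hd'; rewrite distrC /= [h *: 1]mulr1 [h + t]addrC.
  by rewrite [_^-1 *: _]mulrC.
by apply: DeriveDef; [apply/cvg_ex; exists l | apply/cvg_lim].
Unshelve. all: by end_near. Qed.

Lemma is_derive_Re f (t : R) (l : R[i]) : has_cderiv f t%:C%C l ->
  is_derive (t : R) (1 : R) (fun s : R => complex.Re (f s%:C%C)) (complex.Re l).
Proof.
move=> h; apply: is_derive_dist => e e0; have [d d0 hd] := h e e0.
exists d => // k k0 kd.
have := hd k%:C%C; rewrite cmod_real => /(_ _ kd) hh.
have kC : k%:C%C != 0 :> R[i] by rewrite -cmod_gt0 cmod_real normr_gt0.
apply: le_lt_trans (hh kC); apply: le_trans (abs_Re_le _).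
rewrite cReB mulrC -fmorphV mulrC [_ * (k^-1)%:C%C]mulrC Re_mul_real cReB rmorphD /=.
by rewrite mulrC.
Qed.

(** The real part of f, rotated so that the total increment is a nonnegative real, minus psi has
    nonpositive derivative, and the real mean value theorem applies. A general majorant psi is kept
    because growth along radii needs a logarithm, not only a linear function. *)
Lemma segment_majorant f (df : R -> R[i]) (p q : R[i]) psi dpsi :
  (forall t, 0 <= t <= 1 -> has_cderiv f (p + t%:C%C * q) (df t)) ->
  (forall t, 0 <= t <= 1 -> is_derive (t : R) (1 : R) psi (dpsi t)) ->
  (forall t, 0 <= t <= 1 -> cmod (df t * q) <= dpsi t) ->
  cmod (f (p + q) - f p) <= psi 1 - psi 0.
Proof.
move=> Hf Hpsi Hle.
have [c c1 hc] := unimodular_rotation (f (p + q) - f p).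
pose G := fun t : R => complex.Re (c * f (p + t%:C%C * q)).
have dG t : 0 <= t <= 1 -> is_derive (t : R) (1 : R) G (complex.Re (c * (df t * q))).
  move=> t01; apply: (@is_derive_Re (fun s => c * f (p + s * q))).
  apply: has_cderivZ.
  apply: (has_cderiv_comp (f := fun s => p + s * q) (l := q)); last exact: Hf.
  have := has_cderivD (has_cderiv_cst p t%:C%C)
    (has_cderivM (has_cderiv_id t%:C%C) (has_cderiv_cst q t%:C%C)).
  by apply: has_cderiv_eq; ring.
have dH t : 0 <= t <= 1 ->
    is_derive (t : R) (1 : R) (G \- psi) (complex.Re (c * (df t * q)) - dpsi t).
  by move=> t01; have := dG t t01; have := Hpsi t t01 => ? ?; apply: is_deriveB.
have [||x] := @MVT_segment R (G \- psi)
    (fun t => complex.Re (c * (df t * q)) - dpsi t) 0 1 ler01.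
- by move=> x; rewrite in_itv /= => /andP[x0 x1]; apply: dH; rewrite !ltW.
- apply: derivable_within_continuous => x; rewrite in_itv /= => x01.
  by have [] := dH x x01.
rewrite in_itv /= => x01; rewrite /G subr0 mulr1.
have -> : p + 1%:C%C * q = p + q by rewrite mul1r.
have -> : p + 0%:C%C * q = p by rewrite mul0r addr0.
have -> : complex.Re (c * f (p + q)) = complex.Re (c * (f (p + q) - f p)) + complex.Re (c * f p).
  by rewrite -cReD; congr (complex.Re _); ring.
rewrite hc /= => E.
have : complex.Re (c * (df x * q)) <= dpsi x.
  apply: le_trans (ler_norm _) _; apply: le_trans (abs_Re_le _) _.
  by rewrite cmodM c1 mul1r; exact: Hle.
by move: E; lra.
Qed.

Lemma segment_lipschitz f (df : R -> R[i]) (p q : R[i]) (M : R) :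
  (forall t, 0 <= t <= 1 -> has_cderiv f (p + t%:C%C * q) (df t)) ->
  (forall t, 0 <= t <= 1 -> cmod (df t) <= M) ->
  cmod (f (p + q) - f p) <= M * cmod q.
Proof.
move=> Hf HM.
have -> : M * cmod q = (M * cmod q) *: (1 : R) - (M * cmod q) *: (0 : R).
  by rewrite scaler0 subr0 [_ *: _]mulr1.
apply: (@segment_majorant _ df _ _ (fun t => (M * cmod q) *: t) (fun=> M * cmod q)) => //.
- by move=> t _; apply: is_derive_eq; rewrite [_ *: _]mulr1.
- by move=> t t01; rewrite cmodM ler_wpM2r ?cmod_ge0 // HM.
Qed.

End SegmentCalculus.

(** * Integrals over real intervals *)

Section IntervalIntegral.
Context {R : realType}.
Notation mu := (@lebesgue_measure R).
Implicit Types (F G : R -> R) (a b c : R).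

Definition itvint F a b : R := Rintegral mu `[a, b] F.

Definition itv_integrable F a b := mu.-integrable `[a, b] (EFin \o F).

Lemma itv_integrable_cst a b c : itv_integrable (fun=> c) a b.
Proof.
apply: continuous_compact_integrable; first exact: segment_compact.
by apply: continuous_subspaceT => x; exact: cst_continuous.
Qed.

Lemma itv_integrableD F G a b : itv_integrable F a b -> itv_integrable G a b ->
  itv_integrable (fun x => F x + G x) a b.
Proof. by move=> iF iG; apply: eq_integrable (integrableD _ iF iG). Qed.

Lemma itv_integrableB F G a b : itv_integrable F a b -> itv_integrable G a b ->
  itv_integrable (fun x => F x - G x) a b.
Proof. by move=> iF iG; apply: eq_integrable (integrableB _ iF iG). Qed.

Lemma itv_integrableZ c F a b : itv_integrable F a b ->
  itv_integrable (fun x => c * F x) a b.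
Proof. by move=> iF; apply: eq_integrable (integrableZl _ c iF). Qed.

Lemma itvintB F G a b : itv_integrable F a b -> itv_integrable G a b ->
  itvint (fun x => F x - G x) a b = itvint F a b - itvint G a b.
Proof. by move=> iF iG; rewrite /itvint RintegralB. Qed.

Lemma itvintD F G a b : itv_integrable F a b -> itv_integrable G a b ->
  itvint (fun x => F x + G x) a b = itvint F a b + itvint G a b.
Proof. by move=> iF iG; rewrite /itvint RintegralD. Qed.

Lemma itvintZ c F a b : itv_integrable F a b ->
  itvint (fun x => c * F x) a b = c * itvint F a b.
Proof. by move=> iF; rewrite /itvint RintegralZl. Qed.

Lemma itvint_cst c a b : a <= b -> itvint (fun=> c) a b = c * (b - a).
Proof.
move=> ab; rewrite /itvint Rintegral_cst //; congr (_ * _).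
rewrite [X in fine X]lebesgue_measure_itv /= lte_fin.
by move: ab; rewrite le_eqVlt => /predU1P[->|->//]; rewrite ltxx subrr.
Qed.

Lemma le_itvint F G a b : itv_integrable F a b -> itv_integrable G a b ->
  (forall x, a <= x <= b -> F x <= G x) -> itvint F a b <= itvint G a b.
Proof.
by move=> iF iG FG; apply: le_Rintegral => // x /=; rewrite in_itv /= => /FG.
Qed.

Lemma itvint_dist_le F a b c M : a <= b -> itv_integrable F a b ->
  (forall x, a <= x <= b -> `|F x - c| <= M) ->
  `|itvint F a b - c * (b - a)| <= M * (b - a).
Proof.
move=> ab iF hF.
have hM x : a <= x <= b -> c - M <= F x <= c + M.
  by move=> /hF; rewrite ler_norml; lra.
rewrite ler_norml; apply/andP; split.
- have : itvint (fun=> c - M) a b <= itvint F a b.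
    by apply: le_itvint => // [|x /hM/andP[]//]; exact: itv_integrable_cst.
  by rewrite itvint_cst //; lra.
- have : itvint F a b <= itvint (fun=> c + M) a b.
    by apply: le_itvint => // [|x /hM/andP[]//]; exact: itv_integrable_cst.
  by rewrite itvint_cst //; lra.
Qed.

Lemma itvint_cat F a b c : a <= b -> b <= c -> itv_integrable F a c ->
  itvint F a c = itvint F a b + itvint F b c.
Proof.
move=> ab bc iF; rewrite /itvint.
have iF' : mu.-integrable [set` Interval (BLeft a) (BRight c)] (EFin \o F) by [].
have := @Rintegral_itvB R F (BLeft a) (BRight c) b iF'.
rewrite !bnd_simp => /(_ ab bc) E.
rewrite -[X in _ + X]Rintegral_itv_obnd_cbnd; last first.
  apply: integrableS iF => // x /=; rewrite !in_itv /= => /andP[h1 ->].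
  by rewrite andbT (le_trans ab) // ltW.
by rewrite -E addrC subrK.
Qed.

End IntervalIntegral.

Section Goursat.
Context {R : realType}.
Notation mu := (@lebesgue_measure R).
Implicit Types (k : R[i] -> R[i]) (N : R[i] -> R) (x y a b : R).

(** [N] stands for the real part, the imaginary part or the modulus, and [j] for a horizontal or
    vertical side, so that one continuity argument serves every integrand on the contour. *)
Lemma line_integrable N k (j : R -> R[i]) a b :
  (forall z w, `|N z - N w| <= cmod (z - w)) ->
  (forall x x', cmod (j x - j x') = `|x - x'|) ->
  (forall x, a <= x <= b -> ccont k (j x)) ->
  itv_integrable (fun x => N (k (j x))) a b.
Proof.
move=> HN Hj Hk; apply: continuous_compact_integrable; first exact: segment_compact.
apply: continuous_in_subspaceT => x; rewrite inE /= in_itv /= => /Hk Hx.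
apply/cvgrPdist_lt => e e0; have [d d0 hd] := Hx e e0.
near=> y; apply: le_lt_trans (HN _ _) _; rewrite cmod_distC.
apply: hd; rewrite Hj distrC.
near: y; exact: (@cvgr_dist_lt _ _ _ _ _ id x (@cvg_id _ _) d d0).
Unshelve. all: by end_near. Qed.

Lemma hor_isometry y x x' : cmod (Complex x y - Complex x' y) = `|x - x'|.
Proof. by rewrite /cmod /= subrr expr0n addr0 sqrtr_sqr. Qed.

Lemma ver_isometry x y y' : cmod (Complex x y - Complex x y') = `|y - y'|.
Proof. by rewrite /cmod /= subrr expr0n add0r sqrtr_sqr. Qed.

Lemma Re_lip (z w : R[i]) : `|complex.Re z - complex.Re w| <= cmod (z - w).
Proof. by rewrite -cReB abs_Re_le. Qed.

Lemma Im_lip (z w : R[i]) : `|complex.Im z - complex.Im w| <= cmod (z - w).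
Proof. by rewrite -cImB abs_Im_le. Qed.

Lemma cmod_lip (z w : R[i]) : `|cmod z - cmod w| <= cmod (z - w).
Proof.
have h1 := cmod_lerB z w; have := cmod_lerB w z; rewrite cmod_distC ler_norml; lra.
Qed.

Definition hcont k y a b := forall x, a <= x <= b -> ccont k (Complex x y).
Definition vcont k x a b := forall y, a <= y <= b -> ccont k (Complex x y).

(* The real part of the contour integral of [k] around the rectangle; a unimodular
   factor in [k] selects the component needed. *)
Definition rect_int k x0 x1 y0 y1 : R :=
  itvint (fun x => complex.Re (k (Complex x y0)) - complex.Re (k (Complex x y1))) x0 x1
  - itvint (fun y => complex.Im (k (Complex x1 y)) - complex.Im (k (Complex x0 y))) y0 y1.

Lemma hcont_integrable N k y a b : (forall z w, `|N z - N w| <= cmod (z - w)) ->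
  hcont k y a b -> itv_integrable (fun x => N (k (Complex x y))) a b.
Proof. move=> HN Hk; apply: (@line_integrable N k (fun x => Complex x y)) => // x x'.
exact: hor_isometry. Qed.

Lemma vcont_integrable N k x a b : (forall z w, `|N z - N w| <= cmod (z - w)) ->
  vcont k x a b -> itv_integrable (fun y => N (k (Complex x y))) a b.
Proof. move=> HN Hk; apply: (@line_integrable N k (fun y => Complex x y)) => // y y'.
exact: ver_isometry. Qed.

Lemma rect_int_splitx k x0 x1 x2 y0 y1 : x0 <= x1 -> x1 <= x2 ->
  hcont k y0 x0 x2 -> hcont k y1 x0 x2 ->
  vcont k x0 y0 y1 -> vcont k x1 y0 y1 -> vcont k x2 y0 y1 ->
  rect_int k x0 x2 y0 y1 = rect_int k x0 x1 y0 y1 + rect_int k x1 x2 y0 y1.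
Proof.
move=> x01 x12 h0 h1 v0 v1 v2; rewrite /rect_int (@itvint_cat _ _ x0 x1 x2) //; last first.
  by apply: itv_integrableB; apply: hcont_integrable => //; exact: Re_lip.
have iv x : vcont k x y0 y1 -> itv_integrable (fun y => complex.Im (k (Complex x y))) y0 y1.
  by apply: vcont_integrable; exact: Im_lip.
by rewrite (itvintB (iv _ v2) (iv _ v0)) (itvintB (iv _ v1) (iv _ v0)) (itvintB (iv _ v2) (iv _ v1)); ring.
Qed.

Lemma rect_int_splity k x0 x1 y0 y1 y2 : y0 <= y1 -> y1 <= y2 ->
  vcont k x0 y0 y2 -> vcont k x1 y0 y2 ->
  hcont k y0 x0 x1 -> hcont k y1 x0 x1 -> hcont k y2 x0 x1 ->
  rect_int k x0 x1 y0 y2 = rect_int k x0 x1 y0 y1 + rect_int k x0 x1 y1 y2.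
Proof.
move=> y01 y12 h0 h1 v0 v1 v2; rewrite /rect_int [X in _ - X](@itvint_cat _ _ y0 y1 y2) //; last first.
  by apply: itv_integrableB; apply: vcont_integrable => //; exact: Im_lip.
have iv y : hcont k y x0 x1 -> itv_integrable (fun x => complex.Re (k (Complex x y))) x0 x1.
  by apply: hcont_integrable; exact: Re_lip.
by rewrite (itvintB (iv _ v0) (iv _ v2)) (itvintB (iv _ v0) (iv _ v1)) (itvintB (iv _ v1) (iv _ v2)); ring.
Qed.

(** An affine function contributes [c1] to each horizontal difference and [c2] to each vertical one,
    and the two totals are both Im l times the area of the rectangle, so they cancel; only the
    deviations, at most 2 e per pair of opposite sides, remain. *)
Lemma rect_int_near_affine k (p l : R[i]) x0 x1 y0 y1 e : x0 <= x1 -> y0 <= y1 ->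
  hcont k y0 x0 x1 -> hcont k y1 x0 x1 -> vcont k x0 y0 y1 -> vcont k x1 y0 y1 ->
  (forall x y, x0 <= x <= x1 -> y0 <= y <= y1 ->
    cmod (k (Complex x y) - (p + l * Complex x y)) <= e) ->
  `|rect_int k x0 x1 y0 y1| <= 2 * e * ((x1 - x0) + (y1 - y0)).
Proof.
move=> x01 y01 h0 h1 v0 v1 H; rewrite /rect_int.
set F := fun x : R => _; set G := fun y : R => _.
pose c1 := complex.Im l * (y1 - y0); pose c2 := complex.Im l * (x1 - x0).
have A : `|itvint F x0 x1 - c1 * (x1 - x0)| <= (2 * e) * (x1 - x0).
  apply: itvint_dist_le => //.
    by apply: itv_integrableB; apply: hcont_integrable => //; exact: Re_lip.
  move=> x hx.
  have -> : F x - c1 = complex.Re ((k (Complex x y0) - (p + l * Complex x y0))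
      - (k (Complex x y1) - (p + l * Complex x y1))).
    by rewrite /F /c1 !cReB !cReD !cReM /=; ring.
  apply: le_trans (abs_Re_le _) _; apply: le_trans (cmodB _ _) _.
  by rewrite mulr2n mulrDl mul1r lerD // H // ?lexx ?y01 ?lexx.
have B : `|itvint G y0 y1 - c2 * (y1 - y0)| <= (2 * e) * (y1 - y0).
  apply: itvint_dist_le => //.
    by apply: itv_integrableB; apply: vcont_integrable => //; exact: Im_lip.
  move=> y hy.
  have -> : G y - c2 = complex.Im ((k (Complex x1 y) - (p + l * Complex x1 y))
      - (k (Complex x0 y) - (p + l * Complex x0 y))).
    by rewrite /G /c2 !cImB !cImD !cImM /=; ring.
  apply: le_trans (abs_Im_le _) _; apply: le_trans (cmodB _ _) _.
  by rewrite mulr2n mulrDl mul1r lerD // H // ?lexx ?x01 ?lexx.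
have -> : itvint F x0 x1 - itvint G y0 y1 =
  (itvint F x0 x1 - c1 * (x1 - x0)) - (itvint G y0 y1 - c2 * (y1 - y0)).
  by rewrite /c1 /c2; ring.
by apply: le_trans (ler_normB _ _) _; rewrite [leRHS]mulrDr lerD.
Qed.

Lemma pow2_small (a e : R) : 0 < e -> exists n : nat, a / 2 ^+ n < e.
Proof.
move=> e0; exists (Num.truncn (`|a| / e)).+1.
rewrite ltr_pdivrMr ?exprn_gt0 //; apply: le_lt_trans (ler_norm a) _.
rewrite mulrC -ltr_pdivrMr //; apply: lt_le_trans (_ : (Num.truncn (`|a| / e)).+1%:R <= _).
  exact: truncnS_gt.
by rewrite -natrX ler_nat ltnW // ltn_expl.
Qed.

Lemma nested_intervals (Z L : nat -> R) : (forall n, 0 <= L n) ->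
  (forall n, Z n <= Z n.+1 /\ Z n.+1 + L n.+1 <= Z n + L n) ->
  exists q, forall n, Z n <= q <= Z n + L n.
Proof.
move=> L0 HZ.
have up m n : Z n <= Z (n + m)%N /\ Z (n + m)%N + L (n + m)%N <= Z n + L n.
  elim: m => [|m [IH1 IH2]]; first by rewrite addn0.
  rewrite addnS; have [h1 h2] := HZ (n + m)%N.
  by split; [exact: le_trans h1|exact: le_trans IH2].
have cross n m : Z n <= Z m + L m.
  case: (leqP n m) => nm.
    have [h _] := up (m - n)%N n; rewrite subnKC // in h.
    by apply: le_trans h _; rewrite lerDl.
  have [_ h] := up (n - m)%N m; rewrite subnKC ?(ltnW nm) // in h.
  by apply: le_trans h; rewrite lerDl.
exists (sup (range Z)) => n; apply/andP; split.
  apply: ub_le_sup; last by exists n.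
  by exists (Z 0%N + L 0%N) => _ [m _ <-].
by apply: ge_sup; [exists (Z 0%N); exists 0%N|move=> _ [m _ <-]].
Qed.

Lemma rect_int_quarter k x y h v : 0 <= h -> 0 <= v ->
  (forall s t, x <= s <= x + h + h -> y <= t <= y + v + v -> ccont k (Complex s t)) ->
  exists x' y', [/\ x' = x \/ x' = x + h, y' = y \/ y' = y + v &
    `|rect_int k x (x + h + h) y (y + v + v)| <=
      4 * `|rect_int k x' (x' + h) y' (y' + v)|].
Proof.
move=> h0 v0 ck.
have xh : x <= x + h by rewrite lerDl.
have xhh : x + h <= x + h + h by rewrite lerDl.
have yv : y <= y + v by rewrite lerDl.
have yvv : y + v <= y + v + v by rewrite lerDl.
have xx := le_trans xh xhh; have yy := le_trans yv yvv.
rewrite (@rect_int_splitx k x (x + h)) //;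
  try by move=> t ht; apply: ck; rewrite ?lexx ?xx ?yy ?xh ?yv // (andP ht).1 ?(andP ht).2.
rewrite (@rect_int_splity k x (x + h) y (y + v)) //;
  try by move=> t /andP[t1 t2]; apply: ck; rewrite ?lexx ?xx ?yy ?xh ?yv ?xhh ?yvv ?t1 ?t2 //
    ?(le_trans t2).
rewrite (@rect_int_splity k (x + h) (x + h + h) y (y + v)) //;
  try by move=> t /andP[t1 t2]; apply: ck; rewrite ?lexx ?xx ?yy ?xh ?yv ?xhh ?yvv ?t1 ?t2 //
    ?(le_trans _ t1).
set J1 := rect_int k x (x + h) y (y + v).
set J2 := rect_int k x (x + h) (y + v) (y + v + v).
set J3 := rect_int k (x + h) (x + h + h) y (y + v).
set J4 := rect_int k (x + h) (x + h + h) (y + v) (y + v + v).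
have Hab : `|J1 + J2 + (J3 + J4)| <= `|J1| + `|J2| + (`|J3| + `|J4|).
  by apply: le_trans (ler_normD _ _) _; rewrite lerD // ler_normD.
have [l1|l1] := leP `|J1 + J2 + (J3 + J4)| (4 * `|J1|).
  by exists x, y; split=> //; left.
have [l2|l2] := leP `|J1 + J2 + (J3 + J4)| (4 * `|J2|).
  by exists x, (y + v); split=> //; [left|right].
have [l3|l3] := leP `|J1 + J2 + (J3 + J4)| (4 * `|J3|).
  by exists (x + h), y; split=> //; [right|left].
exists (x + h), (y + v); split; [by right|by right|].
rewrite -/J4; clear -Hab l1 l2 l3; lra.
Qed.

(** Repeated bisection keeps a quarter carrying at least a quarter of the integral; the quarters
    shrink to a point, where differentiability makes the integrand nearly affine. *)
Theorem goursat_rect k x0 x1 y0 y1 : x0 <= x1 -> y0 <= y1 ->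
  (forall x y, x0 <= x <= x1 -> y0 <= y <= y1 -> exists l, has_cderiv k (Complex x y) l) ->
  rect_int k x0 x1 y0 y1 = 0.
Proof.
move=> x01 y01 Hk.
have ck x y : x0 <= x <= x1 -> y0 <= y <= y1 -> ccont k (Complex x y).
  by move=> hx hy; have [l /has_cderiv_cont] := Hk x y hx hy.
pose a := x1 - x0; pose b := y1 - y0.
have a0 : 0 <= a by rewrite subr_ge0.
have b0 : 0 <= b by rewrite subr_ge0.
pose w (n : nat) : R := (2 ^+ n)^-1.
have w0 n : 0 < w n by rewrite invr_gt0 exprn_gt0.
have wS n (c : R) : c * w n = c * w n.+1 + c * w n.+1.
  by rewrite /w exprS invfM; set t := (2 ^+ n)^-1; field.
have aw n : 0 <= a * w n by rewrite mulr_ge0 // ltW.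
have bw n : 0 <= b * w n by rewrite mulr_ge0 // ltW.
pose J n x y := rect_int k x (x + a * w n) y (y + b * w n).
pose inside n x y := [/\ x0 <= x, x + a * w n <= x1, y0 <= y & y + b * w n <= y1].
(* Dependent choice wants a successor for every state, so the conclusion is made conditional on the
   rectangle lying [inside]; other states may stay where they are. *)
pose step (s s' : nat * R * R) := let: (n, x, y) := s in let: (n', x', y') := s' in
  inside n x y -> [/\ n' = n.+1, `|J n x y| <= 4 * `|J n.+1 x' y'|,
     x <= x' /\ x' + a * w n.+1 <= x + a * w n & y <= y' /\ y' + b * w n.+1 <= y + b * w n].
have Hstep s : {s' | step s s'}.
  apply: cid; move: s => [[n x] y].
  have [[hx0 hx1 hy0 hy1]|ni] := pselect (inside n x y); last by exists (n, x, y).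
  have [|x' [y' [hx' hy' HJ]]] := @rect_int_quarter k x y (a * w n.+1) (b * w n.+1) (aw _) (bw _).
    rewrite -!addrA -!wS => s t /andP[s1 s2] /andP[t1 t2].
    by apply: ck; rewrite ?(le_trans _ s1) ?(le_trans s2) ?(le_trans _ t1) ?(le_trans t2).
  rewrite -!addrA -!wS in HJ.
  exists (n.+1, x', y') => _; split=> //.
    by case: hx' => ->; rewrite (wS n) ?addrA ?lexx ?lerDl ?aw // lerDl aw.
  by case: hy' => ->; rewrite (wS n) ?addrA ?lexx ?lerDl ?bw // lerDl bw.
have [S [S0 SS]] := dependent_choice Hstep (0%N, x0, y0).
pose X n := (S n).1.2; pose Y n := (S n).2.
have X0 : X 0%N = x0 by rewrite /X S0.
have Y0 : Y 0%N = y0 by rewrite /Y S0.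
have invS n : (S n = (n, X n, Y n) /\ inside n (X n) (Y n)) /\
    `|rect_int k x0 x1 y0 y1| <= 4 ^+ n * `|J n (X n) (Y n)|.
  elim: n => [|n [[IH1 IH2] IH3]].
    rewrite X0 Y0 S0 /inside /J; have -> : w 0%N = 1 by rewrite /w expr0 invr1.
    by rewrite !mulr1 /a /b !(addrC _ (_ - _)) !subrK expr0 mul1r !lexx.
  have := SS n; rewrite IH1 /X /Y; case: (S n.+1) => [[m' x'] y'] /(_ IH2)[-> h1 [h2 h3] [h4 h5]] /=.
  case: IH2 => q1 q2 q3 q4; split; first split=> //.
    by split; rewrite ?(le_trans q1) ?(le_trans q3) ?(le_trans h3) ?(le_trans h5).
  by apply: le_trans IH3 _; rewrite exprSr -mulrA ler_wpM2l // exprn_ge0.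
have nestS n : (X n <= X n.+1 /\ X n.+1 + a * w n.+1 <= X n + a * w n) /\
   (Y n <= Y n.+1 /\ Y n.+1 + b * w n.+1 <= Y n + b * w n).
  have := SS n; have [[-> hi] _] := invS n; have [[-> _] _] := invS n.+1.
  by move=> /(_ hi)[].
have [px hpx] := nested_intervals aw (fun n => (nestS n).1).
have [py hpy] := nested_intervals bw (fun n => (nestS n).2).
have [l Hl] : exists l, has_cderiv k (Complex px py) l.
  have [[_ [q1 q2 q3 q4]] _] := invS 0%N; have /andP[r1 r2] := hpx 0%N.
  have /andP[r3 r4] := hpy 0%N.
  by apply: Hk; rewrite ?(le_trans q1) ?(le_trans q3) ?(le_trans r2) ?(le_trans r4).
have [q [cq ql hq]] := (has_cderivP _ _ _).1 Hl.
(* At stage n the deviation from the affine approximation is at most e times the size (a + b) w(n),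
   and the side lengths bring the same factor again; since w(n) = 2^-n this exactly pays for the
   factor 4^n. *)
have main e : 0 < e -> `|rect_int k x0 x1 y0 y1| <= 2 * e * (a + b) ^+ 2.
  move=> e0; have [d d0 hd] := cq e e0.
  have [n dw] := pow2_small (a + b) d0.
  have [[_ [q1 q2 q3 q4]] q5] := invS n; apply: le_trans q5 _.
  have /andP[r1 r2] := hpx n; have /andP[r3 r4] := hpy n.
  have xx : X n <= X n + a * w n by rewrite lerDl.
  have yy : Y n <= Y n + b * w n by rewrite lerDl.
  have ckn x y : X n <= x <= X n + a * w n -> Y n <= y <= Y n + b * w n ->
      ccont k (Complex x y).
    move=> /andP[s1 s2] /andP[t1 t2].
    by apply: ck; rewrite ?(le_trans _ s1) ?(le_trans s2) ?(le_trans _ t1) ?(le_trans t2).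
  have : `|J n (X n) (Y n)| <= 2 * (e * ((a + b) * w n)) *
     ((X n + a * w n - X n) + (Y n + b * w n - Y n)).
    apply: (@rect_int_near_affine k (k (Complex px py) - l * Complex px py) l) => //;
      try by move=> t ht; apply: ckn; rewrite ?lexx ?xx ?yy.
    move=> x y /andP[s1 s2] /andP[t1 t2].
    have near_p : cmod (Complex x y - Complex px py) <= (a + b) * w n.
      apply: le_trans (cmod_le_ReIm _) _ => /=; rewrite mulrDl.
      apply: lerD; rewrite ler_norml.
        by clear -r1 r2 s1 s2; lra.
      by clear -r3 r4 t1 t2; lra.
    have -> : k (Complex x y) - (k (Complex px py) - l * Complex px py + l * Complex x y)
       = (q (Complex x y) - q (Complex px py)) * (Complex x y - Complex px py).
      by rewrite mulrBl -hq ql; ring.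
    rewrite cmodM ler_pM ?cmod_ge0 // ltW // hd //; exact: le_lt_trans near_p dw.
  have -> : (X n + a * w n - X n) + (Y n + b * w n - Y n) = (a + b) * w n by ring.
  move=> HJ; have h4 : 0 <= 4 ^+ n :> R by rewrite exprn_ge0.
  apply: le_trans (ler_wpM2l h4 HJ) _.
  have -> : 4 ^+ n * (2 * (e * ((a + b) * w n)) * ((a + b) * w n)) =
     2 * e * (a + b) ^+ 2 * ((2 * 2) ^+ n * (w n * w n)).
    have -> : 2 * 2 = 4 :> R by ring.
    by ring.
  by rewrite exprMn /w -invfM mulfV ?mulr1 // mulf_neq0 // expf_neq0 // pnatr_eq0.
apply/eqP; rewrite -normr_le0; apply/ler_addgt0Pr => e e0; rewrite add0r.
have c0 : 0 < 2 * (a + b) ^+ 2 + 1 by rewrite ltr_wpDl // mulr_ge0 // sqr_ge0.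
apply: le_trans (main (e / (2 * (a + b) ^+ 2 + 1)) _) _; first by rewrite divr_gt0.
set D := 2 * (a + b) ^+ 2 + 1.
have -> : 2 * (e / D) * (a + b) ^+ 2 = e * (2 * (a + b) ^+ 2) / D by ring.
by rewrite ler_pdivrMr // ler_pM2l // /D lerDl ler01.
Qed.

End Goursat.

(** * Cauchy estimates in terms of area integrals *)

Section PlaneMeasure.
Context {R : realType}.
Notation mu := (@lebesgue_measure R).
Notation mu2 := (mu \x mu)%E.
Implicit Types (O : set R[i]) (k h : R[i] -> R[i]).

Definition plane O : set (R * R) := [set p : R * R | O (Complex p.1 p.2)].

Definition copen O := forall z, O z -> exists2 d : R, 0 < d &
  forall w, cmod (w - z) < d -> O w.

(** No measurability is assumed: the integral of a nonnegative function is a supremum over simple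
    functions below it, hence monotone in any case. This permits area integrals over sets such as
    [Eset] without a measurability proof. *)
Lemma le_integral_ge0 d (T : measurableType d) (m : {measure set T -> \bar R})
  (D : set T) (f g : T -> \bar R) :
  (forall x, D x -> (0 <= f x)%E) -> (forall x, D x -> (f x <= g x)%E) ->
  (\int[m]_(x in D) f x <= \int[m]_(x in D) g x)%E.
Proof.
move=> f0 fg; rewrite !ge0_integralE //; last first.
  by move=> x Dx; apply: le_trans (fg x Dx); exact: f0.
apply: ge_ereal_sup => _ [s /= hs <-]; apply: ereal_sup_ubound; exists s => // x.
apply: le_trans (hs x) _; rewrite /patch; case: ifPn => // /set_mem; exact: fg.
Qed.

(** The sigma-algebra is the product one, so an open set is written as the countable union of the
    rational squares it contains. *)
Lemma measurable_plane O : copen O -> measurable (plane O).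
Proof.
move=> oO.
pose box (i : rat * rat * nat) : set (R * R) :=
  `](ratr i.1.1 - i.2.+1%:R^-1 : R), (ratr i.1.1 + i.2.+1%:R^-1)[ `*`
  `](ratr i.1.2 - i.2.+1%:R^-1 : R), (ratr i.1.2 + i.2.+1%:R^-1)[.
pose F i := if `[< box i `<=` plane O >] then box i else set0.
have -> : plane O = \bigcup_i F i.
  apply/seteqP; split=> [[x y] /= Oxy|p [i _]]; last first.
    by rewrite /F; case: asboolP => // /(_ p).
  have [d d0 hd] := oO _ Oxy.
  (* The centre of the square is within r of each coordinate of the point, so other points of the
     square are within 2 r per coordinate, and within 4 r in modulus. *)
  have [n hn] : exists n : nat, 4 * n.+1%:R^-1 < d.
    exists (Num.truncn (4 / d)).
    rewrite ltr_pdivrMr ?ltr0Sn // mulrC -ltr_pdivrMr //; exact: truncnS_gt.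
  set r : R := n.+1%:R^-1 in hn.
  have r0 : 0 < r by rewrite invr_gt0 ltr0Sn.
  have [q1] := @rat_in_itvoo R (x - r) (x + r) ltac:(lra).
  rewrite in_itv /= => hq1.
  have [q2] := @rat_in_itvoo R (y - r) (y + r) ltac:(lra).
  rewrite in_itv /= => hq2.
  exists (q1, q2, n) => //; rewrite /F; case: asboolP => [_|[]].
    by split; rewrite /= in_itv /= -/r; lra.
  move=> [s t] [/=]; rewrite !in_itv /= -/r => h1 h2; apply: hd.
  apply: le_lt_trans (cmod_le_ReIm _) _ => /=.
  have a1 : `|s - x| <= 2 * r by rewrite ler_norml; lra.
  have a2 : `|t - y| <= 2 * r by rewrite ler_norml; lra.
  lra.
apply: countable_bigcupT_measurable => // i; rewrite /F; case: asboolP => // _.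
exact: measurableX.
Qed.

Lemma measurable_fun_plane O (N : R[i] -> R) h : copen O ->
  (forall z w, `|N z - N w| <= cmod (z - w)) -> (forall z, O z -> ccont h z) ->
  measurable_fun (plane O) (fun p : R * R => N (h (Complex p.1 p.2))).
Proof.
move=> oO HN ch; apply: (measurability _ (RGenOpens.measurableE R)).
move=> _ [_ [a [b ->] <-]].
have -> : plane O `&` (fun p : R * R => N (h (Complex p.1 p.2))) @^-1` `]a, b[%classic
   = plane [set z | O z /\ a < N (h z) < b].
  by apply/seteqP; split=> p /=; rewrite in_itv.
apply: measurable_plane => z [Oz /andP[az zb]].
have [d1 d10 h1] := oO z Oz.
have [d2 d20 h2] := ch z Oz (Num.min (N (h z) - a) (b - N (h z))) ltac:(by rewrite lt_min !subr_gt0 az).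
exists (Num.min d1 d2); first by rewrite lt_min d10.
move=> w; rewrite lt_min => /andP[/h1 Ow /h2]; rewrite lt_min => /andP[wa wb].
split=> //; have := HN (h w) (h z); rewrite ler_norml => /andP[e1 e2].
by apply/andP; split; lra.
Qed.

Lemma copen_disk : copen (disk : set R[i]).
Proof.
move=> z /= z1; exists (1 - cmod z); first by rewrite subr_gt0.
move=> w hw; have := cmodD (w - z) z; rewrite subrK /disk /=; lra.
Qed.

Lemma holo_ccont h z : holo_disk h -> disk z -> ccont h z.
Proof. by move=> hh /hh[l /has_cderiv_cont]. Qed.

End PlaneMeasure.

(** * The Cauchy estimate on a rectangle *)

Section CauchyEstimate.
Context {R : realType}.
Notation mu := (@lebesgue_measure R).
Notation mu2 := (mu \x mu)%E.
Implicit Types (k h : R[i] -> R[i]).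

(** The left, right, bottom and top strips around the small square avoid the origin, so Goursat's
    lemma removes them one after another. *)
Lemma rect_int_shrink k (x0 x1 y0 y1 t : R) : 0 < t ->
  x0 <= - t -> t <= x1 -> y0 <= - t -> t <= y1 ->
  (forall x y, x0 <= x <= x1 -> y0 <= y <= y1 -> Complex x y != 0 ->
     exists l, has_cderiv k (Complex x y) l) ->
  rect_int k x0 x1 y0 y1 = rect_int k (- t) t (- t) t.
Proof.
move=> t0 hx0 hx1 hy0 hy1 Hk.
have tt : - t <= t by rewrite ge0_cp // ltW.
have x0t := le_trans hx0 tt; have y0t := le_trans hy0 tt.
have x1t := le_trans tt hx1; have y1t := le_trans tt hy1.
have nz (x y : R) : x != 0 \/ y != 0 -> Complex x y != 0.
  by rewrite eq_complex /= negb_and => -[->|->]; rewrite ?orbT.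
have D x y : x0 <= x <= x1 -> y0 <= y <= y1 -> x != 0 \/ y != 0 ->
    exists l, has_cderiv k (Complex x y) l by move=> hx hy /nz; exact: Hk.
have C x y : x0 <= x <= x1 -> y0 <= y <= y1 -> x != 0 \/ y != 0 -> ccont k (Complex x y).
  by move=> hx hy n; have [l /has_cderiv_cont] := D x y hx hy n.
have tn : t != 0 by rewrite gt_eqF.
have ntn : - t != 0 by rewrite oppr_eq0.
have x0n : x0 != 0 by rewrite lt_eqF // (le_lt_trans hx0) // oppr_lt0.
have y0n : y0 != 0 by rewrite lt_eqF // (le_lt_trans hy0) // oppr_lt0.
have x1n : x1 != 0 by rewrite gt_eqF // (lt_le_trans t0).
have y1n : y1 != 0 by rewrite gt_eqF // (lt_le_trans t0).
rewrite (@rect_int_splitx _ k x0 (- t)) //; first last.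
- by move=> y hy; apply: C => //; [rewrite (le_trans hx0)//= lexx|left].
- by move=> y hy; apply: C => //; [rewrite hx0|left].
- by move=> y hy; apply: C => //; [rewrite lexx (le_trans hx0)|left].
- by move=> x hx; apply: C => //; [rewrite lexx (le_trans hy0)|right].
- by move=> x hx; apply: C => //; [rewrite lexx (le_trans hy0)|right].
rewrite (@goursat_rect _ k x0 (- t)) //; [|exact: le_trans hy1|]; last first.
  move=> x y /andP[hx1' hx2'] hy; apply: D => //; first by rewrite hx1' (le_trans hx2').
  by left; rewrite lt_eqF // (le_lt_trans hx2') // oppr_lt0.
rewrite add0r (@rect_int_splitx _ k (- t) t) //; first last.
- by move=> y hy; apply: C => //; [rewrite lexx (le_trans x0t)|left].
- by move=> y hy; apply: C => //; [rewrite hx1 x0t|left].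
- by move=> y hy; apply: C => //; [rewrite hx0 x1t|left].
- by move=> x /andP[a b]; apply: C => //; [rewrite (le_trans hx0)|rewrite lexx (le_trans y0t)|right].
- by move=> x /andP[a b]; apply: C => //; [rewrite (le_trans hx0)|rewrite lexx (le_trans y0t)|right].
rewrite [X in _ + X](@goursat_rect _ k t) //; [|exact: le_trans hy1|]; last first.
  move=> x y /andP[hx1' hx2'] hy; apply: D => //; first by rewrite hx2' (le_trans x0t).
  by left; rewrite gt_eqF // (lt_le_trans t0).
have F x : - t <= x <= t -> x0 <= x <= x1.
  by move=> /andP[a b]; rewrite (le_trans hx0 a) (le_trans b).
rewrite addr0 (@rect_int_splity _ k (- t) t y0 (- t)) //; first last.
- by move=> x /F hx; apply: C => //; [rewrite lexx (le_trans y0t)|right].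
- by move=> x /F hx; apply: C => //; [rewrite hy0 y1t|right].
- by move=> x /F hx; apply: C => //; [rewrite lexx (le_trans y0t)|right].
- by move=> y hy; apply: C => //; [apply: F; rewrite tt lexx|left].
- by move=> y hy; apply: C => //; [apply: F; rewrite tt lexx|left].
rewrite (@goursat_rect _ k (- t) t y0) //; last first.
  move=> x y /F hx /andP[a b]; apply: D => //; first by rewrite a (le_trans b).
  by right; rewrite lt_eqF // (le_lt_trans b) // oppr_lt0.
rewrite add0r (@rect_int_splity _ k (- t) t (- t) t) //; first last.
- by move=> x /F hx; apply: C => //; [rewrite lexx (le_trans y0t)|right].
- by move=> x /F hx; apply: C => //; [rewrite hy1 y0t|right].
- by move=> x /F hx; apply: C => //; [rewrite hy0 y1t|right].
- by move=> y /andP[a b]; apply: C => //; [apply: F; rewrite tt lexx|rewrite b (le_trans hy0)|left].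
- by move=> y /andP[a b]; apply: C => //; [apply: F; rewrite tt lexx|rewrite b (le_trans hy0)|left].
rewrite [X in _ + X](@goursat_rect _ k (- t) t t) //; last first.
  move=> x y /F hx /andP[a b]; apply: D => //; first by rewrite b (le_trans y0t).
  by right; rewrite gt_eqF // (lt_le_trans t0).
by rewrite addr0.
Qed.

Lemma itvint_ge (F : R -> R) a b c : a <= b -> itv_integrable F a b ->
  (forall x, a <= x <= b -> c <= F x) -> c * (b - a) <= itvint F a b.
Proof.
by move=> ab iF h; rewrite -itvint_cst //; apply: le_itvint => //; exact: itv_integrable_cst.
Qed.

Lemma itvint_le (F : R -> R) a b c : a <= b -> itv_integrable F a b ->
  (forall x, a <= x <= b -> F x <= c) -> itvint F a b <= c * (b - a).
Proof.
by move=> ab iF h; rewrite -itvint_cst //; apply: le_itvint => //; exact: itv_integrable_cst.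
Qed.

(* On the square of half-side [t] the kernel [-i m / z] contributes at least
   [m] to each of the four sides, so an [o(1/|z|)] perturbation cannot
   bring the integral below [4 m]. *)
Lemma rect_int_square_lower k (m e t : R) : 0 <= m -> 0 < t ->
  (forall z, z != 0 -> cmod z <= 2 * t -> ccont k z) ->
  (forall z, z != 0 -> cmod z <= 2 * t ->
     cmod (k z - Complex 0 (- m) / z) <= e / cmod z) ->
  4 * m - 8 * e <= rect_int k (- t) t (- t) t.
Proof.
move=> m0 t0 ck hk.
have tt : - t <= t by rewrite ge0_cp // ltW.
have tn : t != 0 by rewrite gt_eqF.
have onsq x y : - t <= x <= t -> - t <= y <= t -> `|x| = t \/ `|y| = t ->
  [/\ Complex x y != 0, cmod (Complex x y) <= 2 * t & t <= cmod (Complex x y)].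
  move=> hx hy hxy; have h3 : t <= cmod (Complex x y).
    by case: hxy => <-; [exact: (abs_Re_le (Complex x y))|exact: (abs_Im_le (Complex x y))].
  split=> //; first by rewrite -cmod_gt0 (lt_le_trans t0).
  apply: le_trans (cmod_le_ReIm _) _ => /=.
  have a1 : `|x| <= t by rewrite ler_norml.
  have a2 : `|y| <= t by rewrite ler_norml.
  by rewrite mulr2n mulrDl mul1r lerD.
have e0 : 0 <= e.
  have [|||a b c] := onsq t 0; rewrite ?lexx ?tt ?oppr_le0 ?(ltW t0) //.
    by left; rewrite gtr0_norm.
  have := le_trans (cmod_ge0 _) (hk _ a b).
  by rewrite pmulr_lge0 // invr_gt0 (lt_le_trans t0).
have nt : `|t| = t by rewrite gtr0_norm.
have nnt : `|- t| = t by rewrite normrN.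
have est x y : - t <= x <= t -> - t <= y <= t -> `|x| = t \/ `|y| = t ->
   cmod (k (Complex x y) - Complex 0 (- m) / Complex x y) <= e / t.
  move=> hx hy hxy; have [a b c] := onsq x y hx hy hxy.
  apply: le_trans (hk _ a b) _; rewrite ler_wpM2l // lef_pV2 // posrE //.
  exact: lt_le_trans t0 c.
have tin : - t <= t <= t by rewrite lexx tt.
have ntin : - t <= - t <= t by rewrite lexx tt.
have kernE x y : Complex x y != 0 -> Complex 0 (- m) / Complex x y =
   Complex (- m * y / (x ^+ 2 + y ^+ 2)) (- m * x / (x ^+ 2 + y ^+ 2)).
  by move=> _; apply: ReIm_eq; rewrite ?cReM ?cImM /=; ring.
(* The right-hand side is the joint contribution of two opposite sides; it is smallest at the
   corners, where it equals m / t. *)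
have K x : - t <= x <= t -> m / t <= 2 * m * t / (x ^+ 2 + t ^+ 2).
  move=> hx; have s0 : 0 < x ^+ 2 + t ^+ 2 by rewrite ltr_wpDl ?sqr_ge0 // exprn_gt0.
  rewrite ler_pdivlMr // -subr_ge0.
  have -> : 2 * m * t - m / t * (x ^+ 2 + t ^+ 2) = m / t * (t ^+ 2 - x ^+ 2) by field.
  rewrite mulr_ge0 ?divr_ge0 // ?(ltW t0) // subr_ge0 -(ger0_norm (ltW t0)).
  by rewrite -[leLHS]real_normK ?num_real // lerXn2r ?nnegrE // ?(ltW t0) // nt ler_norml.
have H : (m / t - 2 * e / t) * (t - - t) <=
   itvint (fun x => complex.Re (k (Complex x (- t))) - complex.Re (k (Complex x t))) (- t) t.
  apply: itvint_ge => //.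
    apply: itv_integrableB; apply: hcont_integrable; (try exact: Re_lip) => x hx;
      have [] // := onsq x t hx tin (or_intror nt) => a b _; (try exact: ck);
      have [] // := onsq x (- t) hx ntin (or_intror nnt) => a' b' _; exact: ck.
  move=> x hx; have e1 := est x t hx tin (or_intror nt).
  have e2 := est x (- t) hx ntin (or_intror nnt).
  have [n1 _ _] := onsq x t hx tin (or_intror nt).
  have [n2 _ _] := onsq x (- t) hx ntin (or_intror nnt).
  have := le_trans (abs_Re_le _) e1; have := le_trans (abs_Re_le _) e2.
  rewrite !kernE // !cReB /= sqrrN !ler_norml; have := K x hx.
  have -> : 2 * m * t / (x ^+ 2 + t ^+ 2) = 2 * (m * t / (x ^+ 2 + t ^+ 2)) by ring.
  have -> : - m * - t / (x ^+ 2 + t ^+ 2) = m * t / (x ^+ 2 + t ^+ 2) by ring.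
  have -> : - m * t / (x ^+ 2 + t ^+ 2) = - (m * t / (x ^+ 2 + t ^+ 2)) by ring.
  have -> : 2 * e / t = 2 * (e / t) by ring.
  lra.
have V : itvint (fun y => complex.Im (k (Complex t y)) - complex.Im (k (Complex (- t) y))) (- t) t
   <= (- (m / t - 2 * e / t)) * (t - - t).
  apply: itvint_le => //.
    apply: itv_integrableB; apply: vcont_integrable; (try exact: Im_lip) => x hx;
      have [] // := onsq t x tin hx (or_introl nt) => a b _; (try exact: ck);
      have [] // := onsq (- t) x ntin hx (or_introl nnt) => a' b' _; exact: ck.
  move=> x hx; have e1 := est t x tin hx (or_introl nt).
  have e2 := est (- t) x ntin hx (or_introl nnt).
  have [n1 _ _] := onsq t x tin hx (or_introl nt).
  have [n2 _ _] := onsq (- t) x ntin hx (or_introl nnt).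
  have := le_trans (abs_Im_le _) e1; have := le_trans (abs_Im_le _) e2.
  rewrite !kernE // !cImB /= sqrrN !ler_norml; have := K x hx.
  have -> : 2 * m * t / (x ^+ 2 + t ^+ 2) = 2 * (m * t / (t ^+ 2 + x ^+ 2)).
    by rewrite [x ^+ 2 + _]addrC; ring.
  have -> : - m * - t / (t ^+ 2 + x ^+ 2) = m * t / (t ^+ 2 + x ^+ 2) by ring.
  have -> : - m * t / (t ^+ 2 + x ^+ 2) = - (m * t / (t ^+ 2 + x ^+ 2)) by ring.
  have -> : 2 * e / t = 2 * (e / t) by ring.
  lra.
rewrite /rect_int; have E : (m / t - 2 * e / t) * (t - - t) = 2 * m - 4 * e by field.
by rewrite mulNr E in V; rewrite E in H; lra.
Qed.

(** Integrate c h(z) / z^2 with the unimodular c for which c l = -i |l|. Since h(0) = 0 the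
    singularity is simple, close to -i |l| / z, and small squares give at least 4 |l| (the exact
    value is 2 pi |l|). On the rectangle |z| >= 1/4, hence the factor 16. The sides are left free
    within a band so that they can be chosen later by averaging. *)
Lemma cauchy_rect h (l : R[i]) (x0 x1 y0 y1 : R) :
  (forall x y, `|x| <= 1/2 -> `|y| <= 1/2 -> exists l, has_cderiv h (Complex x y) l) ->
  h 0 = 0 -> has_cderiv h 0 l ->
  - (1/2) <= x0 <= - (1/4) -> 1/4 <= x1 <= 1/2 ->
  - (1/2) <= y0 <= - (1/4) -> 1/4 <= y1 <= 1/2 ->
  4 * cmod l <=
    16 * (itvint (fun x => cmod (h (Complex x y0))) x0 x1
        + itvint (fun x => cmod (h (Complex x y1))) x0 x1
        + itvint (fun y => cmod (h (Complex x0 y))) y0 y1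
        + itvint (fun y => cmod (h (Complex x1 y))) y0 y1).
Proof.
move=> Hh h0 hl hx0 hx1 hy0 hy1.
have [c' c'1 c'l] := unimodular_rotation l.
pose c : R[i] := Complex 0 (- 1) * c'.
have c1 : cmod c = 1 by rewrite cmodM c'1 mulr1 /cmod /= expr0n add0r sqrrN expr1n sqrtr1.
have cl : c * l = Complex 0 (- cmod l).
  by rewrite /c -mulrA c'l; apply: ReIm_eq; rewrite ?cReM ?cImM /=; ring.
pose k z := c * h z / z ^+ 2.
have Hk x y : `|x| <= 1/2 -> `|y| <= 1/2 -> Complex x y != 0 ->
    exists m, has_cderiv k (Complex x y) m.
  move=> hx hy n; have [m hm] := Hh x y hx hy.
  eexists; apply: has_cderiv_div; first by rewrite expf_neq0.
    by apply: has_cderivZ; exact: hm.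
  by apply: has_cderivX; exact: has_cderiv_id.
have Ck x y : `|x| <= 1/2 -> `|y| <= 1/2 -> Complex x y != 0 -> ccont k (Complex x y).
  by move=> hx hy n; have [m /has_cderiv_cont] := Hk x y hx hy n.
have inx x : x0 <= x <= x1 -> `|x| <= 1/2 by clear -hx0 hx1; rewrite ler_norml; lra.
have iny y : y0 <= y <= y1 -> `|y| <= 1/2 by clear -hy0 hy1; rewrite ler_norml; lra.
have xx : x0 <= x1 by lra.
have yy : y0 <= y1 by lra.
have [q [cq ql hq]] := (has_cderivP _ _ _).1 hl.
have lower e : 0 < e -> 4 * cmod l - 8 * e <= rect_int k x0 x1 y0 y1.
  move=> e0; have [d d0 hd] := cq e e0.
  (* The square must lie inside the rectangle, and all points of modulus at most 2 t must lie within
     the distance d at which the difference quotient is e-close to l. *)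
  pose t := Num.min (1/4) (d / 4).
  have t0 : 0 < t by rewrite lt_min; apply/andP; split; lra.
  have [t4 td] : t <= 1/4 /\ t <= d / 4.
    by split; rewrite ge_min lexx ?orbT.
  rewrite (@rect_int_shrink k x0 x1 y0 y1 t) //; [|lra|lra|lra|lra|]; last first.
    by move=> x y hx hy n; apply: Hk => //; [exact: inx|exact: iny].
  apply: rect_int_square_lower => //; first exact: cmod_ge0.
    move=> z z0 zt; case: z z0 zt => x y z0 zt.
    have := abs_Re_le (Complex x y); have := abs_Im_le (Complex x y) => /= a b.
    by apply: Ck => //; lra.
  move=> z z0 zt.
  have -> : k z - Complex 0 (- cmod l) / z = c * (q z - q 0) / z.
    have hz : h z = q z * z by have := hq z; rewrite h0 !subr0.
    by rewrite /k hz -cl ql; field.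
  rewrite cmod_div cmodM c1 mul1r ler_wpM2r ?invr_ge0 ?cmod_ge0 // ltW // hd // subr0.
  by apply: le_lt_trans zt _; lra.
have kh z : 1/4 <= cmod z -> cmod (k z) <= 16 * cmod (h z).
  move=> hz; rewrite /k cmod_div cmodM c1 mul1r cmodX.
  have z0 : 0 < cmod z by lra.
  rewrite ler_pdivrMr ?exprn_gt0 // mulrAC ler_peMl ?cmod_ge0 //.
  have : 1/4 * (1/4) <= cmod z * cmod z by apply: ler_pM => //; rewrite divr_ge0.
  by rewrite expr2; clear; lra.
have far x y : 1/4 <= `|x| \/ 1/4 <= `|y| -> 1/4 <= cmod (Complex x y).
  case=> hq4; apply: le_trans hq4 _; first exact: (abs_Re_le (Complex x y)).
  exact: (abs_Im_le (Complex x y)).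
have nzq (z : R[i]) : 1/4 <= cmod z -> z != 0 by rewrite -cmod_gt0; lra.
have ax0 : 1/4 <= `|x0| /\ `|x0| <= 1/2 by rewrite ler0_norm; lra.
have ay0 : 1/4 <= `|y0| /\ `|y0| <= 1/2 by rewrite ler0_norm; lra.
have ax1 : 1/4 <= `|x1| /\ `|x1| <= 1/2 by rewrite ger0_norm; lra.
have ay1 : 1/4 <= `|y1| /\ `|y1| <= 1/2 by rewrite ger0_norm; lra.
have hor y : 1/4 <= `|y| /\ `|y| <= 1/2 ->
   hcont k y x0 x1 /\ hcont h y x0 x1.
  move=> [y4 y2]; split=> x /inx hx.
    by apply: Ck => //; apply: nzq; apply: far; right.
  by have [m /has_cderiv_cont] := Hh x y hx y2.
have ver x : 1/4 <= `|x| /\ `|x| <= 1/2 ->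
   vcont k x y0 y1 /\ vcont h x y0 y1.
  move=> [y4 y2]; split=> y /iny hx.
    by apply: Ck => //; apply: nzq; apply: far; left.
  by have [m /has_cderiv_cont] := Hh x y y2 hx.
have [kh0 hh0] := hor _ ay0; have [kh1 hh1] := hor _ ay1.
have [kv0 hv0] := ver _ ax0; have [kv1 hv1] := ver _ ax1.
have iH y : hcont h y x0 x1 -> itv_integrable (fun x => cmod (h (Complex x y))) x0 x1.
  by apply: hcont_integrable; exact: cmod_lip.
have iV x : vcont h x y0 y1 -> itv_integrable (fun y => cmod (h (Complex x y))) y0 y1.
  by apply: vcont_integrable; exact: cmod_lip.
have upper : rect_int k x0 x1 y0 y1 <=
    16 * (itvint (fun x => cmod (h (Complex x y0))) x0 x1
        + itvint (fun x => cmod (h (Complex x y1))) x0 x1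
        + itvint (fun y => cmod (h (Complex x0 y))) y0 y1
        + itvint (fun y => cmod (h (Complex x1 y))) y0 y1).
  have iHH := itv_integrableD (iH _ hh0) (iH _ hh1).
  have iVV := itv_integrableD (iV _ hv0) (iV _ hv1).
  have A : itvint (fun x => complex.Re (k (Complex x y0)) - complex.Re (k (Complex x y1))) x0 x1
     <= 16 * (itvint (fun x => cmod (h (Complex x y0))) x0 x1
        + itvint (fun x => cmod (h (Complex x y1))) x0 x1).
    rewrite -(itvintD (iH _ hh0) (iH _ hh1)) -itvintZ //; apply: le_itvint.
    - by apply: itv_integrableB; apply: hcont_integrable => //; exact: Re_lip.
    - exact: itv_integrableZ.
    move=> x hx; apply: le_trans (ler_norm _) _; apply: le_trans (ler_normB _ _) _.
    rewrite mulrDr lerD // (le_trans (abs_Re_le _)) // kh // far //; right.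
      by case: ay0.
    by case: ay1.
  have B : - itvint (fun y => complex.Im (k (Complex x1 y)) - complex.Im (k (Complex x0 y))) y0 y1
     <= 16 * (itvint (fun y => cmod (h (Complex x0 y))) y0 y1
        + itvint (fun y => cmod (h (Complex x1 y))) y0 y1).
    rewrite -(itvintD (iV _ hv0) (iV _ hv1)) -itvintZ // lerNl -mulN1r -itvintZ; last exact: itv_integrableZ.
    apply: le_itvint.
    - by apply: itv_integrableZ; apply: itv_integrableZ.
    - by apply: itv_integrableB; apply: vcont_integrable => //; exact: Im_lip.
    move=> y hy; rewrite mulN1r lerNl opprB.
    apply: le_trans (ler_norm _) _; apply: le_trans (ler_normB _ _) _.
    rewrite mulrDr lerD // (le_trans (abs_Im_le _)) // kh // far //; left.
      by case: ax0.
    by case: ax1.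
  by rewrite /rect_int; lra.
apply/ler_addgt0Pr => e e0; have := lower (e / 8) ltac:(by rewrite divr_gt0).
by lra.
Qed.

End CauchyEstimate.

Section CauchyArea.
Context {R : realType}.
Notation mu := (@lebesgue_measure R).
Notation mu2 := (mu \x mu)%E.
Implicit Types (h f : R[i] -> R[i]).

Lemma square_in_disk (x y : R) : `|x| <= 1/2 -> `|y| <= 1/2 -> disk (Complex x y).
Proof.
move=> hx hy; rewrite /disk /= -(@ltr_pXn2r _ 2) ?nnegrE ?cmod_ge0 ?ler01 // expr1n cmod_sqr /=.
have sq (t : R) : `|t| <= 1/2 -> t ^+ 2 <= 1/4.
  move=> ht; rewrite -[leLHS]real_normK ?num_real // expr2.
  have -> : 1/4 = 1/2 * (1/2) :> R by field.
  by apply: ler_pM.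
by have := sq x hx; have := sq y hy; lra.
Qed.

(* A set of measure at least [1/4] of slices cannot all carry more than four
   times the total mass: this selects the sides of the Cauchy contour. *)
Lemma good_slice1 (G : R * R -> \bar R) (a b J : R) :
  measurable_fun setT G -> (forall p, 0 <= G p)%E -> (\int[mu2]_p G p < J%:E)%E ->
  0 <= J -> a + 1/4 <= b ->
  exists2 x, a <= x <= b & (\int[mu]_y G (x, y) <= (4 * J)%:E)%E.
Proof.
move=> mG G0 GJ J0 ab; apply: contrapT => H.
have ge_inner x : a <= x <= b -> ((4 * J)%:E <= \int[mu]_y G (x, y))%E.
  by move=> hx; rewrite leNgt; apply/negP => /ltW h; apply: H; exists x.
have : (\int[mu]_(x in `[a, b]) (4 * J)%:E <= \int[mu2]_p G p)%E.
  rewrite fubini_tonelli1 // integral_mkcond; apply: le_integral_ge0 => x _.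
    by apply: erestrict_ge0 => y _; rewrite lee_fin mulr_ge0.
  rewrite /patch; case: ifPn => [|_]; last exact: integral_ge0.
  by rewrite inE /= in_itv /= => /ge_inner.
rewrite integral_cst // [X in (_ * X)%E]lebesgue_measure_itv /= lte_fin ifT; last by lra.
apply/negP; rewrite -ltNge; apply: lt_le_trans GJ _.
rewrite -EFinB -EFinM lee_fin.
have : 4 * J * (1/4) <= 4 * J * (b - a) by rewrite ler_wpM2l ?mulr_ge0 //; lra.
lra.
Qed.

Lemma good_slice2 (G : R * R -> \bar R) (a b J : R) :
  measurable_fun setT G -> (forall p, 0 <= G p)%E -> (\int[mu2]_p G p < J%:E)%E ->
  0 <= J -> a + 1/4 <= b ->
  exists2 y, a <= y <= b & (\int[mu]_x G (x, y) <= (4 * J)%:E)%E.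
Proof.
move=> mG G0 GJ J0 ab; apply: contrapT => H.
have ge_inner y : a <= y <= b -> ((4 * J)%:E <= \int[mu]_x G (x, y))%E.
  by move=> hx; rewrite leNgt; apply/negP => /ltW h; apply: H; exists y.
have : (\int[mu]_(x in `[a, b]) (4 * J)%:E <= \int[mu2]_p G p)%E.
  rewrite fubini_tonelli1 // fubini_tonelli // integral_mkcond.
  apply: le_integral_ge0 => x _.
    by apply: erestrict_ge0 => y _; rewrite lee_fin mulr_ge0.
  rewrite /patch; case: ifPn => [|_]; last exact: integral_ge0.
  by rewrite inE /= in_itv /= => /ge_inner.
rewrite integral_cst // [X in (_ * X)%E]lebesgue_measure_itv /= lte_fin ifT; last by lra.
apply/negP; rewrite -ltNge; apply: lt_le_trans GJ _.
rewrite -EFinB -EFinM lee_fin.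
have : 4 * J * (1/4) <= 4 * J * (b - a) by rewrite ler_wpM2l ?mulr_ge0 //; lra.
lra.
Qed.

Lemma itvint_le_integral (F : R -> R) (G : R -> \bar R) (a b J : R) :
  itv_integrable F a b -> (forall x, 0 <= F x) ->
  (forall x, (0 <= G x)%E) -> (forall x, a <= x <= b -> G x = (F x)%:E) ->
  (\int[mu]_x G x <= J%:E)%E -> itvint F a b <= J.
Proof.
move=> iF F0 G0 GF GJ; rewrite -lee_fin /itvint /Rintegral fineK; last first.
  exact: integrable_fin_num.
apply: le_trans GJ; rewrite integral_mkcond; apply: le_integral_ge0 => x _.
  by apply: erestrict_ge0 => y _; rewrite lee_fin.
by rewrite /patch; case: ifPn => // ; rewrite inE /= in_itv /= => /GF ->.
Qed.

(** Plays the part of Cauchy--Schwarz: F <= (de/2) F^2 + 1/(2 de) pointwise, with [de] to be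
    optimized afterwards. *)
Lemma itvint_amgm (F : R -> R) (a b J de : R) : 0 < de -> a <= b -> b - a <= 1 ->
  itv_integrable F a b -> itv_integrable (fun x => F x ^+ 2) a b ->
  itvint (fun x => F x ^+ 2) a b <= 4 * J ->
  itvint F a b <= 2 * de * J + (2 * de)^-1.
Proof.
move=> de0 ab ab1 iF iF2 HJ.
have i1 : itv_integrable (fun x => de / 2 * F x ^+ 2) a b by exact: itv_integrableZ.
have i2 : itv_integrable (fun=> (2 * de)^-1) a b by exact: itv_integrable_cst.
have : itvint F a b <= itvint (fun x => de / 2 * F x ^+ 2 + (2 * de)^-1) a b.
  apply: le_itvint => //; first exact: itv_integrableD.
  move=> x _; rewrite -subr_ge0.
  have -> : de / 2 * F x ^+ 2 + (2 * de)^-1 - F x = (de * F x - 1) ^+ 2 / (2 * de).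
    by field; rewrite gt_eqF.
  by rewrite divr_ge0 ?sqr_ge0 // mulr_ge0 // ltW.
rewrite itvintD // itvintZ // itvint_cst // => h; apply: le_trans h _; apply: lerD.
  have : de / 2 * itvint (fun x => F x ^+ 2) a b <= de / 2 * (4 * J).
    by rewrite ler_wpM2l // divr_ge0 // ltW.
  lra.
by rewrite ler_piMr // invr_ge0 mulr_ge0 // ltW.
Qed.

Lemma cauchy_area h (l : R[i]) : holo_disk h -> h 0 = 0 -> has_cderiv h 0 l ->
  ((cmod l ^+ 2)%:E <=
     (64 * 64)%:E * area_int disk (fun z => (cmod (h z) ^+ 2)%:E))%E.
Proof.
move=> hh h0 hl; rewrite /area_int.
set I := (\int[_]_(p in _) _)%E.
have I0 : (0 <= I)%E by apply: integral_ge0 => p _; rewrite lee_fin sqr_ge0.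
have pi0 : 0 < pi^-1 :> R by rewrite invr_gt0 pi_gt0.
(* Slices are selected by contradiction, which needs a strict upper bound on the integral; the
   equality case follows by letting J decrease to I. *)
have key J : (I < J%:E)%E -> cmod l ^+ 2 <= 32 * 32 * J.
  move=> IJ.
  have J0 : 0 <= J by rewrite -lee_fin (le_trans I0) // ltW.
  have [->|l0] := eqVneq l 0; first by rewrite cmod0 expr0n; apply: mulr_ge0.
  pose G : R * R -> \bar R := (fun p => (cmod (h (Complex p.1 p.2)) ^+ 2)%:E) \_ (plane disk).
  have mD : measurable (plane (disk : set R[i])) by apply: measurable_plane; exact: copen_disk.
  have mG : measurable_fun setT G.
    have mg : measurable_fun (plane disk) (EFin \o (fun p : R * R => cmod (h (Complex p.1 p.2)) ^+ 2)).
      apply/measurable_EFinP.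
      apply: (measurableT_comp (f := fun x : R => x ^+ 2)); first exact: exprn_measurable.
      apply: measurable_fun_plane; [exact: copen_disk|exact: cmod_lip|].
      by move=> z; exact: holo_ccont.
    exact: ((measurable_restrictT _ mD).1 mg).
  have G0 p : (0 <= G p)%E by apply: erestrict_ge0 => q _; rewrite lee_fin sqr_ge0.
  have GJ : (\int[mu2]_p G p < J%:E)%E by rewrite -integral_mkcond.
  have [x1 hx1 X1] := good_slice1 (a := 1/4) (b := 1/2) mG G0 GJ J0 ltac:(lra).
  have [x0 hx0 X0] := good_slice1 (a := - (1/2)) (b := - (1/4)) mG G0 GJ J0 ltac:(lra).
  have [y1 hy1 Y1] := good_slice2 (a := 1/4) (b := 1/2) mG G0 GJ J0 ltac:(lra).
  have [y0 hy0 Y0] := good_slice2 (a := - (1/2)) (b := - (1/4)) mG G0 GJ J0 ltac:(lra).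
  have hD x y : `|x| <= 1/2 -> `|y| <= 1/2 -> exists l, has_cderiv h (Complex x y) l.
    by move=> hx hy; apply: hh; exact: square_in_disk.
  have C := cauchy_rect hD h0 hl hx0 hx1 hy0 hy1.
  have GE x y : `|x| <= 1/2 -> `|y| <= 1/2 -> G (x, y) = (cmod (h (Complex x y)) ^+ 2)%:E.
    by move=> hx hy; rewrite /G /patch ifT // inE; exact: square_in_disk.
  have ccx x y : `|x| <= 1/2 -> `|y| <= 1/2 -> ccont h (Complex x y).
    by move=> hx hy; have [m /has_cderiv_cont] := hD x y hx hy.
  have sq_lip : forall z w : R[i], `|cmod z - cmod w| <= cmod (z - w) by exact: cmod_lip.
  have m0 : 0 < cmod l by rewrite cmod_gt0.
  (* With this choice the four constant terms |l| / 32, multiplied by 16, amount to 2 |l|, half of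
     the left side 4 |l|, and are absorbed. *)
  pose de := 16 / cmod l.
  have de0 : 0 < de by rewrite divr_gt0.
  have ix x : x0 <= x <= x1 -> `|x| <= 1/2 by clear -hx0 hx1; rewrite ler_norml; lra.
  have iy y : y0 <= y <= y1 -> `|y| <= 1/2 by clear -hy0 hy1; rewrite ler_norml; lra.
  have xx : x0 <= x1 by clear -hx0 hx1; lra.
  have yy : y0 <= y1 by clear -hy0 hy1; lra.
  have xx1 : x1 - x0 <= 1 by clear -hx0 hx1; lra.
  have yy1 : y1 - y0 <= 1 by clear -hy0 hy1; lra.
  have sqi (j : R -> R[i]) a b : (forall x x', cmod (j x - j x') = `|x - x'|) ->
     (forall x, a <= x <= b -> ccont h (j x)) ->
     itv_integrable (fun x => cmod (h (j x)) ^+ 2) a b.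
    move=> ji hj.
    pose h2 z := h z * h z.
    have := @line_integrable R cmod h2 j a b sq_lip ji (fun x hx => ccontM (hj x hx) (hj x hx)).
    by congr itv_integrable; apply/funext => x; rewrite /h2 cmodM expr2.
  have bh y : `|y| <= 1/2 -> (\int[mu]_x G (x, y) <= (4 * J)%:E)%E ->
      itvint (fun x => cmod (h (Complex x y))) x0 x1 <= 2 * de * J + (2 * de)^-1.
    move=> hy HY.
    have c2 : itv_integrable (fun x => cmod (h (Complex x y)) ^+ 2) x0 x1.
      apply: (sqi (fun x => Complex x y)); first exact: hor_isometry.
      by move=> x /ix hx; exact: ccx.
    apply: itvint_amgm => //.
      by apply: hcont_integrable => // x /ix hx; exact: ccx.
    apply: itvint_le_integral HY => // x; first exact: sqr_ge0.
    by move=> /ix hx; exact: GE.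
  have bv x : `|x| <= 1/2 -> (\int[mu]_y G (x, y) <= (4 * J)%:E)%E ->
      itvint (fun y => cmod (h (Complex x y))) y0 y1 <= 2 * de * J + (2 * de)^-1.
    move=> hx HX.
    have c2 : itv_integrable (fun y => cmod (h (Complex x y)) ^+ 2) y0 y1.
      apply: (sqi (fun y => Complex x y)); first exact: ver_isometry.
      by move=> y /iy hy; exact: ccx.
    apply: itvint_amgm => //.
      by apply: vcont_integrable => // y /iy hy; exact: ccx.
    apply: itvint_le_integral HX => // y; first exact: sqr_ge0.
    by move=> /iy hy; exact: GE.
  have B1 := bh y0 (iy y0 ltac:(by rewrite lexx yy)) Y0.
  have B2 := bh y1 (iy y1 ltac:(by rewrite lexx yy)) Y1.
  have B3 := bv x0 (ix x0 ltac:(by rewrite lexx xx)) X0.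
  have B4 := bv x1 (ix x1 ltac:(by rewrite lexx xx)) X1.
  have F1 : 2 * de * J = 32 * J / cmod l by rewrite /de; field; rewrite cmod_eq0.
  have F2 : (2 * de)^-1 = cmod l / 32 by rewrite /de; field; rewrite cmod_eq0.
  rewrite F1 F2 in B1 B2 B3 B4.
  have F : cmod l / 2 <= 16 * 32 * J / cmod l.
    have -> : 16 * 32 * J / cmod l = 16 * (32 * J / cmod l) by ring.
    by clear -C B1 B2 B3 B4; lra.
  rewrite ler_pdivlMr // in F; rewrite expr2.
  by clear -F; lra.
have [Ifin|] := boolP (I \is a fin_num); last first.
  rewrite ge0_fin_numE // -leNgt leye_eq => /eqP ->.
  by rewrite gt0_muley ?lte_fin // gt0_muley ?lte_fin // leey.
have [r rE] : exists r : R, I = r%:E by exists (fine I); rewrite fineK.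
rewrite rE in key I0 *; rewrite -!EFinM lee_fin.
have r0 : 0 <= r by rewrite -lee_fin.
have : cmod l ^+ 2 <= 32 * 32 * r.
  apply/ler_addgt0Pr => e e0; have := key (r + e / (32 * 32)); rewrite lte_fin.
  by rewrite ltrDl divr_gt0 // => /(_ isT); lra.
(* The normalized area measure carries 1/pi >= 1/4, which accounts for 64 * 64 = 4 * 32 * 32. *)
have pi4 : pi <= 4 :> R by have := @pihalf_02 R; lra.
have : r / 4 <= pi^-1 * r by rewrite mulrC ler_wpM2r // lef_pV2 // posrE ?pi_gt0.
lra.
Qed.

(** The square with vertices at +-1/2 +- i/2 has four sides of length 1, so [cauchy_rect] gives 4
    |l| <= 16 * 4 M. *)
Lemma cauchy_sup h (l : R[i]) (M : R) : holo_disk h -> has_cderiv h 0 l ->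
  (forall z, disk z -> cmod (h z - h 0) <= M) -> cmod l <= 16 * M.
Proof.
move=> hh hl hM.
pose g z := h z - h 0.
have dg z m : has_cderiv h z m -> has_cderiv g z m.
  move=> hm; have := has_cderivB hm (has_cderiv_cst (h 0) z).
  by rewrite subr0.
have hD x y : `|x| <= 1/2 -> `|y| <= 1/2 -> exists l, has_cderiv g (Complex x y) l.
  move=> hx hy; have [m hm] := hh _ (square_in_disk hx hy).
  by exists m; exact: dg.
have M0 : 0 <= M by apply: le_trans (hM 0 _); rewrite ?subrr /disk /= cmod0.
have C := @cauchy_rect R g l (-(1/2)) (1/2) (-(1/2)) (1/2) hD
  ltac:(by rewrite /g subrr) (dg _ _ hl) ltac:(lra) ltac:(lra) ltac:(lra) ltac:(lra).
have h12 : `|1/2 : R| <= 1/2 by rewrite ger0_norm // divr_ge0.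
have hm12 : `|- (1/2) : R| <= 1/2 by rewrite normrN.
have cc x y : `|x| <= 1/2 -> `|y| <= 1/2 -> ccont g (Complex x y).
  by move=> hx hy; have [m /has_cderiv_cont] := hD x y hx hy.
have bH y : `|y| <= 1/2 ->
   itvint (fun x => cmod (g (Complex x y))) (-(1/2)) (1/2) <= M * (1/2 - - (1/2)).
  move=> hy; apply: itvint_le; first lra.
    apply: hcont_integrable; first exact: cmod_lip.
    by move=> x hx; apply: cc => //; rewrite ler_norml.
  by move=> x hx; apply: hM; apply: square_in_disk => //; rewrite ler_norml.
have bV x : `|x| <= 1/2 ->
   itvint (fun y => cmod (g (Complex x y))) (-(1/2)) (1/2) <= M * (1/2 - - (1/2)).
  move=> hx; apply: itvint_le; first lra.
    apply: vcont_integrable; first exact: cmod_lip.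
    by move=> y hy; apply: cc => //; rewrite ler_norml.
  by move=> y hy; apply: hM; apply: square_in_disk => //; rewrite ler_norml.
have b1 := bH _ h12; have b2 := bH _ hm12; have b3 := bV _ h12; have b4 := bV _ hm12.
have e1 : M * (1/2 - - (1/2)) = M by field.
rewrite e1 in b1 b2 b3 b4; clear -C b1 b2 b3 b4; lra.
Qed.

Lemma cauchy_disk_est f (z0 l : R[i]) (r M : R) : 0 < r ->
  (forall z, cmod (z - z0) < r -> exists l, has_cderiv f z l) -> has_cderiv f z0 l ->
  (forall z, cmod (z - z0) < r -> cmod (f z - f z0) <= M) -> cmod l <= 16 * M / r.
Proof.
move=> r0 hf hl hM.
pose g z := f (z0 + r%:C%C * z).
have inb (z : R[i]) : disk z -> cmod (z0 + r%:C%C * z - z0) < r.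
  rewrite /disk /= => hz; rewrite addrAC subrr add0r cmodM cmod_real gtr0_norm //.
  by rewrite -[ltRHS]mulr1 ltr_pM2l.
have dg (z m : R[i]) : has_cderiv f (z0 + r%:C%C * z) m -> has_cderiv g z (m * r%:C%C).
  move=> hm; apply: (has_cderiv_comp (f := fun z => z0 + r%:C%C * z)) => //.
  have := has_cderivD (has_cderiv_cst z0 z) (has_cderivZ r%:C%C (has_cderiv_id z)).
  by rewrite add0r mulr1.
have g0 : g 0 = f z0 by rewrite /g mulr0 addr0.
have hg : holo_disk g by move=> z /inb /hf[m /dg hm]; exists (m * r%:C%C).
have hl' : has_cderiv g 0 (l * r%:C%C) by apply: dg; rewrite mulr0 addr0.
have := cauchy_sup hg hl' (M := M); rewrite g0 cmodM cmod_real gtr0_norm // => H.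
by rewrite ler_pdivlMr // H // => z /inb /hM.
Qed.

End CauchyArea.

(** * Disk automorphisms and growth along radii *)

Section DiskAutomorphism.
Context {R : realType}.
Implicit Types (a z w : R[i]).

Lemma disk0 : disk (0 : R[i]).
Proof. by rewrite /disk /= cmod0. Qed.

Lemma disk_sqr z : disk z -> 0 < 1 - cmod z ^+ 2.
Proof. by move=> hz; rewrite subr_gt0 expr_lt1 // cmod_ge0. Qed.

Lemma disk_sqr_le z : disk z -> 0 <= 1 - cmod z ^+ 2.
Proof. by move=> /disk_sqr /ltW. Qed.

Lemma one_sub_conj_ge a z : cmod z <= 1 -> 1 - cmod a <= cmod (1 - cconj a * z).
Proof.
move=> z1; apply: le_trans (cmod_lerB _ _); rewrite cmod1 lerD2l lerN2.
by rewrite cmodM cmod_conj ler_piMr ?cmod_ge0.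
Qed.

Lemma one_sub_conj_le a z : disk a -> disk z -> cmod (1 - cconj a * z) <= 2.
Proof.
move=> ha hz; apply: le_trans (cmodB _ _) _; rewrite cmod1 cmodM cmod_conj.
rewrite -[leRHS]/(1 + 1) lerD2l -[leRHS]mul1r ler_pM ?cmod_ge0 //; exact: ltW.
Qed.

Lemma one_sub_conj_neq0 a z : disk a -> disk z -> 1 - cconj a * z != 0.
Proof.
move=> ha hz; rewrite -cmod_gt0; apply: lt_le_trans (one_sub_conj_ge _ (ltW hz)).
by rewrite subr_gt0.
Qed.

Lemma sigma_identity a z :
  cmod (1 - cconj a * z) ^+ 2 - cmod (a - z) ^+ 2 =
  (1 - cmod a ^+ 2) * (1 - cmod z ^+ 2).
Proof. by rewrite !cmod_sqr !cReB !cImB cReM cImM /=; ring. Qed.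

Lemma sigma_sqr a z : disk a -> disk z -> 1 - cmod (sigma a z) ^+ 2 =
  (1 - cmod a ^+ 2) * (1 - cmod z ^+ 2) / cmod (1 - cconj a * z) ^+ 2.
Proof.
move=> ha hz; have n := one_sub_conj_neq0 ha hz.
rewrite -sigma_identity /sigma cmod_div expr_div_n mulrBl divff //.
by rewrite expf_neq0 // cmod_eq0.
Qed.

Lemma sigma_disk a z : disk a -> disk z -> disk (sigma a z).
Proof.
move=> ha hz; have n := one_sub_conj_neq0 ha hz.
have : 0 < 1 - cmod (sigma a z) ^+ 2.
  by rewrite sigma_sqr // divr_gt0 ?exprn_gt0 ?cmod_gt0 // mulr_gt0 ?disk_sqr.
by rewrite subr_gt0 expr_lt1 // cmod_ge0.
Qed.

Lemma sigma0 a : sigma a 0 = a.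
Proof. by rewrite /sigma mulr0 !subr0 divr1. Qed.

Lemma sigmaaa a : sigma a a = 0.
Proof. by rewrite /sigma subrr mul0r. Qed.

Lemma real_one_sub_sqr a : (1 - cmod a ^+ 2)%:C%C = 1 - a * cconj a.
Proof. by rewrite mul_cconj; apply: ReIm_eq => //=; rewrite subr0. Qed.

Lemma sigma_cderiv a z : disk a -> disk z ->
  has_cderiv (sigma a) z (- (1 - cmod a ^+ 2)%:C%C / (1 - cconj a * z) ^+ 2).
Proof.
move=> ha hz; have n := one_sub_conj_neq0 ha hz.
have d1 := has_cderivB (has_cderiv_cst a z) (has_cderiv_id z).
have d2 := has_cderivB (has_cderiv_cst 1 z) (has_cderivZ (cconj a) (has_cderiv_id z)).
have D := @has_cderiv_div R (fun w => a - w) (fun w => 1 - cconj a * w) z _ _ n d1 d2.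
apply: (has_cderiv_eq _ (has_cderiv_ext (fun w => erefl (sigma a w)) D)).
by rewrite real_one_sub_sqr; congr (_ / _); ring.
Qed.

Lemma cmod_sigma_deriv a z : disk a -> disk z ->
  (1 - cmod z ^+ 2) * cmod (- (1 - cmod a ^+ 2)%:C%C / (1 - cconj a * z) ^+ 2) =
  1 - cmod (sigma a z) ^+ 2.
Proof.
move=> ha hz; rewrite sigma_sqr // cmod_div cmodN cmodX cmod_real.
by rewrite ger0_norm ?disk_sqr_le // mulrA [X in X / _]mulrC.
Qed.

Lemma holo_sigma a : disk a -> holo_disk (sigma a).
Proof. by move=> ha z hz; eexists; exact: sigma_cderiv. Qed.

Lemma self_map_sigma a : disk a -> self_map (sigma a).
Proof. by move=> ha; split; [exact: holo_sigma|move=> z; exact: sigma_disk]. Qed.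

Lemma holo_comp (f g : R[i] -> R[i]) : self_map f -> holo_disk g ->
  holo_disk (fun z => g (f z)).
Proof.
move=> [hf sf] hg z hz; have [l hl] := hf z hz; have [m hm] := hg _ (sf z hz).
by eexists; exact: has_cderiv_comp hl hm.
Qed.

Lemma self_map_comp (f g : R[i] -> R[i]) : self_map f -> self_map g ->
  self_map (fun z => g (f z)).
Proof.
move=> hf [hg sg]; split; first exact: holo_comp.
by move=> z hz; apply: sg; apply: hf.2.
Qed.

(* A Schwarz--Pick inequality with the non-sharp constant [16] of the Cauchy
   estimate, which is all that comparisons up to constants require. *)
Lemma schwarz_pick (h : R[i] -> R[i]) z (l : R[i]) : self_map h -> disk z ->
  has_cderiv h z l -> (1 - cmod z ^+ 2) * cmod l <= 16 * (1 - cmod (h z) ^+ 2).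
Proof.
move=> hh hz hl; have hw := hh.2 z hz.
have sm := self_map_comp (self_map_comp (self_map_sigma hz) hh) (self_map_sigma hw).
have d1 := sigma_cderiv hz disk0.
have d2 : has_cderiv h (sigma z 0) l by rewrite sigma0.
have d3 : has_cderiv (sigma (h z)) (h (sigma z 0))
    (- (1 - cmod (h z) ^+ 2)%:C%C / (1 - cconj (h z) * h z) ^+ 2).
  by rewrite sigma0; exact: sigma_cderiv.
have D := has_cderiv_comp (has_cderiv_comp d1 d2) d3.
have := cauchy_sup (M := 1) sm.1 D; rewrite /= sigma0 sigmaaa mulr1 => H.
have {}H : cmod (- (1 - cmod (h z) ^+ 2)%:C%C / (1 - cconj (h z) * h z) ^+ 2 *
   (l * (- (1 - cmod z ^+ 2)%:C%C / (1 - cconj z * 0) ^+ 2))) <= 16.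
  by apply: H => w hw'; rewrite subr0; apply: ltW; exact: (sm.2 w hw').
move: H; rewrite mulr0 subr0 expr1n divr1 !cmodM cmodV cmodX !cmodN !cmod_real.
rewrite [cconj _ * _]mulrC -real_one_sub_sqr cmod_real.
rewrite !ger0_norm ?disk_sqr_le //; have := disk_sqr hw; set A := 1 - _ => A0.
have -> : A / A ^+ 2 * (cmod l * (1 - cmod z ^+ 2)) = (1 - cmod z ^+ 2) * cmod l / A.
  by field; rewrite gt_eqF.
by rewrite ler_pdivrMr.
Qed.

End DiskAutomorphism.

Section Growth.
Context {R : realType}.
Implicit Types (f h : R[i] -> R[i]) (z w : R[i]).

(* The Bloch growth function; it is at least the hyperbolic distance to [0]. *)
Definition Lam z : R := - ln (1 - cmod z).

Lemma Lam_ge0 z : 0 <= Lam z.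
Proof. by rewrite oppr_ge0 ln_le0 // gerBl cmod_ge0. Qed.

Lemma Lam_mono z w : cmod z <= cmod w -> disk w -> Lam z <= Lam w.
Proof.
move=> zw hw; rewrite lerN2 ler_ln ?posrE ?subr_gt0 ?lerD2l ?lerN2 //.
exact: le_lt_trans hw.
Qed.

Lemma is_derive_ln_comp (g : R -> R) (x b : R) : 0 < g x ->
  is_derive (x : R) (1 : R) g b ->
  is_derive (x : R) (1 : R) (fun s : R => ln (g s)) ((g x)^-1 * b).
Proof.
move=> g0 dg; have dl := is_derive1_ln g0.
have : is_derive (x : R) (1 : R) (@ln R \o g) ((g x)^-1 * b) by apply: is_derive1_comp.
by [].
Qed.

Lemma is_derive_scale (g : R -> R) (K x b : R) : is_derive (x : R) (1 : R) g b ->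
  is_derive (x : R) (1 : R) (fun s : R => K * g s) (K * b).
Proof.
move=> dg; have : is_derive (x : R) (1 : R) (K \*: g) (K *: b) by apply: is_deriveZ.
by [].
Qed.

Lemma is_derive_subr (g k : R -> R) (x b c : R) : is_derive (x : R) (1 : R) g b ->
  is_derive (x : R) (1 : R) k c ->
  is_derive (x : R) (1 : R) (fun s : R => g s - k s) (b - c).
Proof.
move=> dg dk; have : is_derive (x : R) (1 : R) (g - k) (b - c) by apply: is_deriveB.
by [].
Qed.

Lemma is_derive_Lam (K r t : R) : 0 <= r < 1 -> 0 <= t <= 1 ->
  is_derive (t : R) (1 : R) (fun s : R => - (K * ln (1 - s * r))) (K * (r / (1 - t * r))).
Proof.
move=> /andP[r0 r1] /andP[t0 t1].
have p : 0 < 1 - t * r.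
  by rewrite subr_gt0; apply: le_lt_trans r1; rewrite ler_piMl.
have dl := is_derive1_ln p.
have di : is_derive (t : R) (1 : R) (fun s : R => 1 - s * r) (- r).
  apply: is_derive_dist => e e0; exists 1 => // h h0 _.
  have -> : (1 - (t + h) * r - (1 - t * r)) / h - - r = 0 by field.
  by rewrite normr0.
have dc : is_derive (t : R) (1 : R) (fun s : R => ln (1 - s * r)) ((1 - t * r)^-1 * - r).
  exact: (@is_derive_ln_comp (fun s : R => 1 - s * r)).
have dk : is_derive (t : R) (1 : R) (fun s : R => - K * ln (1 - s * r))
   (- K * ((1 - t * r)^-1 * - r)).
  exact: is_derive_scale.
have -> : (fun s : R => - (K * ln (1 - s * r))) = (fun s : R => - K * ln (1 - s * r)).
  by apply/funext => s; rewrite mulNr.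
by apply: is_derive_eq dk _; rewrite [r / _]mulrC; ring.
Qed.

Lemma segment_in_disk z (t : R) : disk z -> 0 <= t <= 1 ->
  disk (t%:C%C * z) /\ cmod (t%:C%C * z) = t * cmod z.
Proof.
move=> hz /andP[t0 t1]; have e : cmod (t%:C%C * z) = t * cmod z.
  by rewrite cmodM cmod_real ger0_norm.
by split=> //; rewrite /disk /= e; apply: le_lt_trans hz; rewrite ler_piMl ?cmod_ge0.
Qed.

(** Follows from 1 - x^2 >= 1 - x at x = t |z|. It turns a Bloch bound K on f' into K times the
    derivative of the logarithmic majorant along the radius. *)
Lemma radial_weight z (t : R) : disk z -> 0 <= t <= 1 ->
  cmod z <= (1 - cmod (t%:C%C * z) ^+ 2) * (cmod z / (1 - t * cmod z)).
Proof.
move=> hz t01; have [hd e] := segment_in_disk hz t01; move/andP: t01 => [t0 t1].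
have x1 : t * cmod z < 1 by rewrite -e.
have x0 : 0 <= t * cmod z by rewrite mulr_ge0 ?cmod_ge0.
rewrite e mulrA ler_pdivlMr ?subr_gt0 // mulrC ler_wpM2r ?cmod_ge0 //.
by rewrite lerD2l lerN2 expr2 ler_piMl // ltW.
Qed.

(** The derivative bound is asked only for |w| <= |z|: when this is applied to functions composed
    with sigma_a, the good bounds are known just on a smaller disk. *)
Lemma disk_growth f z (K : R) : holo_disk f -> disk z ->
  (forall w l, cmod w <= cmod z -> has_cderiv f w l -> (1 - cmod w ^+ 2) * cmod l <= K) ->
  cmod (f z - f 0) <= K * Lam z.
Proof.
move=> hf hz HK.
have r01 : 0 <= cmod z < 1 by rewrite cmod_ge0.
have lez t : 0 <= t <= 1 -> cmod (t%:C%C * z) <= cmod z.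
  move=> t01; have [_ ->] := segment_in_disk hz t01; move/andP: t01 => [t0 t1].
  by rewrite ler_piMl ?cmod_ge0.
have := @segment_majorant R f (fun t => cderiv f (t%:C%C * z)) 0 z
   (fun s : R => - (K * ln (1 - s * cmod z))) (fun t => K * (cmod z / (1 - t * cmod z))).
rewrite add0r mul1r mul0r subr0 ln1 mulr0 oppr0 subr0 -mulrN; apply.
- move=> t t01; rewrite add0r; have [hd _] := segment_in_disk hz t01.
  exact: holo_cderiv.
- by move=> t t01; exact: is_derive_Lam.
- move=> t t01; have [hd e] := segment_in_disk hz t01.
  have := HK _ _ (lez _ t01) (holo_cderiv hf hd).
  have := radial_weight hz t01; rewrite (cmodM (cderiv _ _)).
  have W := disk_sqr hd; set w := 1 - _ in W *; set m := cmod _; set l := cmod _.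
  move=> h1 h2.
  have l0 : 0 <= l := cmod_ge0 _.
  apply: le_trans (ler_wpM2l l0 h1) _.
  have -> : l * (w * (m / (1 - t * m))) = w * l * (m / (1 - t * m)) by ring.
  rewrite ler_wpM2r //.
  by rewrite divr_ge0 ?cmod_ge0 // subr_ge0 -e; exact: ltW.
Qed.

Definition Lw w : R := ln (2 / (1 - cmod w ^+ 2)).

Lemma Lw_arg_ge2 w : disk w -> 2 <= 2 / (1 - cmod w ^+ 2).
Proof.
by move=> hw; rewrite ler_pdivlMr ?disk_sqr // ler_piMr // gerBl sqr_ge0.
Qed.

Lemma ln2_ge : 1/2 <= ln (2 : R).
Proof.
have := @le_ln1Dx R (- (1/2)) ltac:(lra).
have -> : 1 + - (1/2) = 2^-1 :> R by field.
rewrite lnV ?posrE //; lra.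
Qed.

Lemma Lw_ge w : disk w -> 1/2 <= Lw w.
Proof.
move=> hw; apply: le_trans ln2_ge _; have h2 := Lw_arg_ge2 hw.
by rewrite ler_ln ?posrE // (lt_le_trans _ h2).
Qed.

Lemma Lw_gt0 w : disk w -> 0 < Lw w.
Proof. by move=> /Lw_ge; apply: lt_le_trans; rewrite divr_gt0. Qed.

Lemma LwE w : disk w -> Lw w = ln 2 - ln (1 - cmod w ^+ 2).
Proof. by move=> hw; rewrite /Lw ln_div ?posrE ?disk_sqr. Qed.

(** Along the radius, ln(1 - |h|^2) has derivative at most 2 |h'| |z| / (1 - |h|^2), and
    [schwarz_pick] bounds it by 2 * 16 times the derivative of [Lam]. So [Lw] composed with a
    self-map is Lipschitz in hyperbolic terms, which permits comparing log weights at phi(a) and at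
    phi(sigma_a(z)). *)
Lemma Lw_dist h z : self_map h -> disk z -> `|Lw (h z) - Lw (h 0)| <= 32 * Lam z.
Proof.
move=> [hh sh] hz.
have r01 : 0 <= cmod z < 1 by rewrite cmod_ge0.
pose N (t : R) := ln (1 - cmod (h (t%:C%C * z)) ^+ 2).
pose p (t : R) := complex.Re (h (t%:C%C * z)).
pose q (t : R) := complex.Im (h (t%:C%C * z)).
pose dh (t : R) := cderiv h (t%:C%C * z) * z.
have dcomp c t : 0 <= t <= 1 ->
   is_derive (t : R) (1 : R) (fun s : R => complex.Re (c * h (s%:C%C * z)))
     (complex.Re (c * dh t)).
  move=> t01; have [hd e] := segment_in_disk hz t01.
  apply: (@is_derive_Re _ (fun s => c * h (s * z))); apply: has_cderivZ.
  apply: (has_cderiv_comp (f := fun s => s * z)); last exact: holo_cderiv.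
  by have := has_cderivM (has_cderiv_id t%:C%C) (has_cderiv_cst z t%:C%C); rewrite mul1r mulr0 addr0.
have dp t : 0 <= t <= 1 -> is_derive (t : R) (1 : R) p (complex.Re (dh t)).
  by move=> /(dcomp 1); rewrite mul1r; under eq_fun do rewrite mul1r.
have dq t : 0 <= t <= 1 -> is_derive (t : R) (1 : R) q (complex.Im (dh t)).
  move=> /(dcomp (Complex 0 (-1))); rewrite cReM /= mul0r sub0r mulN1r opprK.
  by under eq_fun do rewrite cReM /= mul0r sub0r mulN1r opprK.
have dN t : 0 <= t <= 1 -> is_derive (t : R) (1 : R) N
   (- (2 * (p t * complex.Re (dh t) + q t * complex.Im (dh t)) /
     (1 - cmod (h (t%:C%C * z)) ^+ 2))).
  move=> t01; have [hd e] := segment_in_disk hz t01.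
  have P0 := disk_sqr (sh _ hd).
  have dl := is_derive1_ln P0.
  have -> : N = (fun s : R => ln (1 - (p s * p s + q s * q s))).
    by apply/funext => s; rewrite /N /= cmod_sqr !expr2.
  have P0' : 0 < 1 - (p t * p t + q t * q t).
    by move: P0; rewrite cmod_sqr !expr2.
  have dl' := is_derive1_ln P0'.
  have h1 := dp t t01; have h2 := dq t t01.
  have di : is_derive (t : R) (1 : R) (fun s : R => 1 - (p s * p s + q s * q s))
     (- (2 * (p t * complex.Re (dh t) + q t * complex.Im (dh t)))).
    apply: is_derive_eq; rewrite ?add0r -![_ *: _]/(_ * _); ring.
  have dc : is_derive (t : R) (1 : R) (fun s : R => ln (1 - (p s * p s + q s * q s)))
     ((1 - (p t * p t + q t * q t))^-1 *
      - (2 * (p t * complex.Re (dh t) + q t * complex.Im (dh t)))).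
    exact: (@is_derive_ln_comp (fun s : R => 1 - (p s * p s + q s * q s))).
  apply: is_derive_eq dc _.
  by rewrite cmod_sqr -/(p t) -/(q t) !expr2; ring.
pose psi (s : R) := - (32 * ln (1 - s * cmod z)).
have dpsi t : 0 <= t <= 1 -> is_derive (t : R) (1 : R) psi (32 * (cmod z / (1 - t * cmod z))).
  by move=> t01; exact: is_derive_Lam.
have bound t : 0 <= t <= 1 ->
   `|2 * (p t * complex.Re (dh t) + q t * complex.Im (dh t)) /
     (1 - cmod (h (t%:C%C * z)) ^+ 2)| <= 32 * (cmod z / (1 - t * cmod z)).
  move=> t01; have [hd e] := segment_in_disk hz t01.
  have P0 := disk_sqr (sh _ hd); have P1 := sh _ hd.
  have SP := schwarz_pick (conj hh sh) hd (holo_cderiv hh hd).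
  have := radial_weight hz t01; have W := disk_sqr hd.
  rewrite normrM normfV (gtr0_norm P0) ler_pdivrMr // => rw.
  have : `|p t * complex.Re (dh t) + q t * complex.Im (dh t)| <= cmod (dh t).
    have -> : p t * complex.Re (dh t) + q t * complex.Im (dh t) =
       complex.Re (cconj (h (t%:C%C * z)) * dh t) by rewrite cReM /=; ring.
    apply: le_trans (abs_Re_le _) _; rewrite cmodM cmod_conj ler_piMl ?cmod_ge0 //.
    exact: ltW.
  rewrite normrM ger0_norm // => h3; apply: le_trans (ler_wpM2l _ h3) _ => //.
  rewrite /dh cmodM; set D := cmod (cderiv _ _) in SP *.
  have D0 : 0 <= D := cmod_ge0 _.
  have k0 : 0 <= cmod z / (1 - t * cmod z).
    by rewrite divr_ge0 ?cmod_ge0 // subr_ge0 -e; exact: ltW.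
  have s1 := ler_wpM2l D0 rw; have s2 := ler_wpM2r k0 SP.
  move: s1 s2; set w1 := 1 - _; set X := cmod z / _; set A := 1 - _.
  by move=> s1 s2; clear -s1 s2; lra.
have N0 : N 0 = ln (1 - cmod (h 0) ^+ 2) by rewrite /N mul0r.
have N1 : N 1 = ln (1 - cmod (h z) ^+ 2) by rewrite /N mul1r.
have psi0 : psi 0 = 0 by rewrite /psi mul0r subr0 ln1 mulr0 oppr0.
have psi1 : psi 1 = 32 * Lam z by rewrite /psi mul1r /Lam mulrN.
(* Taken with s = 1 and s = -1, this yields both halves of the absolute value. *)
have mvt (s : R) : `|s| = 1 -> s * (N 1 - N 0) <= 32 * Lam z.
  move=> s1.
  pose G := fun t : R => psi t - s * N t.
  pose dG t := 32 * (cmod z / (1 - t * cmod z)) - s * (- (2 * (p t * complex.Re (dh t) + q t * complex.Im (dh t)) /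
     (1 - cmod (h (t%:C%C * z)) ^+ 2))).
  have GG t : 0 <= t <= 1 -> is_derive (t : R) (1 : R) G (dG t).
    by move=> t01; apply: is_derive_subr; [exact: dpsi|apply: is_derive_scale; exact: dN].
  have [||x] := @MVT_segment R G dG 0 1 ler01.
  - by move=> x; rewrite in_itv /= => /andP[? ?]; apply: GG; rewrite !ltW.
  - apply: derivable_within_continuous => x; rewrite in_itv /= => x01.
    by have [] := GG x x01.
  rewrite in_itv /= => x01; rewrite subr0 mulr1 => E.
  have : 0 <= dG x.
    rewrite subr_ge0; apply: le_trans (bound x x01).
    by apply: le_trans (ler_norm _) _; rewrite normrM s1 mul1r normrN.
  by rewrite -E /G psi0 psi1 mulrBr => dG0; clear -dG0; lra.
have hd0 := sh _ disk0; have hdz := sh _ hz.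
rewrite !LwE // -N0 -N1 ler_norml.
have := mvt 1 (normr1 _); have := mvt (-1) ltac:(by rewrite normrN normr1).
rewrite mulN1r mul1r; lra.
Qed.

End Growth.

(** * The Bloch space and compactness of dilations *)

Section BlochSpace.
Context {R : realType}.
Implicit Types (f g : R[i] -> R[i]) (z w c l : R[i]) (T : (R[i] -> R[i]) -> R[i] -> R[i]).

Lemma bloch_semi_ge f z l : disk z -> has_cderiv f z l ->
  (((1 - cmod z ^+ 2) * cmod l)%:E <= bloch_semi f)%E.
Proof. by move=> hz hl; apply: ereal_sup_ubound; exists z, l. Qed.

Lemma bloch_semi_le f (M : R) :
  (forall z l, disk z -> has_cderiv f z l -> (1 - cmod z ^+ 2) * cmod l <= M) ->
  (bloch_semi f <= M%:E)%E.
Proof. by move=> H; apply: ge_ereal_sup => _ [z [l [hz hl ->]]]; rewrite lee_fin H. Qed.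

Lemma bloch_semi_ge0 f : holo_disk f -> (0 <= bloch_semi f)%E.
Proof.
move=> hf; have [l hl] := hf 0 disk0; apply: le_trans (bloch_semi_ge disk0 hl).
by rewrite lee_fin mulr_ge0 ?cmod_ge0 //; apply: disk_sqr_le; exact: disk0.
Qed.

Lemma bloch_norm_ge0 f : holo_disk f -> (0 <= bloch_norm f)%E.
Proof. by move=> hf; rewrite adde_ge0 ?bloch_semi_ge0 // lee_fin cmod_ge0. Qed.

Lemma bloch_norm_le f (m M : R) : cmod (f 0) <= m ->
  (forall z l, disk z -> has_cderiv f z l -> (1 - cmod z ^+ 2) * cmod l <= M) ->
  (bloch_norm f <= (m + M)%:E)%E.
Proof. by move=> hm HM; rewrite EFinD leeD ?lee_fin // bloch_semi_le. Qed.

Lemma bloch_normP f (M : R) : holo_disk f -> (bloch_norm f <= M%:E)%E ->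
  cmod (f 0) <= M /\
  forall z l, disk z -> has_cderiv f z l -> (1 - cmod z ^+ 2) * cmod l <= M.
Proof.
move=> hf HM; have s0 := bloch_semi_ge0 hf; split.
  rewrite -lee_fin; apply: le_trans HM; rewrite /bloch_norm.
  by rewrite -[leLHS]adde0 leeD2l.
move=> z l hz hl; rewrite -lee_fin; apply: le_trans (bloch_semi_ge hz hl) _.
by apply: le_trans HM; rewrite /bloch_norm -[leLHS]add0e leeD2r // lee_fin cmod_ge0.
Qed.

Lemma bloch_norm_eq f g : (forall z, disk z -> f z = g z) -> bloch_norm f = bloch_norm g.
Proof.
move=> fg; rewrite /bloch_norm fg; last exact: disk0.
congr (_ + ereal_sup _)%E; apply/seteqP; split=> x [z [l [hz hl ->]]]; exists z, l; split=> //.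
  have [r r0 hr] := copen_disk hz.
  by apply: has_cderiv_near r0 _ hl => w /hr; exact: fg.
have [r r0 hr] := copen_disk hz.
by apply: has_cderiv_near r0 _ hl => w /hr /fg.
Qed.

Lemma in_blochI f (m M : R) : holo_disk f -> cmod (f 0) <= m ->
  (forall z l, disk z -> has_cderiv f z l -> (1 - cmod z ^+ 2) * cmod l <= M) -> in_bloch f.
Proof.
by move=> hf hm HM; split=> //; apply: le_lt_trans (bloch_norm_le hm HM) (ltry _).
Qed.

Lemma in_bloch_fin f : in_bloch f -> exists2 M : R, 0 < M & bloch_norm f = M%:E \/ (bloch_norm f <= M%:E)%E.
Proof.
move=> [hf nf]; have n0 := bloch_norm_ge0 hf.
exists (fine (bloch_norm f) + 1); first by rewrite ltr_wpDl ?fine_ge0.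
by right; rewrite EFinD fineK ?ge0_fin_numE // leeDl.
Qed.

Lemma holoD f g : holo_disk f -> holo_disk g -> holo_disk (fun z => f z + g z).
Proof.
move=> hf hg z hz; have [l hl] := hf z hz; have [m hm] := hg z hz.
by exists (l + m); exact: has_cderivD.
Qed.

Lemma holoB f g : holo_disk f -> holo_disk g -> holo_disk (fun z => f z - g z).
Proof.
move=> hf hg z hz; have [l hl] := hf z hz; have [m hm] := hg z hz.
by exists (l - m); exact: has_cderivB.
Qed.

Lemma holoM f g : holo_disk f -> holo_disk g -> holo_disk (fun z => f z * g z).
Proof.
move=> hf hg z hz; have [l hl] := hf z hz; have [m hm] := hg z hz.
by eexists; exact: has_cderivM hl hm.
Qed.

Lemma holoX f n : holo_disk f -> holo_disk (fun z => f z ^+ n).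
Proof.
by move=> hf z hz; have [l hl] := hf z hz; eexists; exact: has_cderivX hl.
Qed.

Lemma holo_cst c : holo_disk (fun=> c).
Proof. by move=> z _; exists 0; exact: has_cderiv_cst. Qed.

Lemma holo_id : holo_disk (id : R[i] -> R[i]).
Proof. by move=> z _; exists 1; exact: has_cderiv_id. Qed.

Lemma bloch_normD f g : holo_disk f -> holo_disk g ->
  (bloch_norm (fun z => f z + g z)%R <= bloch_norm f + bloch_norm g)%E.
Proof.
move=> hf hg; rewrite /bloch_norm addeACA; apply: leeD.
  by rewrite -EFinD lee_fin cmodD.
apply: ge_ereal_sup => _ [z [l [hz hl ->]]].
have D := has_cderivD (holo_cderiv hf hz) (holo_cderiv hg hz).
rewrite (has_cderiv_unique hl D).
apply: le_trans (leeD (bloch_semi_ge hz (holo_cderiv hf hz)) (bloch_semi_ge hz (holo_cderiv hg hz))).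
by rewrite -EFinD lee_fin -mulrDr ler_wpM2l ?cmodD // disk_sqr_le.
Qed.

Lemma bloch_normZ f c (M : R) : holo_disk f -> (bloch_norm f <= M%:E)%E ->
  (bloch_norm (fun z => c * f z)%R <= (cmod c * M)%:E)%E.
Proof.
move=> hf HM; have nf := le_lt_trans HM (ltry M).
have s0 := bloch_semi_ge0 hf.
have sfin : bloch_semi f \is a fin_num.
  rewrite ge0_fin_numE //; apply: le_lt_trans nf.
  by rewrite /bloch_norm leeDr // lee_fin cmod_ge0.
have E : bloch_semi f = (fine (bloch_semi f))%:E by rewrite fineK.
have le1 : cmod (f 0) + fine (bloch_semi f) <= M by rewrite -lee_fin EFinD -E.
apply: le_trans (_ : (cmod c * cmod (f 0) + cmod c * fine (bloch_semi f))%:E <= _)%E; last first.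
  by rewrite lee_fin -mulrDr ler_wpM2l ?cmod_ge0.
apply: bloch_norm_le; first by rewrite cmodM.
move=> z l hz hl.
have D := has_cderivZ c (holo_cderiv hf hz).
rewrite (has_cderiv_unique hl D) cmodM mulrCA ler_wpM2l ?cmod_ge0 //.
by rewrite -lee_fin -E bloch_semi_ge //; exact: holo_cderiv.
Qed.

Lemma bloch_normB f g : holo_disk f -> holo_disk g ->
  (bloch_norm (fun z => f z - g z)%R <= bloch_norm f + bloch_norm g)%E.
Proof.
move=> hf hg; rewrite /bloch_norm addeACA; apply: leeD.
  by rewrite -EFinD lee_fin cmodB.
apply: ge_ereal_sup => _ [z [l [hz hl ->]]].
have D := has_cderivB (holo_cderiv hf hz) (holo_cderiv hg hz).
rewrite (has_cderiv_unique hl D).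
apply: le_trans (leeD (bloch_semi_ge hz (holo_cderiv hf hz)) (bloch_semi_ge hz (holo_cderiv hg hz))).
by rewrite -EFinD lee_fin -mulrDr ler_wpM2l ?cmodB // disk_sqr_le.
Qed.

Lemma in_blochD f g : in_bloch f -> in_bloch g -> in_bloch (fun z => f z + g z).
Proof.
move=> [hf nf] [hg ng]; split; first exact: holoD.
by apply: le_lt_trans (bloch_normD hf hg) _; rewrite lte_add_pinfty.
Qed.

Lemma in_blochB f g : in_bloch f -> in_bloch g -> in_bloch (fun z => f z - g z).
Proof.
move=> [hf nf] [hg ng]; split; first exact: holoB.
by apply: le_lt_trans (bloch_normB hf hg) _; rewrite lte_add_pinfty.
Qed.

Lemma in_blochZ f c : in_bloch f -> in_bloch (fun z => c * f z).
Proof.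
move=> bf; have [M M0 HM] := in_bloch_fin bf; case: bf => hf nf; split.
  by apply: holoM => //; exact: holo_cst.
have {}HM : (bloch_norm f <= M%:E)%E by case: HM => [->|//].
by apply: le_lt_trans (bloch_normZ c hf HM) (ltry _).
Qed.

Lemma in_bloch_cst c : in_bloch (fun=> c).
Proof.
apply: (@in_blochI _ (cmod c) 0) => //; first exact: holo_cst.
move=> z l _ hl; rewrite (has_cderiv_unique hl (has_cderiv_cst c z)) cmod0 mulr0 //.
Qed.

Lemma bloch_growth f z (M : R) : holo_disk f -> (bloch_norm f <= M%:E)%E -> disk z ->
  cmod (f z) <= M * (1 + Lam z).
Proof.
move=> hf HM hz; have [h0 hd] := bloch_normP hf HM.
have := disk_growth hf hz (K := M) => H.
have {}H : cmod (f z - f 0) <= M * Lam z.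
  by apply: H => w l wz; apply: hd; apply: le_lt_trans wz hz.
have -> : f z = (f z - f 0) + f 0 by rewrite subrK.
by apply: le_trans (cmodD _ _) _; lra.
Qed.

(** Homogeneity is required only on the disk, because a compact operator in the sense of
    [compact_bloch] is linear only there. *)
Lemma op_norm_bound T f (M m : R) :
  (forall f, in_bloch f -> in_bloch (T f)) ->
  (forall f c z, in_bloch f -> disk z -> T (fun w => c * f w) z = c * T f z) ->
  (op_norm T <= M%:E)%E -> in_bloch f -> (bloch_norm f <= m%:E)%E -> 0 < m ->
  (bloch_norm (T f) <= (M * m)%:E)%E.
Proof.
move=> HT hom HM bf nf m0.
have mC : (m^-1)%:C%C != 0 :> R[i] by rewrite -cmod_gt0 cmod_real normr_gt0 invr_eq0 gt_eqF.
pose g := fun w => (m^-1)%:C%C * f w.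
have bg : in_bloch g by exact: in_blochZ.
have ng : (bloch_norm g <= 1)%E.
  apply: le_trans (bloch_normZ _ bf.1 nf) _.
  by rewrite cmod_real gtr0_norm ?invr_gt0 // mulVf ?gt_eqF // lexx.
have nTg : (bloch_norm (T g) <= M%:E)%E.
  by apply: le_trans HM; apply: ereal_sup_ubound; exists g.
have -> : bloch_norm (T f) = bloch_norm (fun z => m%:C%C * T g z).
  apply: bloch_norm_eq => z hz; rewrite hom // mulrA -rmorphM /= mulfV ?gt_eqF //.
  by rewrite mul1r.
apply: le_trans (bloch_normZ _ (HT g bg).1 nTg) _.
by rewrite cmod_real gtr0_norm // mulrC.
Qed.

Lemma op_norm_ge0 T : (forall f, in_bloch f -> in_bloch (T f)) -> (0 <= op_norm T)%E.
Proof.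
move=> HT; have b0 : in_bloch (fun=> 0 : R[i]) by exact: in_bloch_cst.
apply: le_trans (bloch_norm_ge0 (HT _ b0).1) _; apply: ereal_sup_ubound.
exists (fun=> 0) => //; split=> //; rewrite -(add0r (1 : R)).
apply: bloch_norm_le; rewrite ?cmod0 // => z l _ hl.
by rewrite (has_cderiv_unique hl (has_cderiv_cst 0 z)) cmod0 mulr0 ler01.
Qed.

Lemma op_norm_le T (M : R) :
  (forall f, in_bloch f -> (bloch_norm f <= 1)%E -> (bloch_norm (T f) <= M%:E)%E) ->
  (op_norm T <= M%:E)%E.
Proof. by move=> H; apply: ge_ereal_sup => _ [f [bf nf] <-]; exact: H. Qed.

Lemma wcomp_hom (u phi f : R[i] -> R[i]) c z :
  wcomp u phi (fun w => c * f w) z = c * wcomp u phi f z.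
Proof. by rewrite /wcomp; ring. Qed.

Lemma compact_hom K f c z : compact_bloch K -> in_bloch f -> disk z ->
  K (fun w => c * f w) z = c * K f z.
Proof.
move=> [K1 K2 _ _] bf hz; have := K2 f f c 0 bf bf z hz; rewrite mul0r addr0 => <-.
apply: K1 => //; first exact: in_blochZ.
  by apply: in_blochD; exact: in_blochZ.
by move=> w _; rewrite mul0r addr0.
Qed.

Lemma compactD K f g z : compact_bloch K -> in_bloch f -> in_bloch g -> disk z ->
  K (fun w => f w + g w) z = K f z + K g z.
Proof.
move=> [K1 K2 _ _] bf bg hz; have := K2 f g 1 1 bf bg z hz; rewrite !mul1r => <-.
apply: K1 => //; first exact: in_blochD.
  by apply: in_blochD; exact: in_blochZ.
by move=> w _; rewrite !mul1r.
Qed.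

End BlochSpace.

(** * Normal families and the compactness of dilations *)

Section Montel.
Context {R : realType}.
Implicit Types (f g : R[i] -> R[i]) (z w l : R[i]).

Lemma ultra_limit (U : set_system nat) (x : nat -> R) (M : R) : UltraFilter U ->
  (forall n, `|x n| <= M) ->
  exists l : R, forall e, 0 < e -> U [set n | `|x n - l| < e].
Proof.
move=> UU xM; have UP : ProperFilter U by exact: ultra_proper.
have cpt := @segment_compact R (- M) M.
have FA : (x @ U) `[- M, M]%classic.
  by apply: (@filterE _ U) => n /=; rewrite in_itv /= -ler_norml xM.
have [l [_ cl]] := cpt _ _ FA.
exists l => e e0.
have [//|UC] := in_ultra_setVsetC [set n | `|x n - l| < e] UU.
have Fc : (x @ U) [set y | e <= `|y - l|].
  have : U [set n | e <= `|x n - l|].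
    by apply: filterS UC => n /=; rewrite leNgt => /negP.
  by [].
have Bl : nbhs l [set y | `|y - l| < e].
  by near=> y; rewrite /= distrC; near: y; exact: (@cvgr_dist_lt _ _ _ _ _ id l (@cvg_id _ _) e e0).
have [y [/= h1 h2]] := cl _ _ Fc Bl.
by have := lt_le_trans h2 h1; rewrite ltxx.
Unshelve. all: by end_near. Qed.

(** One ultrafilter, finer than the filter of tails, gives limits at all indices t at once. It is
    used with pairs of a point and a boolean, so that values and derivatives converge along the same
    filter. *)
Lemma ultra_limit_fun (T : Type) (x : nat -> T -> R[i]) (M : T -> R) :
  (forall n t, cmod (x n t) <= M t) ->
  exists (U : set_system nat) (g : T -> R[i]), [/\ ProperFilter U,
    forall N, U [set n | (N <= n)%N] &
    forall t e, 0 < e -> U [set n | cmod (x n t - g t) < e]].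
Proof.
move=> xM.
have [U [UU sU]] := @ultraFilterLemma nat \oo _.
have UP : ProperFilter U by exact: ultra_proper.
have lim t : exists l, forall e, 0 < e -> U [set n | cmod (x n t - l) < e].
  have [a ha] := @ultra_limit U (fun n => complex.Re (x n t)) (M t) UU
     (fun n => le_trans (abs_Re_le _) (xM n t)).
  have [b hb] := @ultra_limit U (fun n => complex.Im (x n t)) (M t) UU
     (fun n => le_trans (abs_Im_le _) (xM n t)).
  exists (Complex a b) => e e0; have e2 : 0 < e / 2 by rewrite divr_gt0.
  apply: filterS2 (ha _ e2) (hb _ e2) => n /= h1 h2.
  by apply: le_lt_trans (cmod_le_ReIm _) _; rewrite cReB cImB (splitr e) ltrD.
have [g hg] := choice lim.
exists U, g; split=> // N; apply: sU; exact: nbhs_infty_ge.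
Qed.

Lemma increasing_subseq (P : nat -> nat -> Prop) :
  (forall N k, exists2 n, (N <= n)%N & P k n) ->
  exists s : nat -> nat, (forall k, (s k < s k.+1)%N) /\ forall k, P k (s k).
Proof.
move=> H.
have step (s : nat * nat) : {s' : nat * nat | s'.1 = s.1.+1 /\ (s.2 < s'.2)%N /\ P s'.1 s'.2}.
  by apply: cid; have [n h1 h2] := H s.2.+1 s.1.+1; exists (s.1.+1, n).
have [n0 _ hn0] := H 0%N 0%N.
have [S [S0 SS]] := dependent_choice step (0%N, n0).
have E k : (S k).1 = k by elim: k => [|k IH]; [rewrite S0|have [-> _] := SS k; rewrite IH].
exists (fun k => (S k).2); split=> k; first by have [_ []] := SS k.
case: k => [|k]; first by rewrite S0.
by have [_ [_]] := SS k; rewrite E.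
Qed.

(* Rounding each coordinate towards [0] keeps the grid point in the same disk. *)
Lemma grid_point (rho de : R) : 0 < de -> exists N : nat, forall z, cmod z <= rho ->
  exists i : 'I_N * 'I_N * bool * bool,
    let q := Complex ((-1) ^+ i.1.2 * (i.1.1.1%:R * de)) ((-1) ^+ i.2 * (i.1.1.2%:R * de)) in
    cmod q <= cmod z /\ cmod (z - q) <= 2 * de.
Proof.
move=> de0; exists (Num.truncn (rho / de)).+1 => z hz.
have coord (x : R) : `|x| <= cmod z -> exists (i : 'I_(Num.truncn (rho / de)).+1) (b : bool),
    `|(-1) ^+ b * (i%:R * de)| <= `|x| /\ `|x - (-1) ^+ b * (i%:R * de)| <= de.
  move=> hx; have q0 : 0 <= `|x| / de by rewrite divr_ge0 // ltW.
  have hi : (Num.truncn (`|x| / de) < (Num.truncn (rho / de)).+1)%N.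
    by rewrite ltnS; apply: le_truncn; rewrite ler_wpM2r ?invr_ge0 ?(ltW de0) // (le_trans hx).
  exists (Ordinal hi), (x < 0) => /=.
  have /andP[t1 t2] := truncn_itv q0.
  rewrite ler_pdivlMr // in t1; rewrite ltr_pdivrMr // in t2.
  set k := Num.truncn _ in t1 t2 *.
  have kd0 : 0 <= k%:R * de by rewrite mulr_ge0 // ltW.
  have t3 : `|x| < k%:R * de + de by move: t2; rewrite -natr1 mulrDl mul1r.
  clear -t1 t3 kd0 de0; split.
    by rewrite normrM normrX normrN1 expr1n mul1r ger0_norm.
  case: (ltrP x 0) t1 t3 => hx; rewrite ?expr1 ?expr0 ?mul1r ?mulN1r ?opprK.
    by rewrite ltr0_norm // ler_norml; lra.
  by rewrite ger0_norm // ler_norml; lra.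
have [i [b [h1 h2]]] := coord _ (abs_Re_le z).
have [j [c [h3 h4]]] := coord _ (abs_Im_le z).
exists (i, j, b, c) => /=; split; last first.
  apply: le_trans (cmod_le_ReIm _) _; rewrite cReB cImB /=; move: h2 h4; lra.
rewrite -(@ler_pXn2r _ 2) ?nnegrE ?cmod_ge0 // !cmod_sqr /=.
have sq (x y : R) : `|x| <= `|y| -> x ^+ 2 <= y ^+ 2.
  by move=> h; rewrite -(real_normK (num_real x)) -(real_normK (num_real y)) lerXn2r ?nnegrE.
by apply: lerD; apply: sq.
Qed.

Lemma holo_lipschitz f (K rho : R) z w : holo_disk f -> rho < 1 ->
  (forall v l, cmod v <= rho -> has_cderiv f v l -> cmod l <= K) ->
  cmod z <= rho -> cmod w <= rho -> cmod (f w - f z) <= K * cmod (w - z).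
Proof.
move=> hf r1 HK hz hw.
have inr (t : R) : 0 <= t <= 1 -> cmod (z + t%:C%C * (w - z)) <= rho.
  move=> /andP[t0 t1]; have -> : z + t%:C%C * (w - z) = (1 - t)%:C%C * z + t%:C%C * w.
    by rewrite rmorphB rmorph1; ring.
  apply: le_trans (cmodD _ _) _; rewrite !cmodM !cmod_real !ger0_norm ?subr_ge0 //.
  have h1 : (1 - t) * cmod z <= (1 - t) * rho by rewrite ler_wpM2l // subr_ge0.
  have h2 : t * cmod w <= t * rho by rewrite ler_wpM2l.
  clear -h1 h2; lra.
have := @segment_lipschitz R f (fun t => cderiv f (z + t%:C%C * (w - z))) z (w - z) K.
have -> : z + (w - z) = w by rewrite addrC subrK.
apply.
- by move=> t /inr h; apply: holo_cderiv => //; apply: le_lt_trans h r1.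
- move=> t /inr h; apply: (HK _ _ h); apply: holo_cderiv => //; exact: le_lt_trans h r1.
Qed.

Lemma bloch_deriv_le f (M rho : R) v l : holo_disk f -> (bloch_norm f <= M%:E)%E ->
  rho < 1 -> cmod v <= rho -> has_cderiv f v l -> cmod l <= M / (1 - rho ^+ 2).
Proof.
move=> hf hM r1 hv hl; have [_ H] := bloch_normP hf hM.
have hd : disk v := le_lt_trans hv r1.
have r0 : 0 <= rho := le_trans (cmod_ge0 _) hv.
have p : 0 < 1 - rho ^+ 2 by rewrite subr_gt0 expr_lt1.
rewrite ler_pdivlMr // mulrC; apply: le_trans (H v l hd hl).
by rewrite ler_wpM2r ?cmod_ge0 // lerD2l lerN2 lerXn2r ?nnegrE ?cmod_ge0.
Qed.

Section Limit.
Variables (fs : nat -> R[i] -> R[i]) (M : R).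
Hypothesis bfs : forall n, in_bloch (fs n) /\ (bloch_norm (fs n) <= M%:E)%E.

Let M_ge0 : 0 <= M.
Proof.
have [[hf _] hM] := bfs 0%N.
by rewrite -lee_fin (le_trans (bloch_norm_ge0 hf)).
Qed.

(* A pointwise limit along an ultrafilter; equicontinuity upgrades it to a
   locally uniform one, which replaces the diagonal subsequence argument. *)
Lemma bloch_ultra_limit : exists (U : set_system nat) (g G : R[i] -> R[i]),
  [/\ ProperFilter U, forall N, U [set n | (N <= n)%N],
   forall z e, disk z -> 0 < e -> U [set n | cmod (fs n z - g z) < e] &
   forall z e, disk z -> 0 < e -> U [set n | cmod (cderiv (fs n) z - G z) < e]].
Proof.
pose x n (t : R[i] * bool) : R[i] := if `[< disk t.1 >] then
   (if t.2 then cderiv (fs n) t.1 else fs n t.1) else 0.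
pose B (t : R[i] * bool) : R := if `[< disk t.1 >] then
   (if t.2 then M / (1 - cmod t.1 ^+ 2) else M * (1 + Lam t.1)) else 0.
have [n t|U [g [UP UN Ug]]] := @ultra_limit_fun _ x B.
  rewrite /x /B; case: asboolP => [ht|_]; last by rewrite cmod0.
  have [[hf _] hM] := bfs n; case: ifP => _.
    by apply: bloch_deriv_le (lexx _) (holo_cderiv hf ht).
  exact: bloch_growth.
exists U, (fun z => g (z, false)), (fun z => g (z, true)); split=> // z e hz e0.
  by have := Ug (z, false) e e0; rewrite /x /=; case: asboolP.
by have := Ug (z, true) e e0; rewrite /x /=; case: asboolP.
Qed.

Variables (U : set_system nat) (g G : R[i] -> R[i]).
Hypothesis UP : ProperFilter U.
Hypothesis Ug : forall z e, disk z -> 0 < e -> U [set n | cmod (fs n z - g z) < e].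
Hypothesis UG : forall z e, disk z -> 0 < e -> U [set n | cmod (cderiv (fs n) z - G z) < e].

(** All members share a Lipschitz constant on |z| <= rho, inherited by the limit; closeness at the
    finitely many grid points therefore spreads to the whole disk, and a filter is closed under
    finite intersections. *)
Lemma limit_uniform (rho e : R) : rho < 1 -> 0 < e ->
  U [set n | forall z, cmod z <= rho -> cmod (fs n z - g z) <= e].
Proof.
move=> r1 e0.
have [r0|r0] := ltP rho 0.
  by apply: filterE => n z /(le_trans (cmod_ge0 z)); rewrite leNgt r0.
pose K := M / (1 - rho ^+ 2).
have p : 0 < 1 - rho ^+ 2 by rewrite subr_gt0 expr_lt1.
have K0 : 0 <= K by rewrite divr_ge0 // ltW.
have lipf n z w : cmod z <= rho -> cmod w <= rho ->
    cmod (fs n w - fs n z) <= K * cmod (w - z).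
  have [[hf _] hM] := bfs n.
  by apply: holo_lipschitz => // v l; exact: bloch_deriv_le.
have lipg z w : cmod z <= rho -> cmod w <= rho -> cmod (g w - g z) <= K * cmod (w - z).
  move=> hz hw; apply/ler_addgt0Pr => d d0; have d2 : 0 < d / 2 by rewrite divr_gt0.
  have [n [/= a b]] := filter_ex (filterI (Ug (le_lt_trans hz r1) d2) (Ug (le_lt_trans hw r1) d2)).
  have -> : g w - g z = (fs n w - fs n z) + ((fs n z - g z) - (fs n w - g w)) by ring.
  apply: le_trans (cmodD _ _) _; rewrite lerD ?lipf //.
  by apply: le_trans (cmodB _ _) _; rewrite [leRHS]splitr lerD // ltW.
(* A grid point within 2 de costs at most e / 4 for the sequence and e / 4 for the limit, leaving e
   / 2 at the grid point itself. *)
pose de := e / (8 * (K + 1)).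
have K1 : 0 < K + 1 by rewrite ltr_wpDl.
have de0 : 0 < de by rewrite divr_gt0 // mulr_gt0.
have Kde : K * (2 * de) <= e / 4.
  rewrite /de; have -> : K * (2 * (e / (8 * (K + 1)))) = e / 4 * (K / (K + 1)).
    by field; rewrite gt_eqF.
  by rewrite ler_piMr ?divr_ge0 // ?(ltW e0) // ler_pdivrMr // mul1r lerDl ler01.
have [N HN] := grid_point rho de0.
pose q (i : 'I_N * 'I_N * bool * bool) : R[i] :=
  Complex ((-1) ^+ i.1.2 * (i.1.1.1%:R * de)) ((-1) ^+ i.2 * (i.1.1.2%:R * de)).
have Uq : U [set n | forall i, disk (q i) -> cmod (fs n (q i) - g (q i)) < e / 2].
  apply: filter_forall => i; have [h|h] := pselect (disk (q i)).
    by apply: filterS (Ug h (divr_gt0 e0 (ltr0Sn R 1))) => n /= hn _.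
  by apply: filterE.
apply: filterS Uq => n /= Hn z hz; have [i [/= qz zq]] := HN z hz.
have hq : cmod (q i) <= rho := le_trans qz hz.
have -> : fs n z - g z = (fs n z - fs n (q i)) + (fs n (q i) - g (q i)) - (g z - g (q i)) by ring.
apply: le_trans (cmodB _ _) _.
have b1 : cmod (g z - g (q i)) <= e / 4.
  by apply: le_trans (lipg _ _ hq hz) _; apply: le_trans Kde; rewrite ler_wpM2l.
have b2 : cmod (fs n z - fs n (q i)) <= e / 4.
  by apply: le_trans (lipf n _ _ hq hz) _; apply: le_trans Kde; rewrite ler_wpM2l.
have b3 := ltW (Hn i (le_lt_trans hq r1)).
have := cmodD (fs n z - fs n (q i)) (fs n (q i) - g (q i)).
by clear -b1 b2 b3; lra.
Qed.

(** As g is not yet known to be holomorphic, the Cauchy estimate is applied to the difference of two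
    members. The index m of the second may depend on z and is picked so that its derivative at z is
    close to G(z); the condition on n stays independent of z. *)
Lemma limit_deriv_uniform (r e : R) : 0 <= r < 1 -> 0 < e ->
  U [set n | forall z, cmod z <= r -> cmod (cderiv (fs n) z - G z) <= e].
Proof.
move=> /andP[r0 r1] e0; pose rho := (r + 1) / 2.
have rr : r < rho by rewrite /rho; lra.
have rho1 : rho < 1 by rewrite /rho; lra.
have d0 : 0 < rho - r by rewrite subr_gt0.
(* Solves 16 * (4 eta) / (rho - r) = e / 2, where 4 eta bounds the oscillation of the difference on
   the disk of radius rho - r. *)
pose eta := e * (rho - r) / (2 * 64).
have eta0 : 0 < eta by rewrite divr_gt0 // ?mulr_gt0.
have Uu := limit_uniform rho1 eta0.
apply: filterS Uu => n /= Hn z hz.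
have hd : disk z := le_lt_trans hz r1.
have [m [/= Hm Gm]] := filter_ex (filterI (limit_uniform rho1 eta0) (UG hd (divr_gt0 e0 (ltr0Sn R 1)))).
have [[hfn _] _] := bfs n; have [[hfm _] _] := bfs m.
have inrho w : cmod (w - z) < rho - r -> cmod w <= rho.
  by have := cmodD (w - z) z; rewrite subrK => h1 h2; lra.
pose F : R[i] -> R[i] := fun w => fs n w - fs m w.
have hF : holo_disk F by exact: holoB.
have dF := has_cderivB (holo_cderiv hfn hd) (holo_cderiv hfm hd).
have small w : cmod w <= rho -> cmod (F w) <= 2 * eta.
  move=> hw; have -> : F w = (fs n w - g w) - (fs m w - g w) by rewrite /F; ring.
  apply: le_trans (cmodB _ _) _; have := Hn w hw; have := Hm w hw; lra.
have H1 w : cmod (w - z) < rho - r -> exists l, has_cderiv F w l.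
  by move=> hw; apply: hF; apply: le_lt_trans rho1; exact: inrho.
have H2 w : cmod (w - z) < rho - r -> cmod (F w - F z) <= 4 * eta.
  move=> hw; apply: le_trans (cmodB _ _) _; have := small w (inrho w hw).
  have := small z (le_trans hz (ltW rr)); lra.
have C : cmod (cderiv (fs n) z - cderiv (fs m) z) <= e / 2.
  have CC := cauchy_disk_est d0 H1 dF H2.

  apply: le_trans CC _.
  by rewrite /eta le_eqVlt; apply/orP; left; apply/eqP; field; rewrite gt_eqF.
have -> : cderiv (fs n) z - G z =
   (cderiv (fs n) z - cderiv (fs m) z) + (cderiv (fs m) z - G z) by ring.
by apply: le_trans (cmodD _ _) _; rewrite [leRHS]splitr lerD // ltW.
Qed.

(** Increments of [fs n] - [fs m] are at most (e/4) |h| by closeness of the derivatives; letting m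
    follow the filter gives the same bound for [fs n] - g, with nothing known about g. A single
    member n then transfers its difference quotient to g. *)
Lemma limit_has_cderiv z : disk z -> has_cderiv g z (G z).
Proof.
move=> hz e e0; pose r := (cmod z + 1) / 2.
have hz' : cmod z < 1 := hz.
have zr : cmod z < r by rewrite /r; lra.
have r1 : r < 1 by rewrite /r; lra.
have r0 : 0 <= r < 1 by rewrite r1 andbT (le_trans (cmod_ge0 z)) // ltW.
have e4 : 0 < e / 4 by rewrite divr_gt0.
have Ud := limit_deriv_uniform r0 (divr_gt0 e0 (ltr0Sn R 15)).
have [n Hn] := filter_ex Ud.
have [[hfn _] _] := bfs n.
have [d d0 hd] := holo_cderiv hfn hz e4.
exists (Num.min d (r - cmod z)); first by rewrite lt_min d0 subr_gt0.
move=> h h0; rewrite lt_min => /andP[hd1 hd2].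
have h0' : 0 < cmod h by rewrite cmod_gt0.
have zh : cmod (z + h) <= r.
  by apply: le_trans (cmodD _ _) _; lra.
have key : cmod ((fs n (z + h) - g (z + h)) - (fs n z - g z)) <= e / 4 * cmod h.
  apply/ler_addgt0Pr => t t0; have t2 : 0 < t / 2 by rewrite divr_gt0.
  have [m [/= Hm [m1 m2]]] :=
    filter_ex (filterI Ud (filterI (Ug hz t2) (Ug (le_lt_trans zh r1) t2))).
  have [[hfm _] _] := bfs m.
  have L := @holo_lipschitz (fun w => fs n w - fs m w) (e / 4) r z (z + h) (holoB hfn hfm) r1 _ (ltW zr) zh.
  have {}L : cmod (fs n (z + h) - fs m (z + h) - (fs n z - fs m z)) <= e / 4 * cmod h.
    have -> : cmod h = cmod (z + h - z) by rewrite addrAC subrr add0r.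
    apply: L => v l hv hl.
    have hvd : disk v := le_lt_trans hv r1.
    rewrite (has_cderiv_unique hl (has_cderivB (holo_cderiv hfn hvd) (holo_cderiv hfm hvd))).
    have -> : cderiv (fs n) v - cderiv (fs m) v =
       (cderiv (fs n) v - G v) - (cderiv (fs m) v - G v) by ring.
    apply: le_trans (cmodB _ _) _; have := Hn v hv; have := Hm v hv.
    have -> : e / 16 = e / 4 / 4 by field.
    lra.
  have -> : fs n (z + h) - g (z + h) - (fs n z - g z) =
     (fs n (z + h) - fs m (z + h) - (fs n z - fs m z)) +
     ((fs m (z + h) - g (z + h)) - (fs m z - g z)) by ring.
  apply: le_trans (cmodD _ _) _; rewrite lerD //.
  by apply: le_trans (cmodB _ _) _; rewrite [leRHS]splitr lerD // ltW.
have -> : (g (z + h) - g z) / h - G z =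
   ((fs n (z + h) - fs n z) / h - cderiv (fs n) z) + (cderiv (fs n) z - G z)
   - ((fs n (z + h) - g (z + h)) - (fs n z - g z)) / h by field.
apply: le_lt_trans (cmodB _ _) _.
have b1 := hd h h0 hd1.
have b2 := Hn z (ltW zr).
have b3 : cmod ((fs n (z + h) - g (z + h) - (fs n z - g z)) / h) <= e / 4.
  by rewrite cmod_div ler_pdivrMr.
have b4 := cmodD ((fs n (z + h) - fs n z) / h - cderiv (fs n) z) (cderiv (fs n) z - G z).
have E : e / 16 = e / 4 / 4 by field.
rewrite E in b2; clear -b1 b2 b3 b4 e4; lra.
Qed.

Lemma limit_in_bloch : in_bloch g.
Proof.
apply: (@in_blochI _ _ (cmod (g 0)) M) => //.
  by move=> z hz; exists (G z); exact: limit_has_cderiv.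
move=> z l hz hl; rewrite (has_cderiv_unique hl (limit_has_cderiv hz)).
apply/ler_addgt0Pr => e e0; have [n /= hn] := filter_ex (UG hz e0).
have [[hf _] hM] := bfs n; have [_ H] := bloch_normP hf hM.
have := H z _ hz (holo_cderiv hf hz); have := disk_sqr hz.
set w := 1 - _ => w0 h1.
have w1 : w <= 1 by rewrite gerBl sqr_ge0.
have -> : G z = cderiv (fs n) z - (cderiv (fs n) z - G z) by ring.
apply: le_trans (ler_wpM2l (ltW w0) (cmodB _ _)) _; rewrite mulrDr lerD //.
apply: le_trans (ltW hn); rewrite ler_piMl ?cmod_ge0 //.
Qed.

End Limit.

Definition dil (r : R) f := fun z => f (r%:C%C * z).

Lemma cmod_dil (r : R) z : 0 <= r -> cmod (r%:C%C * z) = r * cmod z.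
Proof. by move=> r0; rewrite cmodM cmod_real ger0_norm. Qed.

Lemma disk_dil (r : R) z : 0 <= r <= 1 -> disk z -> disk (r%:C%C * z).
Proof.
move=> /andP[r0 r1] hz; rewrite /disk /= cmod_dil //.
by apply: le_lt_trans hz; rewrite ler_piMl ?cmod_ge0.
Qed.

Lemma dil_cderiv (r : R) f z l : has_cderiv f (r%:C%C * z) l ->
  has_cderiv (dil r f) z (l * r%:C%C).
Proof.
move=> h; apply: (has_cderiv_comp (f := fun z => r%:C%C * z)) => //.
by have := has_cderivZ r%:C%C (has_cderiv_id z); rewrite mulr1.
Qed.

Lemma holo_dil (r : R) f : 0 <= r <= 1 -> holo_disk f -> holo_disk (dil r f).
Proof.
by move=> hr hf z /(disk_dil hr) /hf[l /dil_cderiv h]; exists (l * r%:C%C).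
Qed.

Lemma dil_bloch (r M : R) f : 0 <= r <= 1 -> holo_disk f -> (bloch_norm f <= M%:E)%E ->
  in_bloch (dil r f) /\
  (forall z l, disk z -> has_cderiv (dil r f) z l -> (1 - cmod z ^+ 2) * cmod l <= M).
Proof.
move=> hr hf hM; have [h0 H] := bloch_normP hf hM; move/andP: (hr) => [r0 r1].
have S z l : disk z -> has_cderiv (dil r f) z l -> (1 - cmod z ^+ 2) * cmod l <= M.
  move=> hz hl; have hd := disk_dil hr hz.
  have D := dil_cderiv (holo_cderiv hf hd).
  rewrite (has_cderiv_unique hl D) cmodM cmod_real ger0_norm //.
  apply: le_trans (H _ _ hd (holo_cderiv hf hd)).
  rewrite mulrA cmod_dil // -[leRHS]mulr1; apply: ler_pM => //.
    by rewrite mulr_ge0 ?cmod_ge0 // disk_sqr_le.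
  rewrite ler_wpM2r ?cmod_ge0 // lerD2l lerN2 lerXn2r ?nnegrE ?mulr_ge0 ?cmod_ge0 //.
  by rewrite ler_piMl ?cmod_ge0.
split=> //; apply: (@in_blochI _ _ (cmod (dil r f 0)) M) => //.
exact: holo_dil.
Qed.

(** A dilated function sees only |w| <= r, where derivatives converge uniformly, so its Bloch norm
    converges. The explicit rate lets a bounded operator be applied afterwards. *)
Lemma dilation_compact (fs : nat -> R[i] -> R[i]) (M r : R) : 0 <= r < 1 ->
  (forall n, in_bloch (fs n) /\ (bloch_norm (fs n) <= M%:E)%E) ->
  exists (s : nat -> nat) (g : R[i] -> R[i]), [/\ forall n, (s n < s n.+1)%N, in_bloch g &
    forall k, (bloch_norm (fun z => dil r (fs (s k)) z - dil r g z)%R <= (k.+1%:R^-1)%:E)%E].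
Proof.
move=> hr bfs; have [U [g [G [UP UN Ug UG]]]] := bloch_ultra_limit bfs.
have bg := limit_in_bloch bfs UP Ug UG.
have hr1 : 0 <= r <= 1 by move/andP: hr => [-> /ltW ->].
have [|s [s1 s2]] := @increasing_subseq (fun k n =>
  bloch_norm (fun z => dil r (fs n) z - dil r g z)%R <= (k.+1%:R^-1)%:E)%E.
  move=> N k; pose e : R := k.+1%:R^-1 / 2.
  have e0 : 0 < e by rewrite divr_gt0 // invr_gt0 ltr0Sn.
  have U1 := UN N; have U2 := Ug 0 e disk0 e0.
  have U3 := limit_deriv_uniform bfs UP Ug UG hr e0.
  have [n [/= nN [n0 n1]]] := filter_ex (filterI U1 (filterI U2 U3)); exists n => //.
  rewrite [k.+1%:R^-1]splitr -/e; apply: bloch_norm_le.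
    by rewrite /dil mulr0 ltW.
  move=> z l hz hl; have hd := disk_dil hr1 hz.
  have [[hf _] _] := bfs n.
  have D := has_cderivB (dil_cderiv (holo_cderiv hf hd)) (dil_cderiv (limit_has_cderiv bfs UP Ug UG hd)).
  rewrite (has_cderiv_unique hl D) -mulrBl cmodM cmod_real.
  move/andP: hr => [r0 r1]; rewrite ger0_norm //.
  have zr : cmod (r%:C%C * z) <= r by rewrite cmod_dil // ler_piMr // ltW.
  have := n1 _ zr; set c := cmod _ => hc; have c0 : 0 <= c := cmod_ge0 _.
  rewrite -[leRHS]mul1r; apply: ler_pM => //.
  - exact: disk_sqr_le.
  - by rewrite mulr_ge0.
  - by rewrite gerBl sqr_ge0.
  - by apply: le_trans hc; rewrite ler_piMr // ltW.
by exists s, g.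
Qed.

End Montel.

(** * Compact operators and weakly null sequences *)

Section GlidingHump.
Context {R : realType}.
Implicit Types (f g : R[i] -> R[i]) (z w l : R[i]) (u : nat -> \bar R).

Lemma cvge0_le u (e : R) : u @ \oo --> 0%E -> 0 < e ->
  exists N, forall n, (N <= n)%N -> (u n <= e%:E)%E.
Proof.
move=> /fine_cvgP[[N1 _ h1] /cvgrPdist_lt h2] e0.
have [N2 _ {}h2] := h2 e e0; exists (maxn N1 N2) => n; rewrite geq_max => /andP[n1 n2].
have := h2 n n2; rewrite /= sub0r normrN => /(le_lt_trans (ler_norm _)) /ltW h3.
by rewrite -(fineK (h1 n n1)) lee_fin.
Qed.

Lemma le_cvge0 u : (forall n, (0 <= u n)%E) ->
  (forall e : R, 0 < e -> exists N, forall n, (N <= n)%N -> (u n <= e%:E)%E) ->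
  u @ \oo --> 0%E.
Proof.
move=> u0 H; apply/fine_cvgP; split.
  have [N hN] := H 1 ltr01; exists N => // n /hN h.
  by rewrite ge0_fin_numE //; apply: le_lt_trans h (ltry _).
apply/cvgrPdist_lt => e e0; have [N hN] := H (e / 2) (divr_gt0 e0 (ltr0Sn R 1)).
exists N => // n /hN h /=; rewrite sub0r normrN ger0_norm ?fine_ge0 //.
have : fine (u n) <= e / 2.
  have fn : u n \is a fin_num by rewrite ge0_fin_numE //; apply: le_lt_trans h (ltry _).
  by rewrite -lee_fin fineK.
lra.
Qed.

Definition little_bloch f := forall e : R, 0 < e -> exists2 rho : R, rho < 1 &
  forall z l, disk z -> rho < cmod z -> has_cderiv f z l -> (1 - cmod z ^+ 2) * cmod l <= e.

Definition loc_null (fs : nat -> R[i] -> R[i]) := forall rho e : R, rho < 1 -> 0 < e ->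
  exists N, forall n, (N <= n)%N -> cmod (fs n 0) <= e /\
    forall z l, cmod z <= rho -> has_cderiv (fs n) z l -> (1 - cmod z ^+ 2) * cmod l <= e.

Lemma little_blochD f g : holo_disk f -> holo_disk g -> little_bloch f -> little_bloch g ->
  little_bloch (fun z => f z + g z).
Proof.
move=> hf hg lf lg e e0; have e2 : 0 < e / 2 by rewrite divr_gt0.
have [r1 r11 h1] := lf _ e2; have [r2 r21 h2] := lg _ e2.
exists (Num.max r1 r2); first by rewrite gt_max r11.
move=> z l hz; rewrite gt_max => /andP[z1 z2] hl.
rewrite (has_cderiv_unique hl (has_cderivD (holo_cderiv hf hz) (holo_cderiv hg hz))).
apply: le_trans (ler_wpM2l (disk_sqr_le hz) (cmodD _ _)) _.
by rewrite mulrDr [e]splitr lerD //; [apply: h1 => //|apply: h2 => //]; exact: holo_cderiv.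
Qed.

(* Sums of a rapidly sparse selection stay bounded in norm because their
   derivatives peak on disjoint annuli; so if [K f_n] stayed near some [g] with
   [||g||] not small, then [K] of such a sum of [m] terms, near [m g], would be
   unbounded. *)
Lemma compact_gliding_hump K (fs : nat -> R[i] -> R[i]) (M : R) :
  compact_bloch K -> 0 <= M ->
  (forall n, in_bloch (fs n) /\ (bloch_norm (fs n) <= M%:E)%E) ->
  (forall n, little_bloch (fs n)) -> loc_null fs ->
  forall (e : R) N, 0 < e -> exists2 n, (N <= n)%N & (bloch_norm (K (fs n)) <= e%:E)%E.
Proof.
move=> cK M0 bfs lfs nfs e N e0; have [K1 K2 K3 K4] := cK.
have [s [g [s1 bg cvg]]] := K4 fs M bfs.
have ss n : (n <= s n)%N.
  by elim: n => // n IH; apply: leq_ltn_trans (s1 n); exact: IH.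
pose de := e / 3; have de0 : 0 < de by rewrite divr_gt0.
have [N1 hN1] := cvge0_le cvg de0.
(* The total allowance for interference between humps: the m-th step spends 2^-m, so seminorms never
   exceed M + 1 however many terms are added. *)
pose c (m : nat) : R := 1 - 2^-1 ^+ m.
have half_pos m : 0 < 2^-1 ^+ m :> R by rewrite exprn_gt0 // invr_gt0.
have half_S m : 2^-1 ^+ m = 2^-1 ^+ m.+1 + 2^-1 ^+ m.+1 :> R.
  by rewrite exprS; set t := _ ^+ m; field.
have half_le m : 2^-1 ^+ m <= 1 :> R by rewrite exprn_ile1 // ?invr_ge0 // invf_le1 // ler1n.
have sums m : exists F, [/\ in_bloch F, little_bloch F, cmod (F 0) <= c m,
    (forall z l, disk z -> has_cderiv F z l -> (1 - cmod z ^+ 2) * cmod l <= M + c m) &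
    (bloch_norm (fun z => K F z - m%:R%:C%C * g z)%R <= (m%:R * de)%:E)%E].
  elim: m => [|m [F [bF lF F0 dF KF]]].
    exists (fun=> 0); have b0 : in_bloch (fun=> 0 : R[i]) by exact: in_bloch_cst.
    have d0 z l : has_cderiv (fun=> 0) z l -> cmod l = 0.
      by move=> hl; rewrite (has_cderiv_unique hl (has_cderiv_cst 0 z)) cmod0.
    rewrite /c expr0 subrr addr0; split=> //.
    - by move=> t t0; exists 0 => // z l _ _ /d0 ->; rewrite mulr0 ltW.
    - by rewrite cmod0.
    - by move=> z l _ /d0 ->; rewrite mulr0.
    - have -> : bloch_norm (fun z => K (fun=> 0) z - 0%:R%:C%C * g z) = bloch_norm (fun=> 0).
        apply: bloch_norm_eq => z hz; rewrite mul0r subr0.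
        have E := compact_hom 0 cK b0 hz; rewrite [RHS]mul0r in E; rewrite -[RHS]E.
        apply: K1 => //; first exact: in_blochZ.
        by move=> w _; rewrite mul0r.
      have -> : 0%:R * de = 0 + 0 :> R by rewrite mul0r addr0.
      apply: bloch_norm_le; rewrite ?cmod0 //.
      by move=> z l _ /d0 ->; rewrite mulr0.
  (* The old sum is t-small beyond |z| = rho, being in the little Bloch space, and the new term is
     t-small up to rho, being far out in the sequence; at each point only one of the two is not
     small. *)
  pose t : R := 2^-1 ^+ m.+1.
  have t0 : 0 < t := half_pos _.
  have [rho r1 hrho] := lF t t0.
  have [N2 hN2] := nfs rho t r1 t0.
  pose n := s (maxn N1 N2).
  have nN2 : (N2 <= n)%N by apply: leq_trans (ss _); exact: leq_maxr.
  have [n0 n1] := hN2 n nN2.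
  have [bn nn] := bfs n; have [_ dn] := bloch_normP bn.1 nn.
  have tc : c m.+1 = c m + t by rewrite /c [X in _ = 1 - X + _]half_S -/t; ring.
  exists (fun z => F z + fs n z); split.
  - exact: in_blochD.
  - apply: little_blochD => //; [exact: bF.1|exact: bn.1].
  - by apply: le_trans (cmodD _ _) _; rewrite tc lerD.
  - move=> z l hz hl.
    rewrite (has_cderiv_unique hl (has_cderivD (holo_cderiv bF.1 hz) (holo_cderiv bn.1 hz))).
    apply: le_trans (ler_wpM2l (disk_sqr_le hz) (cmodD _ _)) _; rewrite mulrDr.
    have [zr|zr] := leP (cmod z) rho.
      rewrite tc addrA lerD //; first by apply: dF => //; exact: holo_cderiv bF.1 hz.
      by apply: n1 => //; exact: holo_cderiv bn.1 hz.
    rewrite addrC; apply: lerD; first by apply: dn => //; exact: holo_cderiv bn.1 hz.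
    apply: le_trans (hrho z _ hz zr (holo_cderiv bF.1 hz)) _.
    by rewrite /c -/t; have := half_le m; rewrite half_S -/t; lra.
  - have bd := hN1 (maxn N1 N2) (leq_maxl _ _).
    have -> : bloch_norm (fun z => K (fun z => F z + fs n z) z - m.+1%:R%:C%C * g z) =
        bloch_norm (fun z => (K F z - m%:R%:C%C * g z) + (K (fs n) z - g z)).
      apply: bloch_norm_eq => z hz; rewrite (compactD cK bF bn hz).
      by rewrite -natr1 rmorphD rmorph1; ring.
    apply: le_trans (bloch_normD _ _) _.
    + by apply: holoB; [exact: (K3 _ bF).1|apply: holoM; [exact: holo_cst|exact: bg.1]].
    + by apply: holoB; [exact: (K3 _ bn).1|exact: bg.1].
    by rewrite -natr1 mulrDl mul1r EFinD; apply: leeD.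
have [Fs hFs] := choice sums.
have bFs m : in_bloch (Fs m) /\ (bloch_norm (Fs m) <= (1 + (M + 1))%:E)%E.
  have [bF lF F0 dF KF] := hFs m; split=> //; apply: bloch_norm_le.
    by apply: le_trans F0 _; rewrite gerBl ltW.
  move=> z l hz hl; apply: le_trans (dF z l hz hl) _.
  by rewrite lerD2l gerBl ltW.
have [s' [g2 [s1' bg2 cvg2]]] := K4 Fs _ bFs.
have ss' n : (n <= s' n)%N.
  by elim: n => // n IH; apply: leq_ltn_trans (s1' n); exact: IH.
have [N3 hN3] := cvge0_le cvg2 ltr01.
have [C C0 hC] : exists2 C : R, 0 < C & (bloch_norm g2 <= C%:E)%E.
  by have [C C0 [->|h]] := in_bloch_fin bg2; exists C.
have [m [mbig hm]] : exists m, (1 + C) / de <= m%:R /\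
    (bloch_norm (fun z => K (Fs m) z - g2 z)%R <= 1%:E)%E.
  pose k := maxn N3 (Num.truncn ((1 + C) / de)).+1.
  exists (s' k); split; last by apply: hN3; exact: leq_maxl.
  apply: le_trans (ltW (truncnS_gt _)) _; rewrite ler_nat.
  by apply: leq_trans (ss' _); exact: leq_maxr.
have m0 : 0 < m%:R :> R by apply: lt_le_trans mbig; rewrite divr_gt0 // ltr_wpDl.
have mC : m%:R%:C%C != 0 :> R[i] by rewrite -cmod_gt0 cmod_real normr_gt0 gt_eqF.
have [bF _ _ _ KF] := hFs m.
(* Some K(F_m) with large m is within 1 of g2 and within m de of m g, so |m g| <= m de + 1 + C;
   dividing by m >= (1 + C) / de leaves 2 de. *)
have gsmall : (bloch_norm g <= (2 * de)%:E)%E.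
  have mg : (bloch_norm (fun z => m%:R%:C%C * g z)%R <= (m%:R * de + (1 + C))%:E)%E.
    have -> : bloch_norm (fun z => m%:R%:C%C * g z) = bloch_norm (fun z =>
       ((K (Fs m) z - g2 z) + g2 z) - (K (Fs m) z - m%:R%:C%C * g z)).
      by apply: bloch_norm_eq => z _; ring.
    have hKF : holo_disk (K (Fs m)) := (K3 _ bF).1.
    have h2 : holo_disk (fun z => K (Fs m) z - g2 z) by apply: holoB => //; exact: bg2.1.
    apply: le_trans (bloch_normB _ _) _.
    + by apply: holoD => //; exact: bg2.1.
    + by apply: holoB => //; apply: holoM; [exact: holo_cst|exact: bg.1].
    rewrite addrC EFinD; apply: leeD => //.
    apply: le_trans (bloch_normD h2 bg2.1) _.
    by rewrite EFinD; apply: leeD.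
  have -> : bloch_norm g = bloch_norm (fun z => (m%:R^-1)%:C%C * (m%:R%:C%C * g z)).
    by apply: bloch_norm_eq => z _; rewrite mulrA fmorphV mulVf // mul1r.
  apply: le_trans (bloch_normZ _ _ mg) _.
    by apply: holoM; [exact: holo_cst|exact: bg.1].
  rewrite lee_fin cmod_real gtr0_norm ?invr_gt0 // mulrC ler_pdivrMr //.
  rewrite ler_pdivrMr // in mbig; lra.
pose k := maxn N1 N; exists (s k); first by apply: leq_trans (ss _); exact: leq_maxr.
have bd := hN1 k (leq_maxl _ _).
have [bn _] := bfs (s k).
have -> : bloch_norm (K (fs (s k))) = bloch_norm (fun z => (K (fs (s k)) z - g z) + g z).
  by apply: bloch_norm_eq => z _; rewrite subrK.
apply: le_trans (bloch_normD _ bg.1) _.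
  by apply: holoB; [exact: (K3 _ bn).1|exact: bg.1].
have -> : e = de + 2 * de by rewrite /de; field.
by rewrite EFinD; apply: leeD.
Qed.

End GlidingHump.

(** * The logarithmic test functions *)

Section ComplexLog.
Context {R : realType}.
Implicit Types (x y : R) (z w l : R[i]).

Lemma MVT_dist (f df : R -> R) (a b : R) :
  (forall x, `|x - a| <= `|b - a| -> is_derive (x : R) (1 : R) f (df x)) ->
  exists2 c, `|c - a| <= `|b - a| & f b - f a = df c * (b - a).
Proof.
move=> H; have [ab|ba] := leP a b.
  have inH x : a <= x <= b -> `|x - a| <= `|b - a|.
    by move=> /andP[h1 h2]; rewrite !ger0_norm ?subr_ge0 // lerD2r.
  have [||c] := @MVT_segment R f df a b ab.
  - by move=> x; rewrite in_itv /= => /andP[h1 h2]; apply: H; apply: inH; rewrite !ltW.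
  - apply: derivable_within_continuous => x; rewrite in_itv /= => /inH /H h.
    by have [] := h.
  by rewrite in_itv /= => /inH hc E; exists c.
have inH x : b <= x <= a -> `|x - a| <= `|b - a|.
  by move=> /andP[h1 h2]; rewrite !ler0_norm ?subr_le0 ?(ltW ba) // lerN2 lerD2r.
have [||c] := @MVT_segment R f df b a (ltW ba).
- by move=> x; rewrite in_itv /= => /andP[h1 h2]; apply: H; apply: inH; rewrite !ltW.
- apply: derivable_within_continuous => x; rewrite in_itv /= => /inH /H h.
  by have [] := h.
rewrite in_itv /= => /inH hc E; exists c => //.
by rewrite -opprB E -mulrN opprB.
Qed.

(** The Cauchy--Riemann equations are built into the pattern p_x = q_y = a, q_x = -p_y = b. The
    increment is taken along a vertical and then a horizontal segment; each of the four applications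
    of the mean value theorem errs by at most (e/8) |h|. *)
Lemma cauchy_riemann (p q : R -> R -> R) (a b : R -> R -> R) (x0 y0 r : R) : 0 < r ->
  (forall x y, `|x - x0| < r -> `|y - y0| < r ->
    [/\ is_derive (x : R) (1 : R) (fun s => p s y) (a x y),
        is_derive (y : R) (1 : R) (fun s => p x s) (- b x y),
        is_derive (x : R) (1 : R) (fun s => q s y) (b x y) &
        is_derive (y : R) (1 : R) (fun s => q x s) (a x y)]) ->
  ccont (fun z => Complex (a (complex.Re z) (complex.Im z)) (b (complex.Re z) (complex.Im z)))
    (Complex x0 y0) ->
  has_cderiv (fun z => Complex (p (complex.Re z) (complex.Im z)) (q (complex.Re z) (complex.Im z)))
    (Complex x0 y0) (Complex (a x0 y0) (b x0 y0)).
Proof.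
move=> r0 Hd cD e e0; have e4 : 0 < e / 8 by rewrite divr_gt0.
have [d d0 hd] := cD _ e4.
exists (Num.min r (d / 2)); first by rewrite lt_min r0 divr_gt0.
move=> [h k] hk0; rewrite lt_min => /andP[hkr hkd].
set m := cmod (Complex h k) in hkr hkd.
have m0 : 0 < m by rewrite cmod_gt0.
have hm : `|h| <= m := abs_Re_le (Complex h k).
have km : `|k| <= m := abs_Im_le (Complex h k).
have near x y : `|x - x0| <= `|h| -> `|y - y0| <= `|k| ->
    [/\ `|x - x0| < r, `|y - y0| < r, `|a x y - a x0 y0| <= e / 8 & `|b x y - b x0 y0| <= e / 8].
  move=> hx hy; have hxm := le_trans hx hm; have hym := le_trans hy km.
  have := hd (Complex x y) _; rewrite /= => H.
  have {}H : cmod (Complex (a x y) (b x y) - Complex (a x0 y0) (b x0 y0)) < e / 8.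
    apply: H; apply: le_lt_trans (cmod_le_ReIm _) _ => /=.
    by apply: le_lt_trans (lerD hxm hym) _; rewrite -mulr2n -mulr_natr -ltr_pdivlMr.
  split; [exact: le_lt_trans hkr|exact: le_lt_trans hkr| |].
    by apply: le_trans (ltW H); exact: (abs_Re_le (Complex (a x y) (b x y) - Complex (a x0 y0) (b x0 y0))).
  by apply: le_trans (ltW H); exact: (abs_Im_le (Complex (a x y) (b x y) - Complex (a x0 y0) (b x0 y0))).
have k00 : `|y0 + k - y0| <= `|k| by rewrite addrAC subrr add0r.
have h00 : `|x0 - x0| <= `|h| by rewrite subrr normr0.
have y00 : `|y0 - y0| <= `|k| by rewrite subrr normr0.
have hE : `|x0 + h - x0| = `|h| by rewrite addrAC subrr add0r.
have kE : `|y0 + k - y0| = `|k| by rewrite addrAC subrr add0r.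
have [c1 hc1 E1] := @MVT_dist (fun s => p s (y0 + k)) (fun s => a s (y0 + k)) x0 (x0 + h)
  ltac:(by move=> x; rewrite hE => hx; have [n1 n2 _ _] := near x _ hx k00; have [] := Hd _ _ n1 n2).
have [c2 hc2 E2] := @MVT_dist (fun s => p x0 s) (fun s => - b x0 s) y0 (y0 + k)
  ltac:(by move=> y; rewrite kE => hy; have [n1 n2 _ _] := near x0 y h00 hy; have [] := Hd _ _ n1 n2).
have [c3 hc3 E3] := @MVT_dist (fun s => q s (y0 + k)) (fun s => b s (y0 + k)) x0 (x0 + h)
  ltac:(by move=> x; rewrite hE => hx; have [n1 n2 _ _] := near x _ hx k00; have [] := Hd _ _ n1 n2).
have [c4 hc4 E4] := @MVT_dist (fun s => q x0 s) (fun s => a x0 s) y0 (y0 + k)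
  ltac:(by move=> y; rewrite kE => hy; have [n1 n2 _ _] := near x0 y h00 hy; have [] := Hd _ _ n1 n2).
rewrite hE in hc1 hc3; rewrite kE in hc2 hc4.
rewrite [x0 + h - x0]addrAC subrr add0r in E1 E3.
rewrite [y0 + k - y0]addrAC subrr add0r in E2 E4.
have [_ _ A1 _] := near _ _ hc1 k00.
have [_ _ _ A2] := near _ _ h00 hc2.
have [_ _ _ A3] := near _ _ hc3 k00.
have [_ _ A4 _] := near _ _ h00 hc4.
pose F (z : R[i]) : R[i] := Complex (p (complex.Re z) (complex.Im z)) (q (complex.Re z) (complex.Im z)).
pose D : R[i] := Complex (a x0 y0) (b x0 y0).
suff : cmod ((F (Complex x0 y0 + Complex h k) - F (Complex x0 y0)) / Complex h k - D) < e by [].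
have mulb (s t : R) (u : R) : `|s| <= e / 8 -> `|t| <= u -> `|s * t| <= e / 8 * u.
  by move=> h1 h2; rewrite normrM ler_pM.
have key : cmod (F (Complex x0 y0 + Complex h k) - F (Complex x0 y0) - D * Complex h k) <= e / 2 * m.
  apply: le_trans (cmod_le_ReIm _) _.
  have -> : complex.Re (F (Complex x0 y0 + Complex h k) - F (Complex x0 y0) - D * Complex h k)
     = (a c1 (y0 + k) - a x0 y0) * h - (b x0 c2 - b x0 y0) * k.
    rewrite !cReB cReM /F /D /=.
    have -> : p (x0 + h) (y0 + k) - p x0 y0 = a c1 (y0 + k) * h + - b x0 c2 * k by rewrite -E1 -E2; ring.
    ring.
  have -> : complex.Im (F (Complex x0 y0 + Complex h k) - F (Complex x0 y0) - D * Complex h k)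
     = (b c3 (y0 + k) - b x0 y0) * h + (a x0 c4 - a x0 y0) * k.
    rewrite !cImB cImM /F /D /=.
    have -> : q (x0 + h) (y0 + k) - q x0 y0 = b c3 (y0 + k) * h + a x0 c4 * k by rewrite -E3 -E4; ring.
    ring.
  have b1 := mulb _ _ _ A1 hm; have b2 := mulb _ _ _ A2 km.
  have b3 := mulb _ _ _ A3 hm; have b4 := mulb _ _ _ A4 km.
  apply: le_trans (lerD (ler_normB _ _) (ler_normD _ _)) _.
  have -> : e / 2 * m = e / 8 * m + e / 8 * m + (e / 8 * m + e / 8 * m) by field.
  by rewrite !lerD.
have -> : (F (Complex x0 y0 + Complex h k) - F (Complex x0 y0)) / Complex h k - D =
  (F (Complex x0 y0 + Complex h k) - F (Complex x0 y0) - D * Complex h k) / Complex h k by field.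
rewrite cmod_div ltr_pdivrMr //; apply: le_lt_trans key _; rewrite ltr_pM2r //; lra.
Qed.

(** In the right half-plane [clog] is ln(x^2 + y^2) / 2 + i atan(y/x), whose partial derivatives are
    the coordinates of 1/z. The arguments 2 / (1 - conj(w) z) of the test functions all lie
    there. *)
Lemma clog_cderiv z : 0 < complex.Re z -> has_cderiv clog z z^-1.
Proof.
case: z => x0 y0 /= x00.
pose p x y : R := 2^-1 * ln (x ^+ 2 + y ^+ 2).
pose q x y : R := atan (y / x).
pose a x y : R := x / (x ^+ 2 + y ^+ 2).
pose b x y : R := - y / (x ^+ 2 + y ^+ 2).
have xpos x : `|x - x0| < x0 -> 0 < x by rewrite ltr_norml; lra.
have invE x y : (Complex x y)^-1 = Complex (a x y) (b x y).
  by apply: ReIm_eq; rewrite /= /a /b ?mulNr.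
have CR := @cauchy_riemann p q a b x0 y0 x0 x00.
rewrite -invE in CR.
apply: (@has_cderiv_near R (fun z => Complex (p (complex.Re z) (complex.Im z))
   (q (complex.Re z) (complex.Im z))) clog _ _ x0 x00).
  move=> w hw; have hx : 0 < complex.Re w.
    by apply: xpos; apply: le_lt_trans hw; rewrite -[x0 in `|_ - x0|]/(complex.Re (Complex x0 y0)) -cReB abs_Re_le.
  rewrite /clog /carg hx /p /q /cmod; congr Complex.
  have s0 : 0 < complex.Re w ^+ 2 + complex.Im w ^+ 2.
    by rewrite ltr_wpDr ?sqr_ge0 // exprn_gt0.
  have E : ln (complex.Re w ^+ 2 + complex.Im w ^+ 2) =
      2 * ln (Num.sqrt (complex.Re w ^+ 2 + complex.Im w ^+ 2)).
    have t0 : 0 < Num.sqrt (complex.Re w ^+ 2 + complex.Im w ^+ 2) by rewrite sqrtr_gt0.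
    by rewrite -{1}(sqr_sqrtr (ltW s0)) expr2 lnM ?posrE // mulr2n mulrDl !mul1r.
  by rewrite E mulrA mulVf ?mul1r.
apply: CR; last first.
  have z0 : Complex x0 y0 != 0 by rewrite eq_complex /= negb_and gt_eqF.
  by apply: (ccont_near x00 _ (ccontV z0)) => -[x y] _; rewrite invE.
move=> x y hx hy; have x1 := xpos x hx.
have xn : x != 0 by rewrite gt_eqF.
have s0 : 0 < x ^+ 2 + y ^+ 2 by rewrite ltr_wpDr ?sqr_ge0 // exprn_gt0.
have sn : x ^+ 2 + y ^+ 2 != 0 by rewrite gt_eqF.
have dsq (t : R) : is_derive (t : R) (1 : R) (fun s : R => s ^+ 2) (2 * t).
  apply: is_derive_dist => e e0; exists e => // h h0 he.
  have -> : ((t + h) ^+ 2 - t ^+ 2) / h - 2 * t = h by field.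
  by [].
have dadd (f : R -> R) (c t l : R) : is_derive (t : R) (1 : R) f l ->
    is_derive (t : R) (1 : R) (fun s => f s + c) l.
  move=> df; have : is_derive (t : R) (1 : R) (f + cst c) (l + 0) by apply: is_deriveD.
  by rewrite addr0.
split.
- have h1 := @is_derive_ln_comp R (fun s => s ^+ 2 + y ^+ 2) x (2 * x) s0 (dadd _ _ _ _ (dsq x)).
  apply: is_derive_eq (is_derive_scale 2^-1 h1) _.
  by rewrite /a; field.
- have s0' : 0 < y ^+ 2 + x ^+ 2 by rewrite addrC.
  have h1 := @is_derive_ln_comp R (fun s => s ^+ 2 + x ^+ 2) y (2 * y) s0' (dadd _ _ _ _ (dsq y)).
  have -> : (fun s => p x s) = (fun s => 2^-1 * ln (s ^+ 2 + x ^+ 2)).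
    by apply/funext => s; rewrite /p addrC.
  apply: is_derive_eq (is_derive_scale 2^-1 h1) _.
  by rewrite /b [y ^+ 2 + _]addrC; field.
- have dv : is_derive (x : R) (1 : R) (fun s : R => y * s^-1) (y * (- x ^- 2)).
    apply: is_derive_scale.
    have := @is_deriveV R id x 1 1 xn (is_derive_id x 1).
    by rewrite [_ *: _]mulr1.
  have h : is_derive (x : R) (1 : R) (@atan R \o (fun s : R => y * s^-1))
      ((1 + (y * x^-1) ^+ 2)^-1 * (y * (- x ^- 2))).
    by apply: is_derive1_comp.
  apply: is_derive_eq h _.
  by rewrite /b; field; rewrite sn xn.
- have dv : is_derive (y : R) (1 : R) (fun s : R => s / x) (x^-1).
    apply: is_derive_dist => e e0; exists 1 => // h h0 _.
    have -> : ((y + h) / x - y / x) / h - x^-1 = 0 by field; rewrite xn h0.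
    by rewrite normr0.
  have h : is_derive (y : R) (1 : R) (@atan R \o (fun s : R => s / x))
      ((1 + (y / x) ^+ 2)^-1 * x^-1).
    by apply: is_derive1_comp.
  apply: is_derive_eq h _.
  by rewrite /a; field; rewrite sn xn.
Qed.

End ComplexLog.

(** * Logarithmic test functions and monomials *)

Section TestFunctions.
Context {R : realType}.
Implicit Types (z w l : R[i]).

(* [g_test phi a] depends on [phi] and [a] only through [w = phi a]. *)
Definition gfun w : R[i] -> R[i] :=
  fun z => clog (2%:R / (1 - cconj w * z)) ^+ 2 * ((Lw w)^-1)%:C%C.

Lemma Re_inv_pos z : 0 < complex.Re z -> 0 < complex.Re (2%:R / z).
Proof.
move: z => [x y] x0; rewrite /= in x0.
have s0 : 0 < x ^+ 2 + y ^+ 2 by rewrite ltr_wpDr ?sqr_ge0 // exprn_gt0.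
have -> : complex.Re (2%:R / Complex x y) = 2 * (x / (x ^+ 2 + y ^+ 2)).
  rewrite cReM /=; ring.
by rewrite mulr_gt0 // divr_gt0.
Qed.

Lemma Re_one_sub_conj w z : disk w -> disk z -> 0 < complex.Re (1 - cconj w * z).
Proof.
move=> hw hz; rewrite cReB subr_gt0; apply: le_lt_trans (ler_norm _) _.
apply: le_lt_trans (abs_Re_le _) _; rewrite cmodM cmod_conj /=.
by rewrite -[ltRHS]mul1r ltr_pM ?cmod_ge0.
Qed.

Lemma gfun_cderiv w z : disk w -> disk z -> has_cderiv (gfun w) z
  (2%:R * clog (2%:R / (1 - cconj w * z)) * (cconj w / (1 - cconj w * z)) * ((Lw w)^-1)%:C%C).
Proof.
move=> hw hz; have n := one_sub_conj_neq0 hw hz.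
have d1 : has_cderiv (fun z => 1 - cconj w * z) z (0 - cconj w * 1).
  apply: has_cderivB; first exact: has_cderiv_cst.
  by apply: has_cderivZ; exact: has_cderiv_id.
have d2 := @has_cderiv_div R (fun=> 2%:R) (fun z => 1 - cconj w * z) z _ _ n
  (has_cderiv_cst 2%:R z) d1.
have d3 := has_cderiv_comp d2 (clog_cderiv (Re_inv_pos (Re_one_sub_conj hw hz))).
have d4 := has_cderivM (has_cderivX 2 d3) (has_cderiv_cst ((Lw w)^-1)%:C%C z).
apply: (has_cderiv_eq _ (has_cderiv_ext _ d4)) => // {d1 d2 d3 d4}.
move: (((Lw w)^-1)%:C%C) => c; set L := clog _; set b := cconj w in n *.
rewrite mulr0 addr0 expr1.
have t0 : (2%:R : R[i]) != 0 by rewrite pnatr_eq0.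
by field.
Qed.

Lemma cmod_clog_le z : 0 < complex.Re z -> 1 <= cmod z -> cmod (clog z) <= ln (cmod z) + 2.
Proof.
move=> z0 z1; apply: le_trans (cmod_le_ReIm _) _; rewrite /clog /= /carg z0.
rewrite ger0_norm ?ln_ge0 // lerD2l.
have := atan_gtNpi2 (complex.Im z / complex.Re z).
have := atan_ltpi2 (complex.Im z / complex.Re z).
by have := @pihalf_02 R; rewrite ler_norml; lra.
Qed.

Lemma cmod_gfun_log w z (d : R) : disk w -> disk z -> 0 < d -> d <= cmod (1 - cconj w * z) ->
  cmod (clog (2%:R / (1 - cconj w * z))) <= ln (2 / d) + 2.
Proof.
move=> hw hz d0 dv.
have c2 : cmod (2%:R : R[i]) = 2 by rewrite -(rmorph_nat (real_complex R)) cmod_real ger0_norm.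
have v0 := lt_le_trans d0 dv.
have v2 := one_sub_conj_le hw hz.
have le1 : 1 <= cmod (2%:R / (1 - cconj w * z)) by rewrite cmod_div c2 ler_pdivlMr // mul1r.
apply: le_trans (cmod_clog_le (Re_inv_pos (Re_one_sub_conj hw hz)) le1) _.
rewrite lerD2r cmod_div c2 ler_ln ?posrE ?divr_gt0 // ler_wpM2l // lef_pV2 ?posrE //.
Qed.

(** The lower bound [d] is free: 1 - |w| serves for the norm and for membership in the little Bloch
    space, while 1 - r with |z| <= r gives a bound uniform in w, as needed for local nullity. *)
Lemma gfun_deriv_bound w z l (d : R) : disk w -> disk z -> has_cderiv (gfun w) z l ->
  0 < d -> d <= cmod (1 - cconj w * z) ->
  (1 - cmod z ^+ 2) * cmod l <=
    2 * (ln (2 / d) + 2) * ((1 - cmod z ^+ 2) / cmod (1 - cconj w * z)) / Lw w.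
Proof.
move=> hw hz hl d0 dv; rewrite (has_cderiv_unique hl (gfun_cderiv hw hz)).
have L0 := Lw_gt0 hw; have v0 := lt_le_trans d0 dv.
have c2 : cmod (2%:R : R[i]) = 2 by rewrite -(rmorph_nat (real_complex R)) cmod_real ger0_norm.
rewrite !cmodM cmodV cmod_conj c2 cmod_real ger0_norm ?invr_ge0 ?(ltW L0) //.
have W := disk_sqr_le hz; have K := cmod_gfun_log hw hz d0 dv.
set X := cmod (clog _) in K *; set v := cmod _ in v0 *; set W0 := 1 - _ in W *.
have -> : W0 * (2 * X * (cmod w / v) * (Lw w)^-1) = (2 * X * (W0 / v)) * cmod w / Lw w by ring.
rewrite ler_wpM2r ?invr_ge0 ?(ltW L0) //.
have P : 0 <= W0 / v by rewrite divr_ge0 // ltW.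
have X0 : 0 <= X := cmod_ge0 _.
apply: (le_trans (y := 2 * X * (W0 / v))).
  rewrite ler_piMr //; last exact: ltW.
  by apply: mulr_ge0 => //; apply: mulr_ge0.
by rewrite ler_wpM2r // ler_wpM2l.
Qed.

Lemma one_sub_sqr_le2 z v : disk z -> 1 - cmod z <= v -> (1 - cmod z ^+ 2) / v <= 2.
Proof.
move=> hz hv; have z1 : 0 < 1 - cmod z by rewrite subr_gt0.
rewrite ler_pdivrMr ?(lt_le_trans z1) //.
have -> : 1 - cmod z ^+ 2 = (1 + cmod z) * (1 - cmod z) by ring.
apply: ler_pM => //; rewrite ?(ltW z1) //; first by rewrite addr_ge0 ?cmod_ge0.
have : cmod z < 1 by []; lra.
Qed.

Lemma one_sub_conj_ge' w z : disk w -> 1 - cmod z <= cmod (1 - cconj w * z).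
Proof.
move=> hw; apply: le_trans (cmod_lerB _ _); rewrite cmod1 lerD2l lerN2.
by rewrite cmodM cmod_conj ler_piMl ?cmod_ge0 // ltW.
Qed.

Lemma ln2_le1 : ln (2 : R) <= 1.
Proof. by have := @le_ln1Dx R 1 ltac:(lra). Qed.

(** The logarithm is at most 1 + Lw + 2 and the quotient at most 2, so 4 (Lw + 3) / Lw appears; this
    is at most 28 as Lw >= 1/2. *)
Lemma gfun_semi w z l : disk w -> disk z -> has_cderiv (gfun w) z l ->
  (1 - cmod z ^+ 2) * cmod l <= 28.
Proof.
move=> hw hz hl; have w1 : 0 < 1 - cmod w by rewrite subr_gt0.
apply: le_trans (gfun_deriv_bound hw hz hl w1 (one_sub_conj_ge _ (ltW hz))) _.
have Lh := Lw_ge hw; have L0 := Lw_gt0 hw.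
have K : ln (2 / (1 - cmod w)) <= 1 + Lw w.
  have P1 : 0 < 2 / (1 - cmod w) by rewrite divr_gt0.
  have P2 : 0 < 2 / (1 - cmod w ^+ 2) by rewrite divr_gt0 // disk_sqr.
  have P3 : 0 < 2 * (2 / (1 - cmod w ^+ 2)) by rewrite mulr_gt0.
  apply: le_trans (lerD ln2_le1 (lexx _)); rewrite /Lw -lnM ?posrE //.
  rewrite ler_ln ?posrE //.
  rewrite mulrCA ler_wpM2l //.
  have -> : 1 - cmod w ^+ 2 = (1 + cmod w) * (1 - cmod w) by ring.
  rewrite invfM mulrA ler_peMl ?invr_ge0 ?(ltW w1) //.
  have : cmod w < 1 by []; have := cmod_ge0 w => w0 w1'.
  by rewrite ler_pdivlMr ?mul1r; lra.
have Q := one_sub_sqr_le2 hz (one_sub_conj_ge' z hw).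
have Q0 : 0 <= (1 - cmod z ^+ 2) / cmod (1 - cconj w * z).
  by rewrite divr_ge0 ?cmod_ge0 // disk_sqr_le.
rewrite ler_pdivrMr //.
have l0 : 0 <= ln (2 / (1 - cmod w)) + 2.
  by rewrite addr_ge0 // ln_ge0 // ler_pdivlMr // mul1r; have := cmod_ge0 w; lra.
apply: (le_trans (y := 2 * (ln (2 / (1 - cmod w)) + 2) * 2)).
  by rewrite ler_wpM2l // mulr_ge0.
lra.
Qed.

Lemma gfun0_le w : disk w -> cmod (gfun w 0) <= 9 / Lw w.
Proof.
move=> hw; have L0 := Lw_gt0 hw; rewrite /gfun mulr0 subr0 divr1 cmodM cmodX cmod_real.
rewrite ger0_norm ?invr_ge0 ?(ltW L0) // ler_wpM2r ?invr_ge0 ?(ltW L0) //.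
have c2 : cmod (2%:R : R[i]) = 2 by rewrite -(rmorph_nat (real_complex R)) cmod_real ger0_norm.
have h : cmod (clog (2%:R : R[i])) <= 3.
  have r2 : 0 < complex.Re (2%:R : R[i]).
    by rewrite -(rmorph_nat (real_complex R)) /= ltr0Sn.
  have := cmod_clog_le r2; rewrite c2 => H; apply: le_trans (H _) _; first by rewrite ler1n.
  by have := ln2_le1; lra.
have -> : 9 = 3 ^+ 2 :> R by ring.
by rewrite lerXn2r ?nnegrE ?cmod_ge0.
Qed.

Lemma holo_gfun w : disk w -> holo_disk (gfun w).
Proof. by move=> hw z hz; eexists; exact: gfun_cderiv. Qed.

Lemma gfun_norm w : disk w -> in_bloch (gfun w) /\ (bloch_norm (gfun w) <= 46%:E)%E.
Proof.
move=> hw; have L0 := Lw_gt0 hw; have Lh := Lw_ge hw.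
have h0 : cmod (gfun w 0) <= 18.
  apply: le_trans (gfun0_le hw) _; rewrite ler_pdivrMr //; lra.
have hs z l : disk z -> has_cderiv (gfun w) z l -> (1 - cmod z ^+ 2) * cmod l <= 28.
  exact: gfun_semi.
split; first exact: in_blochI (holo_gfun hw) h0 hs.
have -> : 46 = 18 + 28 :> R by rewrite -natrD.
exact: bloch_norm_le.
Qed.

Lemma gfun_little w : disk w -> little_bloch (gfun w).
Proof.
move=> hw e e0; have w1 : 0 < 1 - cmod w by rewrite subr_gt0.
have L0 := Lw_gt0 hw.
pose C : R := 2 * (ln (2 / (1 - cmod w)) + 2) / (1 - cmod w) / Lw w.
have l0 : 0 < ln (2 / (1 - cmod w)) + 2.
  by rewrite ltr_wpDl // ln_ge0 // ler_pdivlMr // mul1r; have := cmod_ge0 w; lra.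
have C0 : 0 < C by rewrite !divr_gt0 // mulr_gt0.
exists (1 - e / (2 * C)); first by rewrite ltrBlDr ltrDl divr_gt0 // mulr_gt0.
move=> z l hz hr hl.
have vw := one_sub_conj_ge w (ltW hz); have v0 := lt_le_trans w1 vw.
apply: le_trans (gfun_deriv_bound hw hz hl w1 vw) _.
have W := disk_sqr_le hz.
have W2 : 1 - cmod z ^+ 2 <= 2 * (1 - cmod z).
  have -> : 1 - cmod z ^+ 2 = (1 + cmod z) * (1 - cmod z) by ring.
  by rewrite ler_wpM2r ?subr_ge0 ?(ltW hz) //; have : cmod z < 1 by []; lra.
apply: (le_trans (y := C * (1 - cmod z ^+ 2))).
  have -> : C * (1 - cmod z ^+ 2) =
    2 * (ln (2 / (1 - cmod w)) + 2) * ((1 - cmod z ^+ 2) / (1 - cmod w)) / Lw w.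
    by rewrite /C; ring.
  rewrite ler_wpM2r ?invr_ge0 ?(ltW L0) // ler_wpM2l ?mulr_ge0 ?(ltW l0) //.
  by rewrite ler_wpM2l // lef_pV2 ?posrE.
have : 1 - cmod z < e / (2 * C) by lra.
have C20 : 0 < 2 * C by rewrite mulr_gt0.
rewrite ltr_pdivlMr // => h.
have := ler_wpM2l (ltW C0) W2; lra.
Qed.

Lemma Lw_large (X : R) : exists2 s : R, s < 1 & forall w, disk w -> s < cmod w -> X <= Lw w.
Proof.
exists (1 - expR (- X)); first by rewrite ltrBlDr ltrDl expR_gt0.
move=> w hw hs; rewrite LwE //.
have w1 : 0 < 1 - cmod w by rewrite subr_gt0.
have : ln (1 - cmod w ^+ 2) <= ln (2 * (1 - cmod w)).
  rewrite ler_ln ?posrE ?disk_sqr ?mulr_gt0 //.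
  have -> : 1 - cmod w ^+ 2 = (1 + cmod w) * (1 - cmod w) by ring.
  by rewrite ler_wpM2r ?(ltW w1) //; have : cmod w < 1 by []; lra.
rewrite lnM ?posrE //.
have : ln (1 - cmod w) <= - X.
  by rewrite -(expRK (- X)) ler_ln ?posrE ?expR_gt0 //; lra.
lra.
Qed.

Lemma gfun_loc_null (ws : nat -> R[i]) : (forall n, disk (ws n)) ->
  (forall s : R, s < 1 -> exists N, forall n, (N <= n)%N -> s < cmod (ws n)) ->
  loc_null (fun n => gfun (ws n)).
Proof.
move=> hws lim rho e r1 e0.
pose r := Num.max rho 0.
have r0 : 0 <= r by rewrite le_max lexx orbT.
have r1' : 0 < 1 - r by rewrite subr_gt0 gt_max r1 ltr01.
have l0 : 0 <= ln (2 / (1 - r)) + 2.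
  by rewrite addr_ge0 // ln_ge0 // ler_pdivlMr // mul1r; lra.
pose C : R := 9 + 4 * (ln (2 / (1 - r)) + 2).
have C0 : 0 < C by rewrite ltr_pwDl // mulr_ge0.
have [s s1 hs] := Lw_large (C / e).
have [N hN] := lim s s1; exists N => n /hN hn.
have L1 := hs _ (hws n) hn.
have L0 := Lw_gt0 (hws n).
have CL : C / Lw (ws n) <= e by rewrite ler_pdivrMr // mulrC -ler_pdivrMr.
split.
  apply: le_trans (gfun0_le (hws n)) _; apply: le_trans CL.
  by rewrite ler_wpM2r ?invr_ge0 ?(ltW L0) // /C lerDl mulr_ge0.
move=> z l hz hl.
have zr : cmod z <= r by rewrite le_max hz.
have hd : disk z by apply: le_lt_trans hz r1.
have vr : 1 - r <= cmod (1 - cconj (ws n) * z).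
  by apply: le_trans (one_sub_conj_ge' z (hws n)); rewrite lerD2l lerN2.
apply: le_trans (gfun_deriv_bound (hws n) hd hl r1' vr) _; apply: le_trans CL.
rewrite ler_wpM2r ?invr_ge0 ?(ltW L0) //.
have Q := one_sub_sqr_le2 hd (one_sub_conj_ge' z (hws n)).
apply: (le_trans (y := 2 * (ln (2 / (1 - r)) + 2) * 2)).
  by rewrite ler_wpM2l // mulr_ge0.
by rewrite /C; lra.
Qed.

(** This explains the normalization of the test function: at z = w it takes exactly the value of the
    log weight in [u_part], while in its derivative at w the logarithm cancels and a multiple of 1 /
    (1 - |w|^2) remains. *)
Lemma gfun_self w : disk w -> gfun w w = (Lw w)%:C%C.
Proof.
move=> hw; have L0 := Lw_gt0 hw; have s0 := disk_sqr hw.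
have E : 2%:R / (1 - cconj w * w) = (2 / (1 - cmod w ^+ 2))%:C%C.
  by rewrite [cconj w * w]mulrC -real_one_sub_sqr rmorphM fmorphV rmorph_nat.
have p0 : 0 < 2 / (1 - cmod w ^+ 2) by rewrite divr_gt0.
rewrite /gfun E.
have -> : clog (2 / (1 - cmod w ^+ 2))%:C%C = (Lw w)%:C%C.
  rewrite /clog cmod_real gtr0_norm // /carg /= p0 mul0r atan0 //.
by rewrite -rmorphXn -rmorphM /= expr2 mulfK // gt_eqF.
Qed.

Lemma gfun_deriv_self w : disk w ->
  has_cderiv (gfun w) w (2%:R * cconj w / ((1 - cmod w ^+ 2)%:C%C)).
Proof.
move=> hw; apply: has_cderiv_eq (gfun_cderiv hw hw).
have L0 := Lw_gt0 hw; have s0 := disk_sqr hw.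
have E : 2%:R / (1 - cconj w * w) = (2 / (1 - cmod w ^+ 2))%:C%C.
  by rewrite [cconj w * w]mulrC -real_one_sub_sqr rmorphM fmorphV rmorph_nat.
have p0 : 0 < 2 / (1 - cmod w ^+ 2) by rewrite divr_gt0.
rewrite E.
have -> : clog (2 / (1 - cmod w ^+ 2))%:C%C = (Lw w)%:C%C.
  by rewrite /clog cmod_real gtr0_norm // /carg /= p0 mul0r atan0.
rewrite [cconj w * w]mulrC -real_one_sub_sqr fmorphV /=.
have Ln : (Lw w)%:C%C != 0 :> R[i] by rewrite -cmod_gt0 cmod_real normr_gt0 gt_eqF.
have sn : (1 - cmod w ^+ 2)%:C%C != 0 :> R[i] by rewrite -cmod_gt0 cmod_real normr_gt0 gt_eqF.
set L := (Lw w)%:C%C in Ln *; set s := (1 - cmod w ^+ 2)%:C%C in sn *.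
by clearbody L s; field; rewrite Ln sn.
Qed.

(** 1 - x^n is (1 - x) times a sum of n powers of x, each at least x^(n-1); the remaining factor 1 +
    x is at most 2. *)
Lemma npow_peak (n : nat) (x : R) : 0 <= x <= 1 -> n%:R * x ^+ n.-1 * (1 - x ^+ 2) <= 2.
Proof.
move=> /andP[x0 x1].
have key : n%:R * x ^+ n.-1 * (1 - x) <= 1 - x ^+ n.
  elim: n => [|n IH]; first by rewrite !mul0r expr0 subrr.
  have xn : 0 <= x ^+ n by rewrite exprn_ge0.
  rewrite /= -natr1.
  case: n IH xn => [|n] IH xn; first by rewrite add0r expr0 expr1 mulr1 mul1r.
  rewrite /= in IH; move: IH; rewrite [x ^+ n.+2]exprS [x ^+ n.+1]exprS in xn *.
  have t0 : 0 <= x ^+ n by rewrite exprn_ge0.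
  set t := x ^+ n in t0 xn *; set k := n.+1%:R.
  move=> IH; have h : x * (k * t * (1 - x)) <= x * (1 - x * t) by rewrite ler_wpM2l.
  rewrite mulrDl mulrDl mul1r.
  have : k * (x * t) * (1 - x) = x * (k * t * (1 - x)) by ring.
  move=> ->; apply: le_trans (lerD h (lexx _)) _.
  have : (1 - x) * (x * t) <= (1 - x) * 1.
    by rewrite ler_wpM2l ?subr_ge0 // -[leRHS](mulr1 1) ler_pM // exprn_ile1.
  lra.
have xn : 0 <= x ^+ n by rewrite exprn_ge0.
have -> : n%:R * x ^+ n.-1 * (1 - x ^+ 2) = n%:R * x ^+ n.-1 * (1 - x) * (1 + x) by ring.
have k0 : 0 <= n%:R * x ^+ n.-1 * (1 - x) by rewrite !mulr_ge0 ?exprn_ge0 ?subr_ge0.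
rewrite -[leRHS]mul1r; apply: ler_pM => //; lra.
Qed.

Lemma pow_small (q e : R) : 0 <= q < 1 -> 0 < e ->
  exists N, forall n, (N <= n)%N -> q ^+ n <= e.
Proof.
move=> /andP[q0 q1] e0.
have H : `|q| < 1 by rewrite ger0_norm.
have /cvgrPdist_lt /(_ e e0) [N _ hN] := cvg_expr H.
exists N => n /hN /=; rewrite sub0r normrN ger0_norm ?exprn_ge0 //; exact: ltW.
Qed.

(** Write q = s^2: by [npow_peak] the product n s^(n-1) stays bounded, and the second factor s^(n-1)
    tends to 0. *)
Lemma npow_small (q e : R) : 0 <= q < 1 -> 0 < e ->
  exists N, forall n, (N <= n)%N -> n%:R * q ^+ n.-1 <= e.
Proof.
move=> /andP[q0 q1] e0; pose s := Num.sqrt q.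
have s0 : 0 <= s := sqrtr_ge0 _.
have ss : s ^+ 2 = q by rewrite sqr_sqrtr.
have s1 : s < 1 by rewrite -(sqrtr1 R) ltr_sqrt.
have p0 : 0 < 1 - s ^+ 2 by rewrite ss subr_gt0.
have [N hN] := @pow_small s (e * (1 - s ^+ 2) / 2) ltac:(by rewrite s0) ltac:(by rewrite divr_gt0 ?mulr_gt0).
exists N.+1 => -[//|n] hn; rewrite /= -ss -exprM mulnC exprM.
have hk := hN n hn; have P := @npow_peak n.+1 s ltac:(by rewrite s0 ltW).
have sn : 0 <= s ^+ n by rewrite exprn_ge0.
rewrite /= in P; rewrite expr2.
have : n.+1%:R * s ^+ n * (1 - s ^+ 2) * s ^+ n <= 2 * (e * (1 - s ^+ 2) / 2).
  by apply: ler_pM => //; rewrite !mulr_ge0 // ltW.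
have -> : 2 * (e * (1 - s ^+ 2) / 2) = e * (1 - s ^+ 2) by field.
have -> : n.+1%:R * s ^+ n * (1 - s ^+ 2) * s ^+ n = n.+1%:R * (s ^+ n * s ^+ n) * (1 - s ^+ 2) by ring.
by rewrite ler_pM2r.
Qed.

Lemma monomial_cderiv n z : has_cderiv (fun w : R[i] => w ^+ n) z (n%:R * z ^+ n.-1).
Proof. by have := has_cderivX n (has_cderiv_id z); rewrite mulr1. Qed.

Lemma cmod_natr n : cmod (n%:R : R[i]) = n%:R.
Proof. by rewrite -(rmorph_nat (real_complex R)) cmod_real ger0_norm. Qed.

Lemma monomial_norm n : in_bloch (fun w : R[i] => w ^+ n) /\
  (bloch_norm (fun w : R[i] => w ^+ n)%R <= 3%:E)%E.
Proof.
have h0 : cmod ((0 : R[i]) ^+ n) <= 1.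
  by rewrite cmodX cmod0 exprn_ile1.
have hs z l : disk z -> has_cderiv (fun w : R[i] => w ^+ n) z l ->
    (1 - cmod z ^+ 2) * cmod l <= 2.
  move=> hz hl; rewrite (has_cderiv_unique hl (monomial_cderiv n z)).
  rewrite cmodM cmodX cmod_natr mulrC; apply: npow_peak; rewrite cmod_ge0; exact: ltW.
have hh : holo_disk (fun w : R[i] => w ^+ n) by apply: holoX; exact: holo_id.
split; first exact: in_blochI hh h0 hs.
have -> : 3 = 1 + 2 :> R by ring.
exact: bloch_norm_le.
Qed.

Lemma monomial_little n : little_bloch (fun w : R[i] => w ^+ n).
Proof.
move=> e e0; pose C : R := 2 * n.+1%:R.
have C0 : 0 < C by rewrite mulr_gt0 // ltr0Sn.
exists (1 - e / C); first by rewrite ltrBlDr ltrDl divr_gt0.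
move=> z l hz hr hl; rewrite (has_cderiv_unique hl (monomial_cderiv n z)).
rewrite cmodM cmodX cmod_natr.
have W2 : 1 - cmod z ^+ 2 <= 2 * (1 - cmod z).
  have -> : 1 - cmod z ^+ 2 = (1 + cmod z) * (1 - cmod z) by ring.
  by rewrite ler_wpM2r ?subr_ge0 ?(ltW hz) //; have : cmod z < 1 by []; lra.
have z1 : cmod z ^+ n.-1 <= 1 by rewrite exprn_ile1 ?cmod_ge0 // ltW.
have : 1 - cmod z < e / C by lra.
rewrite ltr_pdivlMr // => h.
apply: (le_trans (y := 2 * (1 - cmod z) * n.+1%:R)); last first.
  by move: h; rewrite /C; lra.
apply: ler_pM => //; first exact: disk_sqr_le.
  by rewrite mulr_ge0 // exprn_ge0 // cmod_ge0.
rewrite -[leRHS]mulr1; apply: ler_pM => //; first by rewrite exprn_ge0 // cmod_ge0.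
by rewrite ler_nat.
Qed.

Lemma monomial_loc_null (s : nat -> nat) : (forall n, (n <= s n)%N) ->
  loc_null (fun n => (fun w : R[i] => w ^+ s n)).
Proof.
move=> hs rho e r1 e0; pose r := Num.max rho 0.
have r0 : 0 <= r by rewrite le_max lexx orbT.
have r1' : r < 1 by rewrite gt_max r1 ltr01.
have [N hN] := @npow_small r e ltac:(by rewrite r0) e0.
exists (maxn N 1) => n; rewrite geq_max => /andP[n1 n2].
have sN := leq_trans n1 (hs n); have s1 := leq_trans n2 (hs n).
split; first by rewrite expr0n gtn_eqF // cmod0 ltW.
move=> z l hz hl; rewrite (has_cderiv_unique hl (monomial_cderiv _ z)).
rewrite cmodM cmodX cmod_natr; apply: le_trans (hN _ sN).
have zr : cmod z <= r by rewrite le_max hz.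
rewrite -[leRHS]mul1r; apply: ler_pM.
- by apply: disk_sqr_le; exact: le_lt_trans hz r1.
- by rewrite mulr_ge0 // exprn_ge0 // cmod_ge0.
- by rewrite gerBl sqr_ge0.
by rewrite ler_wpM2l // lerXn2r ?nnegrE ?cmod_ge0.
Qed.

End TestFunctions.

(** * Logarithmic weights on the disk and limits superior *)

Section AreaWeight.
Context {R : realType}.
Implicit Types (x y : R) (z : R[i]).
Notation mu := (@lebesgue_measure R).
Notation mu2 := (mu \x mu)%E.

Lemma copen_ball (r : R) : copen [set z : R[i] | cmod z < r].
Proof.
move=> z /= z1; exists (r - cmod z); first by rewrite subr_gt0.
move=> w hw; have := cmodD (w - z) z; rewrite subrK /=; lra.
Qed.

Definition collar (r : R) : set R[i] := [set z | disk z /\ r <= cmod z].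

Lemma measurable_collar (r : R) : measurable (plane (collar r)).
Proof.
have -> : plane (collar r) = plane disk `\` plane [set z : R[i] | cmod z < r].
  apply/seteqP; split => p; rewrite /plane /collar /disk /= => -[h1 h2]; split => //.
    by apply/negP; rewrite -leNgt.
  by move/negP: h2; rewrite -leNgt.
by apply: measurableD; apply: measurable_plane; [exact: copen_disk|exact: copen_ball].
Qed.

(** A vertical slice nearly tangent to the inner circle is as long as the square root of the
    thickness of the collar, so the thickness is written s^2. On each half, (b - a)^2 <= b^2 - a^2
    <= 4 s^2. *)
Lemma collar_section (s x : R) : 0 < s <= 1 ->
  (mu (xsection (plane (collar (1 - s ^+ 2))) x) <=
    (4 * s * \1_(`]-1, 1[%classic : set R) x)%:E)%E.
Proof.
move=> /andP[s0 s1]; set A := xsection _ _.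
have AE y : A y = (cmod (Complex x y) < 1 /\ 1 - s ^+ 2 <= cmod (Complex x y)).
  by rewrite /A xsectionE.
have mA : measurable A by apply: measurable_xsection; exact: measurable_collar.
have ltA y : A y -> x ^+ 2 + y ^+ 2 < 1 /\ (1 - s ^+ 2) ^+ 2 <= x ^+ 2 + y ^+ 2.
  rewrite AE => -[h1 h2]; rewrite -(cmod_sqr (Complex x y)); split.
    by rewrite expr_lt1 ?cmod_ge0.
  by rewrite lerXn2r ?nnegrE ?cmod_ge0 // subr_ge0 expr_le1 // ltW.
have [xin|xout] := boolP (x \in (`]-1, 1[%classic : set R)); last first.
  rewrite indicE (negbTE xout) mulr0.
  suff -> : A = set0 by rewrite measure0.
  apply/seteqP; split => // y /ltA[h _]; move/negP: xout; apply; rewrite inE /= in_itv /=.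
  rewrite -ltr_norml -(expr_lt1 (n := 2)) ?normr_ge0 // real_normK ?num_real //.
  by have := sqr_ge0 y; lra.
rewrite indicE xin mulr1.
have x2 : x ^+ 2 < 1.
  move: xin; rewrite inE /= in_itv /= -ltr_norml -(expr_lt1 (n := 2)) ?normr_ge0 //.
  by rewrite real_normK ?num_real.
set rho := (1 - s ^+ 2) in ltA *.
pose a := Num.sqrt (rho ^+ 2 - x ^+ 2); pose b := Num.sqrt (1 - x ^+ 2).
have a0 : 0 <= a by exact: sqrtr_ge0.
have rho0 : 0 <= rho by rewrite subr_ge0 expr_le1 // ltW.
have rho1 : rho <= 1 by rewrite lerBlDr lerDl sqr_ge0.
have ab : a <= b by rewrite ler_wsqrtr // lerD2r expr_le1.
have b2 : b ^+ 2 = 1 - x ^+ 2 by rewrite sqr_sqrtr; lra.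
have a2 : rho ^+ 2 - x ^+ 2 <= a ^+ 2.
  have [h|h] := leP 0 (rho ^+ 2 - x ^+ 2); first by rewrite sqr_sqrtr.
  by rewrite (le_trans (ltW h)) ?sqr_ge0.
have bas : b - a <= 2 * s.
  rewrite -(ler_pXn2r (n := 2)) ?nnegrE ?subr_ge0 ?mulr_ge0 ?(ltW s0) //.
  have h : (b - a) ^+ 2 <= b ^+ 2 - a ^+ 2.
    rewrite -subr_ge0; have -> : b ^+ 2 - a ^+ 2 - (b - a) ^+ 2 = 2 * a * (b - a) by ring.
    by rewrite mulr_ge0 ?subr_ge0 // mulr_ge0.
  apply: le_trans h _; have : 1 - rho ^+ 2 <= (2 * s) ^+ 2.
    have -> : (2 * s) ^+ 2 = 1 - rho ^+ 2 + (2 * s ^+ 2 + s ^+ 2 * s ^+ 2) by rewrite /rho; ring.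
    have h2 := sqr_ge0 s; have h4 : 0 <= s ^+ 2 * s ^+ 2 by rewrite mulr_ge0.
    by rewrite lerDl; lra.
  by lra.
have sub : A `<=` `[a, b]%classic `|` `[-b, -a]%classic.
  move=> y /ltA[h1 h2].
  have h3 : a <= `|y| <= b.
    rewrite -(sqrtr_sqr y) !ler_wsqrtr //; lra.
  rewrite /= !in_itv /=; have [y0|y0] := leP 0 y.
    by left; rewrite ger0_norm in h3.
  by right; rewrite ltr0_norm // in h3; lra.
apply: (@le_trans _ _ (mu (`[a, b]%classic `|` `[-b, -a]%classic))).
  by apply: le_measure; rewrite ?inE //; exact: measurableU.
apply: le_trans (measureU2 _ _ _) _ => //.
have itvle (c d : R) : (mu `[c, d]%classic <= (Num.max 0 (d - c))%:E)%E.
  rewrite lebesgue_measure_itv /=; case: ifP => h; rewrite -?EFinB lee_fin le_max ?lexx ?orbT //.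
apply: le_trans (leeD (itvle _ _) (itvle _ _)) _.
rewrite -EFinD lee_fin.
have -> : - a - - b = b - a by ring.
by rewrite max_r ?subr_ge0 //; lra.
Qed.

Lemma collar_measure (s : R) : 0 < s <= 1 ->
  (mu2 (plane (collar (1 - s ^+ 2))) <= (8 * s)%:E)%E.
Proof.
move=> hs; rewrite /product_measure1.
apply: le_trans (_ : \int[mu]_x (4 * s * \1_(`]-1, 1[%classic : set R) x)%:E <= _)%E.
  by apply: le_integral_ge0 => x _ //; exact: collar_section.
rewrite (@integralZl_indic _ _ _ mu setT measurableT (fun=> `]-1, 1[%classic)) //; last first.
  by move: hs => /andP[s0 _]; rewrite ltNge mulr_ge0 // ltW.
have -> : (\int[mu]_x (\1_(`]-1, 1[%classic : set R) x)%:E = 2%:E)%E.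
  rewrite integral_indic // setIT; apply: etrans (lebesgue_measure_itv _) _ => /=.
  by rewrite lte_fin (_ : -1 < 1) -?EFinB ?opprK //; lra.
by rewrite -EFinM lee_fin; lra.
Qed.

(** From 1 - |z| >= h^10 one gets Lam <= 10 ln(1/h) <= 10 (1/h - 1). The exponent 10 is chosen so
    that a collar of thickness h^10 has measure of order h^5, which beats the weight of order h^-4
    by one factor h. *)
Lemma weight_le z (h : R) : 0 < h <= 1 -> h ^+ 10 <= 1 - cmod z -> (1 + Lam z) ^+ 4 <= (10 / h) ^+ 4.
Proof.
move=> /andP[h0 h1] hz; have L0 := Lam_ge0 z.
rewrite lerXn2r ?nnegrE ?divr_ge0 ?addr_ge0 ?(ltW h0) //.
have d0 : 0 < h ^+ 10 by rewrite exprn_gt0.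
have : Lam z <= 10 * ln h^-1.
  rewrite /Lam lnV ?posrE // mulrN lerN2 mulr_natl -lnXn // ler_ln ?posrE //.
  exact: lt_le_trans hz.
have hv : 0 < h^-1 by rewrite invr_gt0.
have hv1 : -1 < h^-1 - 1 by lra.
have := le_ln1Dx hv1; have -> : 1 + (h^-1 - 1) = h^-1 by ring.
lra.
Qed.

Lemma collar_index z : disk z -> exists k : nat,
  1 - ((2^-1 : R) ^+ k) ^+ 10 <= cmod z /\ ((2^-1 : R) ^+ k.+1) ^+ 10 <= 1 - cmod z.
Proof.
move=> hz; have z1 : 0 < 1 - cmod z by rewrite subr_gt0.
have [] := @pow_small R (2^-1) (1 - cmod z) _ z1; first by lra.
move=> N HN.
have hex : exists k, ((2^-1 : R) ^+ k.+1) ^+ 10 <= 1 - cmod z.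
  exists N; apply: le_trans (HN N.+1 (leqnSn N)).
  rewrite -exprM; apply: ler_wiXn2l; rewrite ?leq_pmulr //; lra.
case: (ex_minnP hex) => k hk mink; exists k; split => //.
case: k hk mink => [|k] hk mink; first by rewrite expr0 expr1n subrr cmod_ge0.
rewrite lerBlDr addrC -lerBlDr; rewrite leNgt; apply/negP => h.
by have := mink k (ltW h); rewrite ltnn.
Qed.

Lemma geometric_split_sum (a b : R) N n : 0 <= a -> 0 <= b ->
  \sum_(0 <= k < n) (if (k < N)%N then a else b) * 2^-1 ^+ k <=
  2 * a + 2 * b * 2^-1 ^+ N.
Proof.
move=> a0 b0.
have q0 k : 0 < (2^-1 : R) ^+ k by rewrite exprn_gt0.
(* The partial sums in closed form make the induction exact: the terms before N and those from N on
   telescope separately. *)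
have : \sum_(0 <= k < n) (if (k < N)%N then a else b) * 2^-1 ^+ k <=
  2 * a * (1 - 2^-1 ^+ (minn n N)) + 2 * b * (2^-1 ^+ N - 2^-1 ^+ (maxn n N)).
  elim: n => [|n IH]; first by rewrite big_nil min0n max0n !subrr !mulr0 addr0.
  rewrite big_nat_recr //=.
  have [h|h] := ltnP n N.
    move: IH; rewrite (minn_idPl (ltnW h)) (maxn_idPr (ltnW h)) (minn_idPl h) (maxn_idPr h).
    by rewrite exprS; have := q0 n; nra.
  move: IH; rewrite (minn_idPr h) (maxn_idPl h) (minn_idPr (leqW h)) (maxn_idPl (leqW h)).
  by rewrite exprS; have := q0 n; nra.
move/le_trans; apply; have := q0 (minn n N); have := q0 (maxn n N).
have : 0 <= a * 2^-1 ^+ minn n N by rewrite mulr_ge0 // ltW.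
have : 0 <= b * 2^-1 ^+ maxn n N by rewrite mulr_ge0 // ltW.
lra.
Qed.

(* On the [k]-th collar [1 - |z| >= 2^(-10(k+1))], so the weight is at most a
   constant times [2^(4k)], while the collar has measure at most [8 * 2^(-5k)]. *)
Lemma collar_sum_bound N (S : set R[i]) (f : R[i] -> R) (a b : R) : 0 <= a -> 0 <= b ->
  S `<=` disk -> (forall z, S z -> 0 <= f z) ->
  (forall z, S z -> cmod z <= 1 - (2^-1 ^+ N) ^+ 10 -> f z <= a * (1 + Lam z) ^+ 4) ->
  (forall z, S z -> f z <= b * (1 + Lam z) ^+ 4) ->
  (area_int S (fun z => (f z)%:E) <= (16 * 20 ^+ 4 * (a + b * 2^-1 ^+ N))%:E)%E.
Proof.
move=> eta0 K0 SD f0 fs fK.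
pose C0 : R := 8 * 20 ^+ 4.
have C00 : 0 < C0 by rewrite mulr_gt0 // exprn_gt0.
pose h k : R := 2^-1 ^+ k.
have h0 k : 0 < h k by rewrite exprn_gt0.
have h1 k : h k <= 1 by rewrite exprn_ile1 //; lra.
pose T k := plane (collar (1 - (h k ^+ 5) ^+ 2)).
pose d k : R := (if (k < N)%N then a else b) * (10 / h k.+1) ^+ 4.
have d0 k : 0 <= d k by rewrite mulr_ge0 //; [case: ifP|rewrite exprn_ge0 // divr_ge0 // ltW].
have mT k : measurable (T k) by exact: measurable_collar.
pose g (p : R * R) := (\sum_(0 <= k <oo) (d k * \1_(T k) p)%:E)%E.
have t0 k p : (0 <= (d k * \1_(T k) p)%:E)%E by rewrite lee_fin mulr_ge0.
have dom : (\int[mu2]_(p in plane S) (f (Complex p.1 p.2))%:E <= \int[mu2]_p g p)%E.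
  rewrite integral_mkcond; apply: le_integral_ge0 => p _; rewrite /patch.
    by case: ifP => //; rewrite inE => Sp; rewrite lee_fin f0.
  case: ifP; last by move=> _; apply: nneseries_ge0.
  rewrite inE => Sp; have [k [k1 k2]] := collar_index (SD _ Sp).
  apply: le_trans (_ : (d k * \1_(T k) p)%:E <= _)%E; last first.
    apply: le_trans (nneseries_lim_ge k.+1 _) => //.
    by rewrite big_nat_recr //= leeDr // sume_ge0.
  have Tk : p \in T k.
    by rewrite inE; split; [exact: SD|rewrite -exprM].
  rewrite indicE Tk mulr1 lee_fin /d; set z := Complex p.1 p.2 in k1 k2 *.
  have W := @weight_le z (h k.+1) _ k2.
  have {W} W : (1 + Lam z) ^+ 4 <= (10 / h k.+1) ^+ 4 by apply: W; rewrite h0 h1.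
  case: ifP => kN.
    apply: le_trans (fs _ Sp _) (ler_wpM2l eta0 W).
    (* Here k < N means k + 1 <= N, so this collar still lies within |z| <= 1 - h(N)^10, where the
       better bound [a] holds. *)
    have hk : h N ^+ 10 <= h k.+1 ^+ 10.
      rewrite lerXn2r ?nnegrE ?(ltW (h0 _)) //; apply: ler_wiXn2l => //; lra.
    by rewrite lerBrDl -lerBrDr; exact: le_trans hk k2.
  exact: le_trans (fK _ Sp) (ler_wpM2l K0 W).
have gint : (\int[mu2]_p g p <= (16 * 20 ^+ 4 * (a + b * 2^-1 ^+ N))%:E)%E.
  rewrite /g integral_nneseries //; last first.
    move=> k; apply/measurable_EFinP; apply: measurable_funM; first exact: measurable_cst.
    by apply: measurable_indic; exact: mT.
  apply: lime_le.
    by apply: is_cvg_nneseries => k _ _; apply: integral_ge0 => p _; exact: t0.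
  apply: nearW => n; apply: le_trans (_ : (\sum_(0 <= k < n) (C0 * ((if (k < N)%N then a else b) * 2^-1 ^+ k))%:E <= _)%E).
    apply: lee_sum => k _.
    rewrite (@integralZl_indic _ _ _ mu2 setT measurableT (fun=> T k)) //; last 2 first.
    - by rewrite ltNge d0.
    - exact: mT.
    have -> : (\int[mu2]_x (\1_(T k) x)%:E = mu2 (T k))%E.
      by rewrite integral_indic ?setIT //; exact: mT.
    have h5 : 0 < h k ^+ 5 <= 1.
      by apply/andP; split; [exact: exprn_gt0|apply: exprn_ile1; [exact: ltW|exact: h1]].
    have hm := collar_measure h5.
    apply: le_trans (lee_wpmul2l _ hm) _; first by rewrite lee_fin.
    rewrite -EFinM lee_fin /d /C0 /h [2^-1 ^+ k.+1]exprS; set q := 2^-1 ^+ k; set c := if _ then _ else _.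
    have q0 : q != 0 by rewrite gt_eqF // /q exprn_gt0.
    by rewrite le_eqVlt; apply/orP; left; apply/eqP; field.
  rewrite sumEFin lee_fin -mulr_sumr.
  apply: le_trans (ler_wpM2l (ltW C00) (geometric_split_sum N n eta0 K0)) _.
  by rewrite le_eqVlt /C0; apply/orP; left; apply/eqP; ring.
have pi1 : (pi : R)^-1 <= 1.
  by rewrite invf_le1 ?pi_gt0 // (le_trans _ (pi_ge2 R)) // ler1n.
rewrite /area_int; apply: le_trans (le_trans dom gint).
rewrite -[leRHS]mul1e; apply: lee_wpmul2r; last by rewrite lee_fin.
by apply: integral_ge0 => p Sp; rewrite lee_fin f0.
Qed.

(** C is absolute: a global bound with an arbitrarily large K costs only e, at the price of a rho
    depending on K and e. The factor c stays outside the integral because it may vanish, and then c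
    f is bounded although f need not be. *)
Lemma area_weight_bound : exists2 C : R, 1 <= C & forall K e : R, 0 <= K -> 0 < e ->
  exists2 rho : R, rho < 1 & forall (S : set R[i]) (f : R[i] -> R) (c eta : R),
    0 <= c -> 0 <= eta -> S `<=` disk -> (forall z, S z -> 0 <= f z) ->
    (forall z, S z -> cmod z <= rho -> c * f z <= eta * (1 + Lam z) ^+ 4) ->
    (forall z, S z -> c * f z <= K * (1 + Lam z) ^+ 4) ->
    (c%:E * area_int S (fun z => (f z)%:E) <= (C * (eta + e))%:E)%E.
Proof.
pose C : R := 16 * 20 ^+ 4.
have C1 : 1 <= C.
  have : 1 <= (20 : R) ^+ 4 by rewrite exprn_ege1 // ler1n.
  by rewrite /C; lra.
exists C => // K e K0 e0.
have [] := @pow_small R (2^-1) (e / (K + 1)).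
- by lra.
- by rewrite divr_gt0 // ltr_wpDl.
move=> N /(_ N (leqnn N)) HN.
have q0 : 0 < (2^-1 : R) ^+ N by rewrite exprn_gt0.
exists (1 - (2^-1 ^+ N) ^+ 10); first by rewrite ltrBlDr ltrDl exprn_gt0.
move=> S f c eta; rewrite le_eqVlt => /predU1P[<- eta0 _ _ _ _|c0 eta0 SD f0 fs fK].
  by rewrite mul0e lee_fin mulr_ge0 ?addr_ge0 // ?(ltW e0) // (le_trans ler01).
have bound : (area_int S (fun z => (f z)%:E) <= (C * (eta / c + K / c * 2^-1 ^+ N))%:E)%E.
  apply: collar_sum_bound => // [||z Sz hz|z Sz]; rewrite ?divr_ge0 ?(ltW c0) //.
    by rewrite mulrAC ler_pdivlMr // mulrC; exact: fs.
  by rewrite mulrAC ler_pdivlMr // mulrC; exact: fK.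
have c0' : (0 <= c%:E :> \bar R)%E by rewrite lee_fin ltW.
apply: le_trans (lee_wpmul2l c0' bound) _; rewrite -EFinM lee_fin.
have -> : c * (C * (eta / c + K / c * 2^-1 ^+ N)) = C * (eta + K * 2^-1 ^+ N).
  by field; rewrite gt_eqF.
rewrite ler_wpM2l ?(le_trans ler01) // lerD2l.
apply: le_trans (ler_wpM2l K0 HN) _.
rewrite mulrA ler_pdivrMr ?ltr_wpDl //; nra.
Qed.

End AreaWeight.

(** * Limits superior, roots of area integrals and the Cauchy estimate in the A^2 norm *)

Section LimsupCalculus.
Context {R : realType}.
Implicit Types (x y s t : R) (a z : R[i]) (phi : R[i] -> R[i]) (Q : R[i] -> \bar R).

Lemma sup0_le (A : set (\bar R)) y : 0 <= y -> (forall v, A v -> (v <= y%:E)%E) ->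
  (Defs.sup0 A <= y%:E)%E.
Proof.
by move=> y0 h; apply: ge_ereal_sup => v [->|/h //]; rewrite lee_fin.
Qed.

Lemma sup0_ge (A : set (\bar R)) v : A v -> (v <= Defs.sup0 A)%E.
Proof. by move=> h; apply: ereal_sup_ubound; right. Qed.

Lemma sup0_ge0 (A : set (\bar R)) : (0 <= Defs.sup0 A)%E.
Proof. by apply: ereal_sup_ubound; left. Qed.

(** The suprema decrease as s increases, so the limit in the definition exists and is an infimum.
    Composition with negation brings this to a nondecreasing function to the right of -1. *)
Lemma limsup_phiE phi Q : limsup_phi phi Q =
  ereal_inf [set Defs.sup0 [set Q a | a in [set a | disk a /\ s < cmod (phi a)]] | s in [set s | s < 1]].
Proof.
rewrite /limsup_phi; set S := fun s : R => Defs.sup0 _.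
apply/cvg_lim => //; apply/cvg_at_leftNP.
have nd : {in Interval (BRight (- 1 : R)) +oo%O &, {homo (S \o -%R) : x y / x <= y >-> (x <= y)%E}}.
  move=> x y _ _ xy; apply: ereal_sup_le => v; case=> [->|[a [da ha] <-]]; first by left.
  by right; exists a => //; split => //; apply: le_lt_trans ha; rewrite lerN2.
have := nondecreasing_at_right_cvge (f := S \o -%R) (a := -1) +oo%O isT nd.
congr (_ --> ereal_inf _); apply/seteqP; split => v [s hs <-].
  exists (- s) => //=; move: hs; rewrite /= in_itv /= andbT; lra.
exists (- s) => //=; last by rewrite opprK.
by rewrite in_itv /= andbT ltrN2.
Qed.

Lemma limsup_phi_le phi Q s y : 0 <= y -> s < 1 ->
  (forall a, disk a -> s < cmod (phi a) -> (Q a <= y%:E)%E) -> (limsup_phi phi Q <= y%:E)%E.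
Proof.
move=> y0 s1 h; rewrite limsup_phiE.
apply: (@le_trans _ _ (Defs.sup0 [set Q a | a in [set a | disk a /\ s < cmod (phi a)]])).
  by apply: ereal_inf_lbound; exists s.
by apply: sup0_le => // v [a [h1 h2] <-]; exact: h.
Qed.

Lemma limsup_phi_eventually phi Q x (e : R) : (limsup_phi phi Q <= x%:E)%E -> 0 < e ->
  exists2 s, s < 1 & forall a, disk a -> s < cmod (phi a) -> (Q a <= (x + e)%:E)%E.
Proof.
move=> h e0; rewrite limsup_phiE in h.
have xe : (x%:E < (x + e)%:E)%E by rewrite lte_fin ltrDl.
have /ereal_inf_lt[_ [s s1 <-] hs] := le_lt_trans h xe.
exists s => // a da ha; apply: le_trans (ltW hs); apply: sup0_ge.
by exists a.
Qed.

Lemma limsup_phi_ge0 phi Q : (0 <= limsup_phi phi Q)%E.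
Proof.
by rewrite limsup_phiE; apply: le_ereal_inf_tmp => _ [s _ <-]; exact: sup0_ge0.
Qed.

Lemma limsup_left1_le (F : R -> \bar R) t0 y : t0 < 1 ->
  (forall t, t0 < t < 1 -> (F t <= y%:E)%E) -> (limsup_left1 F <= y%:E)%E.
Proof.
move=> t1 h; rewrite /limsup_left1.
apply: (@le_trans _ _ (ereal_sup (F @` [set t | t0 < t < 1]))).
  apply: ereal_inf_lbound; exists [set t | t0 < t < 1] => //.
  near=> t; apply/andP; split; near: t; [exact: nbhs_left_gt|exact: nbhs_left_lt].
by apply: ge_ereal_sup => v [t ht <-]; exact: h.
Unshelve. all: by end_near. Qed.

Lemma limsup_left1_ge0 (F : R -> \bar R) : (forall t, (0 <= F t)%E) -> (0 <= limsup_left1 F)%E.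
Proof.
move=> h; apply: le_ereal_inf_tmp => _ [V FV <-].
have [t Vt] := filter_ex FV.
by apply: le_trans (h t) _; apply: ereal_sup_ubound; exists t.
Qed.

Lemma limn_esup_le (v : nat -> \bar R) N y : (forall n, (N <= n)%N -> (v n <= y%:E)%E) ->
  (limn_esup v <= y%:E)%E.
Proof.
move=> h; apply: (@le_trans _ _ (ereal_sup (v @` [set n | (N <= n)%N]))).
  by apply: ereal_inf_lbound; exists [set n | (N <= n)%N] => //; exists N.
by apply: ge_ereal_sup => w [n hn <-]; exact: h.
Qed.

Lemma limn_esup_eventually (v : nat -> \bar R) x (e : R) : (limn_esup v <= x%:E)%E -> 0 < e ->
  exists N, forall n, (N <= n)%N -> (v n <= (x + e)%:E)%E.
Proof.
move=> h e0.
have /ereal_inf_lt[_ [V [N _ NV] <-] hs] : (limn_esup v < (x + e)%:E)%E.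
  by apply: le_lt_trans h _; rewrite lte_fin ltrDl.
exists N => n hn; apply: le_trans (ltW hs); apply: ereal_sup_ubound.
by exists n => //; exact: NV.
Qed.

Lemma limn_esup_ge0 (v : nat -> \bar R) : (forall n, (0 <= v n)%E) -> (0 <= limn_esup v)%E.
Proof.
move=> h; apply: le_ereal_inf_tmp => _ [V [N _ NV] <-].
by apply: le_trans (h N) _; apply: ereal_sup_ubound; exists N => //; apply: NV => /=.
Qed.

Lemma poweR_root_le (I : \bar R) (n : nat) (c : R) : (0 < n)%N -> (0 <= I)%E -> 0 <= c ->
  (I <= (c ^+ n)%:E)%E -> (poweR I (n%:R^-1) <= c%:E)%E.
Proof.
move=> n0 I0 c0 h; have n0' : 0 < (n%:R : R)^-1 by rewrite invr_gt0 ltr0n.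
have -> : c%:E = poweR (c ^+ n)%:E (n%:R^-1).
  by rewrite poweR_EFin -powR_mulrn // -powRrM divff ?pnatr_eq0 -?lt0n // powRr1.
apply: (gt0_ler_poweR (ltW n0')) => //; rewrite in_itv /= leey andbT //.
by rewrite lee_fin exprn_ge0.
Qed.

Lemma poweR_root_ge (I : \bar R) (n : nat) (c : R) : (0 < n)%N -> (0 <= I)%E -> 0 <= c ->
  ((c ^+ n)%:E <= I)%E -> (c%:E <= poweR I (n%:R^-1))%E.
Proof.
move=> n0 I0 c0 h; have n0' : 0 < (n%:R : R)^-1 by rewrite invr_gt0 ltr0n.
have -> : c%:E = poweR (c ^+ n)%:E (n%:R^-1).
  by rewrite poweR_EFin -powR_mulrn // -powRrM divff ?pnatr_eq0 -?lt0n // powRr1.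
apply: (gt0_ler_poweR (ltW n0')) => //; rewrite in_itv /= leey andbT //.
by rewrite lee_fin exprn_ge0.
Qed.

Lemma area_int_ge0 (S : set R[i]) (f : R[i] -> \bar R) : (forall z, (0 <= f z)%E) ->
  (0 <= area_int S f)%E.
Proof.
move=> f0; apply: mule_ge0; first by rewrite lee_fin invr_ge0 pi_ge0.
by apply: integral_ge0 => p _; exact: f0.
Qed.

Lemma A2norm_cauchy h (l : R[i]) : holo_disk h -> h 0 = 0 -> has_cderiv h 0 l ->
  ((cmod l)%:E <= 64%:E * A2norm h)%E.
Proof.
move=> hh h0 hl; rewrite /A2norm.
have c := cauchy_area hh h0 hl; set I := area_int _ _ in c *.
have I0 : (0 <= I)%E by apply: area_int_ge0 => z; rewrite lee_fin sqr_ge0.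
have k0 : 0 < (64 : R) by [].
have -> : (cmod l)%:E = (64%:E * (cmod l / 64)%:E)%E by rewrite -EFinM mulrC divfK ?gt_eqF.
apply: lee_wpmul2l; first by rewrite lee_fin ltW.
apply: poweR_root_ge => //; first by rewrite divr_ge0 ?cmod_ge0 // ltW.
have -> : ((cmod l / 64) ^+ 2)%:E = ((64 * 64)^-1%:E * (cmod l ^+ 2)%:E)%E.
  by rewrite -EFinM; congr EFin; field.
have k1 : 0 < (64 * 64 : R) by rewrite mulr_gt0.
have -> : I = (((64 * 64)^-1)%:E * ((64 * 64)%:E * I))%E.
  by rewrite muleA -EFinM mulVf ?mul1e // gt_eqF.
by apply: lee_wpmul2l => //; rewrite lee_fin invr_ge0 ltW.
Qed.

End LimsupCalculus.

Section WeightConstants.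
Context {R : realType}.

(** The conclusion of [area_weight_bound] as a property of C, so that one and the same constant
    serves alpha, beta and gamma. *)
Definition area_const (C : R) := 1 <= C /\ forall K e : R, 0 <= K -> 0 < e ->
  exists2 rho : R, rho < 1 & forall (S : set R[i]) (f : R[i] -> R) (c eta : R),
    0 <= c -> 0 <= eta -> S `<=` disk -> (forall z, S z -> 0 <= f z) ->
    (forall z, S z -> cmod z <= rho -> c * f z <= eta * (1 + Lam z) ^+ 4) ->
    (forall z, S z -> c * f z <= K * (1 + Lam z) ^+ 4) ->
    (c%:E * area_int S (fun z => (f z)%:E) <= (C * (eta + e))%:E)%E.

(** Allows roots to be taken with the same C: C >= 1 gives C <= C^n, and a^n + b^n <= (a + b)^n. *)
Lemma add_pow_le (C a b : R) n : 1 <= C -> 0 <= a -> 0 <= b -> (0 < n)%N ->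
  C * (a ^+ n + b ^+ n) <= (C * (a + b)) ^+ n.
Proof.
move=> C1 a0 b0 n0; have C0 : 0 <= C by apply: le_trans C1.
rewrite exprMn; apply: ler_pM => //; first by rewrite addr_ge0 // exprn_ge0.
  by rewrite -[leLHS]expr1 ler_weXn2l.
case: n n0 => // n _; elim: n => [|n IH]; first by rewrite !expr1.
have s0 : 0 <= a + b by rewrite addr_ge0.
rewrite exprS [b ^+ _]exprS [leRHS]exprS; apply: le_trans (ler_wpM2l s0 IH).
have : 0 <= a * b ^+ n.+1 by rewrite mulr_ge0 // exprn_ge0.
have : 0 <= b * a ^+ n.+1 by rewrite mulr_ge0 // exprn_ge0.
move: (a ^+ n.+1) (b ^+ n.+1) => p q; rewrite mulrDr !mulrDl; lra.
Qed.

Lemma A2norm_weight (C : R) : area_const C -> forall K e : R, 0 <= K -> 0 < e ->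
  exists2 rho : R, rho < 1 & forall (F : R[i] -> R[i]) (c eta : R),
    0 <= c -> 0 <= eta ->
    (forall z, disk z -> cmod z <= rho -> c * cmod (F z) <= eta * (1 + Lam z) ^+ 2) ->
    (forall z, disk z -> c * cmod (F z) <= K * (1 + Lam z) ^+ 2) ->
    (c%:E * A2norm F <= (C * (eta + e))%:E)%E.
Proof.
move=> [C1 hC] K e K0 e0.
have [|rho r1 H] := hC (K ^+ 2) (e ^+ 2) (sqr_ge0 K); first by rewrite exprn_gt0.
exists rho => // F c eta; rewrite le_eqVlt => /predU1P[<- eta0 _ _|c0 eta0 h1 h2].
  by rewrite mul0e lee_fin mulr_ge0 ?addr_ge0 // ?(ltW e0) // (le_trans ler01).
have sq (t X : R) z : 0 <= X -> c * cmod (F z) <= t * (1 + Lam z) ^+ 2 ->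
    c ^+ 2 * cmod (F z) ^+ 2 <= t ^+ 2 * (1 + Lam z) ^+ 4.
  move=> _ h; rewrite -exprMn (_ : t ^+ 2 * _ = (t * (1 + Lam z) ^+ 2) ^+ 2); last by ring.
  have h0 : 0 <= c * cmod (F z) by rewrite mulr_ge0 ?cmod_ge0 // ltW.
  by rewrite lerXn2r ?nnegrE // (le_trans h0).
have := H disk (fun z => cmod (F z) ^+ 2) (c ^+ 2) (eta ^+ 2) (sqr_ge0 c) (sqr_ge0 eta)
  (@subset_refl _ disk) (fun z _ => sqr_ge0 _)
  (fun z hz hr => sq eta 0 z (lexx 0) (h1 z hz hr)) (fun z hz => sq K 0 z (lexx 0) (h2 z hz)).
rewrite /A2norm; set I := area_int _ _ => hI.
have I0 : (0 <= I)%E by apply: area_int_ge0 => z; rewrite lee_fin sqr_ge0.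
set B := C * (eta + e).
have B0 : 0 <= B by rewrite mulr_ge0 ?addr_ge0 // ?(ltW e0) // (le_trans ler01).
have c2 : 0 < c ^+ 2 by rewrite exprn_gt0.
have hI2 : (I <= ((B / c) ^+ 2)%:E)%E.
  have -> : I = ((c ^+ 2)^-1%:E * ((c ^+ 2)%:E * I))%E.
    by rewrite muleA -EFinM mulVf ?mul1e // gt_eqF.
  have t0 : (0 <= ((c ^+ 2)^-1)%:E)%E by rewrite lee_fin invr_ge0 ltW.
  apply: le_trans (lee_wpmul2l t0 hI) _.
  rewrite -EFinM lee_fin mulrC exprMn exprVn ler_wpM2r ?invr_ge0 ?(ltW c2) //.
  by apply: add_pow_le => //; exact: ltW.
have := @poweR_root_le R I 2 (B / c) isT I0 _ hI2.
rewrite divr_ge0 ?(ltW c0) // => /(_ isT) h.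
have c0' : (0 <= c%:E)%E by rewrite lee_fin ltW.
by apply: le_trans (lee_wpmul2l c0' h) _; rewrite -EFinM mulrC divfK // gt_eqF.
Qed.

Lemma bernoulli (d : R) j : 0 <= d <= 1 -> 1 - j%:R * d <= (1 - d) ^+ j.
Proof.
move=> /andP[d0 d1]; elim: j => [|j IH]; first by rewrite expr0 mul0r subr0.
have r0 : 0 <= 1 - d by rewrite subr_ge0.
rewrite exprS -natr1; apply: le_trans (ler_wpM2l r0 IH); rewrite -subr_ge0.
have -> : (1 - d) * (1 - j%:R * d) - (1 - (j%:R + 1) * d) = j%:R * (d * d) by ring.
by rewrite mulr_ge0 // mulr_ge0.
Qed.

End WeightConstants.

(** * Weighted composition operators *)

Section WeightedComposition.
Context {R : realType}.
Implicit Types (x y e s : R) (a z w l : R[i]) (f : R[i] -> R[i]).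
Variables (u phi : R[i] -> R[i]) (M : R).
Hypothesis hu : holo_disk u.
Hypothesis hphi : self_map phi.
Hypothesis hT : forall f, in_bloch f -> in_bloch (wcomp u phi f).
Hypothesis M_gt0 : 0 < M.
Hypothesis hM : (op_norm (wcomp u phi) <= M%:E)%E.

Definition phi_part z : R :=
  cmod (u z) * ((1 - cmod z ^+ 2) * cmod (cderiv phi z) / (1 - cmod (phi z) ^+ 2)).

Definition u_part z : R := (1 - cmod z ^+ 2) * cmod (cderiv u z) * Lw (phi z).

(* Encodes [limsup_{|phi z| -> 1} Q z <= x]. *)
Definition near_le (Q : R[i] -> R) x := forall e, 0 < e -> exists2 s, s < 1 &
  forall z, disk z -> s < cmod (phi z) -> Q z <= x + e.

Lemma disk_phi z : disk z -> disk (phi z).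
Proof. exact: hphi.2. Qed.

Lemma phi_part_ge0 z : disk z -> 0 <= phi_part z.
Proof.
move=> hz; rewrite mulr_ge0 ?cmod_ge0 // divr_ge0 ?(disk_sqr_le (disk_phi hz)) //.
by rewrite mulr_ge0 ?cmod_ge0 ?disk_sqr_le.
Qed.

Lemma u_part_ge0 z : disk z -> 0 <= u_part z.
Proof.
move=> hz; rewrite mulr_ge0 ?(ltW (Lw_gt0 (disk_phi hz))) //.
by rewrite mulr_ge0 ?cmod_ge0 ?disk_sqr_le.
Qed.

Lemma wcomp_cderiv f z l : disk z -> has_cderiv f (phi z) l ->
  has_cderiv (wcomp u phi f) z (cderiv u z * f (phi z) + u z * (l * cderiv phi z)).
Proof.
move=> hz hl; apply: has_cderivM; first exact: holo_cderiv.
by apply: (@has_cderiv_comp R phi f) => //; exact: (holo_cderiv hphi.1).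
Qed.

Lemma wcomp_bound f (m : R) : in_bloch f -> (bloch_norm f <= m%:E)%E -> 0 < m ->
  (bloch_norm (wcomp u phi f) <= (M * m)%:E)%E.
Proof.
move=> bf fm m0; apply: op_norm_bound => // g c z _ _; exact: wcomp_hom.
Qed.

Lemma phi_part_weight z l : disk z ->
  cmod l * (1 - cmod (phi z) ^+ 2) * phi_part z =
  (1 - cmod z ^+ 2) * cmod (u z * (l * cderiv phi z)).
Proof.
move=> hz; have d0 := disk_sqr (disk_phi hz).
by rewrite /phi_part !cmodM; field; rewrite gt_eqF.
Qed.

Lemma sigma_norm w : disk w -> in_bloch (sigma w) /\ (bloch_norm (sigma w) <= 2%:E)%E.
Proof.
move=> hw; have B z l : disk z -> has_cderiv (sigma w) z l -> (1 - cmod z ^+ 2) * cmod l <= 1.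
  move=> hz hl; rewrite (has_cderiv_unique hl (sigma_cderiv hw hz)) cmod_sigma_deriv //.
  by rewrite lerBlDr lerDl sqr_ge0.
have B0 : cmod (sigma w 0) <= 1 by rewrite sigma0 ltW.
split; first exact: (in_blochI (holo_sigma hw) B0 B).
have -> : (2 : R) = 1 + 1 by ring.
exact: bloch_norm_le.
Qed.

(** Test with sigma_w, w = phi(z): it vanishes at w, which removes the term with u', and (1 - |w|^2)
    |sigma_w'(w)| = 1. *)
Lemma phi_part_le z : disk z -> phi_part z <= 2 * M.
Proof.
move=> hz; have hw := disk_phi hz; have [b n] := sigma_norm hw.
have h : (bloch_norm (wcomp u phi (sigma (phi z))) <= (M * 2)%:E)%E by exact: wcomp_bound.
have [_ h2] := bloch_normP (hT b).1 h.
have := h2 z _ hz (wcomp_cderiv hz (sigma_cderiv hw hw)).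
rewrite sigmaaa mulr0 add0r -phi_part_weight // mulrC [M * 2]mulrC.
have d0 := disk_sqr hw.
rewrite cmod_div cmodN cmodX cmod_real (ger0_norm (ltW d0)).
have -> : 1 - cconj (phi z) * phi z = (1 - cmod (phi z) ^+ 2)%:C%C.
  by rewrite mulrC real_one_sub_sqr.
rewrite cmod_real (ger0_norm (ltW d0)); set d := 1 - _ in d0 *.
by have -> : d / d ^+ 2 * d = 1; [field; rewrite gt_eqF|rewrite mulr1].
Qed.

(** For the test function at w = phi(z) the term with u' is exactly [u_part], and the term with phi'
    is at most 2 [phi_part]. *)
Lemma u_part_gfun z (K : R) : disk z ->
  (bloch_norm (wcomp u phi (gfun (phi z))) <= K%:E)%E -> u_part z <= K + 2 * phi_part z.
Proof.
move=> hz h; have hw := disk_phi hz.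
have [_ h2] := bloch_normP (hT (gfun_norm hw).1).1 h.
have := h2 z _ hz (wcomp_cderiv hz (gfun_deriv_self hw)); rewrite gfun_self //.
set p := cderiv u z * _; set q := u z * _ => h3.
have d0 := disk_sqr hw; have L0 := Lw_gt0 hw.
have hq : (1 - cmod z ^+ 2) * cmod q <= 2 * phi_part z.
  rewrite -phi_part_weight // ler_wpM2r ?phi_part_ge0 //.
  rewrite cmod_div cmodM cmod_conj cmod_real (ger0_norm (ltW d0)) cmod_natr divfK ?gt_eqF //.
  by rewrite ler_piMr // ltW.
have -> : u_part z = (1 - cmod z ^+ 2) * cmod p.
  by rewrite /u_part /p cmodM cmod_real (ger0_norm (ltW L0)) mulrA.
have := cmodB (p + q) q; rewrite addrK => /(ler_wpM2l (disk_sqr_le hz)).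
rewrite mulrDr; lra.
Qed.

Lemma u_part_le z : disk z -> u_part z <= 50 * M.
Proof.
move=> hz; have [b n] := gfun_norm (disk_phi hz).
have t46 : 0 < (46 : R) by [].
have h := wcomp_bound b n t46.
by have := u_part_gfun hz h; have := phi_part_le hz; lra.
Qed.

Lemma u_deriv_le z : disk z -> (1 - cmod z ^+ 2) * cmod (cderiv u z) <= 100 * M.
Proof.
move=> hz; have := u_part_le hz; have := Lw_ge (disk_phi hz); rewrite /u_part.
have : 0 <= (1 - cmod z ^+ 2) * cmod (cderiv u z) by rewrite mulr_ge0 ?cmod_ge0 ?disk_sqr_le.
nra.
Qed.

(** [u_part] is bounded and its log weight tends to infinity, so the unweighted derivative of u
    becomes negligible. This disposes of the terms with u' wherever only [phi_part] is to be
    estimated. *)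
Lemma u_deriv_small e : 0 < e -> exists2 s, s < 1 & forall z, disk z -> s < cmod (phi z) ->
  (1 - cmod z ^+ 2) * cmod (cderiv u z) <= e.
Proof.
move=> e0; have [s s1 hs] := @Lw_large R (50 * M / e).
exists s => // z hz sz; have := hs _ (disk_phi hz) sz; rewrite ler_pdivrMr // => h.
have L0 := Lw_gt0 (disk_phi hz).
by rewrite -(ler_pM2r L0) [e * _]mulrC; apply: le_trans h; exact: u_part_le.
Qed.

Lemma near_leW (Q : R[i] -> R) x y : x <= y -> near_le Q x -> near_le Q y.
Proof.
move=> xy h e e0; have [s s1 hs] := h e e0; exists s => // z hz sz.
by apply: le_trans (hs z hz sz) _; rewrite lerD2r.
Qed.

Lemma op_sub_in_bloch K f : compact_bloch K -> in_bloch f -> in_bloch (op_sub (wcomp u phi) K f).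
Proof. by case=> _ _ hK _ bf; apply: in_blochB; [exact: hT|exact: hK]. Qed.

Lemma op_sub_bound K f (y m : R) : compact_bloch K ->
  (op_norm (op_sub (wcomp u phi) K) <= y%:E)%E -> in_bloch f -> (bloch_norm f <= m%:E)%E ->
  0 < m -> (bloch_norm (wcomp u phi f) <= (y * m)%:E + bloch_norm (K f))%E.
Proof.
move=> cK hy bf fm m0.
have h := @op_norm_bound R (op_sub (wcomp u phi) K) f y m (fun g => @op_sub_in_bloch K g cK) _ hy bf fm m0.
have {}h : (bloch_norm (op_sub (wcomp u phi) K f) <= (y * m)%:E)%E.
  apply: h => g c z bg hz; rewrite /op_sub wcomp_hom (compact_hom c cK bg hz); ring.
apply: le_trans (leeD2r _ h).
have hK : holo_disk (K f) by case: cK => _ _ h3 _; exact: (h3 _ bf).1.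
have -> : bloch_norm (wcomp u phi f) =
    bloch_norm (fun z => op_sub (wcomp u phi) K f z + K f z)%R.
  by congr bloch_norm; apply/funext => z; rewrite /op_sub subrK.
apply: bloch_normD => //; exact: (op_sub_in_bloch cK bf).1.
Qed.

Lemma ess_ge_pow K y : compact_bloch K -> 0 <= y ->
  (op_norm (op_sub (wcomp u phi) K) <= y%:E)%E -> (limsup_pow u phi <= (3 * y)%:E)%E.
Proof.
move=> cK y0 hy; apply/lee_addgt0Pr => e e0; rewrite -EFinD.
have [[N hN]|no] := pselect (exists N, forall n, (N <= n)%N ->
    (bloch_norm (fun z => u z * phi z ^+ n)%R <= (3 * y + e)%:E)%E).
  exact: limn_esup_le hN.
(* The exponents with too large a norm need not increase with N; s(N) >= N is enough for the
   monomials to tend to 0 locally uniformly. *)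
exfalso; have /choice[s hs] : forall N : nat, exists n, (N <= n)%N /\
    ~ (bloch_norm (fun z => u z * phi z ^+ n)%R <= (3 * y + e)%:E)%E.
  move=> N; apply: contrapT => h; apply: no; exists N => n hn; apply: contrapT => h'.
  by apply: h; exists n.
have e2 : 0 < e / 2 by rewrite divr_gt0.
have [||||n _ hn] := @compact_gliding_hump R K (fun n => (fun w : R[i] => w ^+ s n)) 3 cK _ _ _ _ (e / 2) 0%N e2.
- by [].
- by move=> n; exact: monomial_norm.
- by move=> n; exact: monomial_little.
- by apply: monomial_loc_null => n; exact: (hs n).1.
apply: (hs n).2; have [b m] := @monomial_norm R (s n).
have t3 : 0 < (3 : R) by [].
change (bloch_norm (wcomp u phi (fun w => w ^+ s n)%R) <= (3 * y + e)%:E)%E.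
apply: le_trans (op_sub_bound cK hy b m t3) _.
apply: le_trans (leeD2l _ hn) _; rewrite -EFinD lee_fin; lra.
Qed.

Lemma ess_ge_g K y : compact_bloch K -> 0 <= y ->
  (op_norm (op_sub (wcomp u phi) K) <= y%:E)%E -> (limsup_g u phi <= (46 * y)%:E)%E.
Proof.
move=> cK y0 hy; apply/lee_addgt0Pr => e e0; rewrite -EFinD.
have t0 : 0 <= 46 * y + e by rewrite addr_ge0 ?mulr_ge0 // ltW.
have [[s s1 hs]|no] := pselect (exists2 s, s < 1 & forall a, disk a -> s < cmod (phi a) ->
    (bloch_norm (wcomp u phi (g_test phi a)) <= (46 * y + e)%:E)%E).
  exact: (limsup_phi_le t0 s1 hs).
exfalso; have /choice[a ha] : forall n : nat, exists a, [/\ disk a, 1 - n.+1%:R^-1 < cmod (phi a) &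
    ~ (bloch_norm (wcomp u phi (gfun (phi a))) <= (46 * y + e)%:E)%E].
  move=> n; apply: contrapT => h; apply: no; exists (1 - n.+1%:R^-1).
    by rewrite ltrBlDr ltrDl invr_gt0.
  move=> a ha sa; apply: contrapT => h'.
  by apply: h; exists a.
have e2 : 0 < e / 2 by rewrite divr_gt0.
have da n : disk (phi (a n)) by apply: disk_phi; case: (ha n).
have [||||n _ hn] := @compact_gliding_hump R K (fun n => gfun (phi (a n))) 46 cK _ _ _ _ (e / 2) 0%N e2.
- by [].
- by move=> n; exact: gfun_norm.
- by move=> n; exact: gfun_little.
- apply: gfun_loc_null => // s s1; have s1' : 0 < 1 - s by rewrite subr_gt0.
  have [N _ HN] := near_infty_natSinv_lt (PosNum s1'); exists N => n hn.
  have [_ h _] := ha n; by apply: lt_trans h; rewrite ltrBrDl -ltrBrDr; exact: HN n hn.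
have [_ _] := ha n; apply; have [b m] := gfun_norm (da n).
have t46 : 0 < (46 : R) by [].
apply: le_trans (op_sub_bound cK hy b m t46) _.
apply: le_trans (leeD2l _ hn) _; rewrite -EFinD lee_fin; lra.
Qed.

Lemma near_of_pow x : (limsup_pow u phi <= x%:E)%E -> near_le phi_part (4 * x).
Proof.
move=> h e e0; have e8 : 0 < e / 8 by rewrite divr_gt0.
have [N hN] := limn_esup_eventually h e8.
have [s1 s11 hs1] := u_deriv_small e8.
exists (Num.max s1 (1 - (2 * N.+1%:R)^-1)).
  by rewrite gt_max s11 ltrBlDr ltrDl invr_gt0 mulr_gt0.
move=> z hz; rewrite gt_max => /andP[sz Nz]; have hw := disk_phi hz.
set r := cmod (phi z) in Nz *; set d := 1 - r.
have d0 : 0 < d by rewrite subr_gt0.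
have d2 : 0 < (2 * d)^-1 by rewrite invr_gt0 mulr_gt0.
(* The exponent is adapted to z: n d >= 1/2, while k d <= 1/2 gives r^k >= 1/2 by Bernoulli, so n
   r^(n-1) (1 - r^2) >= 1/4, the source of the factor 4. The threshold on |phi(z)| forces n >= N. *)
pose k := Num.truncn (2 * d)^-1; pose n := k.+1.
have kd : k%:R * d <= 1/2.
  have : k%:R <= (2 * d)^-1 by rewrite truncn_le // ltW.
  by rewrite invfM => /(ler_wpM2r (ltW d0)); rewrite -mulrA mulVf ?gt_eqF //; lra.
have nd : 1/2 <= n%:R * d.
  have : (2 * d)^-1 < n%:R by rewrite truncnS_gt.
  by rewrite -(ltr_pM2r d0) invfM -mulrA mulVf ?gt_eqF //; lra.
have nN : (N <= n)%N.
  have h1 : d < (2 * N.+1%:R)^-1 by rewrite /d ltrBlDr addrC -ltrBlDr.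
  have h2 : N.+1%:R < n%:R :> R.
    have N0 : 0 < N.+1%:R :> R by rewrite ltr0n.
    have : d * N.+1%:R < 1/2.
      by move: h1; rewrite invfM -(ltr_pM2r N0) -mulrA mulVf ?gt_eqF //; lra.
    by rewrite mulrC => t; rewrite -(ltr_pM2r d0); exact: lt_le_trans t nd.
  by move: h2; rewrite ltr_nat => /ltnW; exact: ltnW.
have r0 : 0 <= r by exact: cmod_ge0.
have r1 : r <= 1 by exact: ltW.
have rk : 1/2 <= r ^+ k.
  have d1 : 0 <= d <= 1 by rewrite /d; lra.
  have rE : 1 - d = r by rewrite /d; ring.
  by have := bernoulli k d1; rewrite rE; lra.
have [_ h2] := bloch_normP (holoM hu (holoX n hphi.1)) (hN n nN).
have {h2} := h2 z _ hz (@wcomp_cderiv (fun w => w ^+ n) z _ hz (monomial_cderiv n (phi z))).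
rewrite /=; set p := cderiv u z * _; set q := u z * _ => h3.
have hp : (1 - cmod z ^+ 2) * cmod p <= e / 8.
  apply: le_trans (hs1 z hz sz); rewrite /p cmodM cmodX -/r mulrA ler_piMr ?exprn_ile1 //.
  by rewrite mulr_ge0 ?cmod_ge0 ?disk_sqr_le.
have hq : (1 - cmod z ^+ 2) * cmod q <= x + e / 8 + e / 8.
  have := cmodB (p + q) p; rewrite [p + q]addrC addrK addrC.
  by move=> /(ler_wpM2l (disk_sqr_le hz)); rewrite mulrDr; lra.
move: hq; rewrite -phi_part_weight // cmodM cmodX cmod_natr -/r /= => hq.
have A0 := phi_part_ge0 hz.
have : 1/4 <= n%:R * r ^+ k * (1 - r ^+ 2).
  have -> : n%:R * r ^+ k * (1 - r ^+ 2) = (n%:R * d) * (r ^+ k * (1 + r)) by rewrite /d; ring.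
  have : 1/2 <= r ^+ k * (1 + r) by nra.
  by nra.
move=> /(ler_wpM2r A0); lra.
Qed.

Lemma near_of_g x y : (limsup_g u phi <= x%:E)%E -> near_le phi_part y ->
  near_le u_part (x + 2 * y).
Proof.
move=> h hA e e0; have e4 : 0 < e / 4 by rewrite divr_gt0.
have [s1 s11 h1] := limsup_phi_eventually h e4.
have [s2 s21 h2] := hA _ e4.
exists (Num.max s1 s2); first by rewrite gt_max s11.
move=> z hz; rewrite gt_max => /andP[z1 z2].
by have := u_part_gfun hz (h1 z hz z1); have := h2 z hz z2; lra.
Qed.

Lemma conj_cderiv a : disk a -> has_cderiv (fun z => sigma (phi a) (phi (sigma a z))) 0
  ((- (1 - cmod (phi a) ^+ 2)%:C%C / (1 - cconj (phi a) * phi a) ^+ 2) *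
    (cderiv phi a * (- (1 - cmod a ^+ 2)%:C%C))).
Proof.
move=> ha; have hw := disk_phi ha.
have d1 := sigma_cderiv ha (disk0 : disk (0 : R[i])); rewrite mulr0 subr0 expr1n divr1 in d1.
have d2 : has_cderiv phi (sigma a 0) (cderiv phi a) by rewrite sigma0; exact: (holo_cderiv hphi.1).
have d3 := has_cderiv_comp d1 d2.
apply: (@has_cderiv_comp R (fun z => phi (sigma a z)) (sigma (phi a))) => //.
by rewrite sigma0; exact: sigma_cderiv.
Qed.

Lemma near_of_alpha x : (alpha_t u phi <= x%:E)%E -> near_le phi_part (64 * x).
Proof.
move=> h e e0; have e4 : 0 < e / 64 by rewrite divr_gt0.
have [s s1 hs] := limsup_phi_eventually h e4; exists s => // a ha sa.
have hw := disk_phi ha; have := hs a ha sa; set F := (fun z => sigma (phi a) _) => h1.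
have hF : holo_disk F.
  exact: (holo_comp (self_map_comp (self_map_sigma ha) hphi) (holo_sigma hw)).
have F0 : F 0 = 0 by rewrite /F sigma0 sigmaaa.
have := A2norm_cauchy hF F0 (conj_cderiv ha).
set l := _ * _ => h2.
have lE : cmod (u a) * cmod l = phi_part a.
  rewrite /phi_part /l; congr (_ * _).
  have -> : 1 - cconj (phi a) * phi a = (1 - cmod (phi a) ^+ 2)%:C%C.
    by rewrite mulrC real_one_sub_sqr.
  have d0 := disk_sqr hw; have d1 := disk_sqr ha.
  rewrite !cmodM cmodV !cmodN cmodX !cmod_real !ger0_norm ?(ltW d0) ?(ltW d1) //.
  by field; rewrite gt_eqF.
rewrite -lee_fin -lE EFinM.
have ua0 : (0 <= (cmod (u a))%:E)%E by rewrite lee_fin cmod_ge0.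
apply: le_trans (lee_wpmul2l ua0 h2) _; rewrite muleCA.
have k0 : (0 <= (64 : R)%:E)%E by rewrite lee_fin.
apply: le_trans (lee_wpmul2l k0 h1) _; rewrite -EFinM lee_fin; lra.
Qed.

Lemma near_of_beta x : (beta_t u phi <= x%:E)%E -> near_le u_part (64 * x).
Proof.
move=> h e e0; have e4 : 0 < e / 64 by rewrite divr_gt0.
have [s s1 hs] := limsup_phi_eventually h e4; exists s => // a ha sa.
have hw := disk_phi ha; have := hs a ha sa; set F := (fun z => (u (sigma a z) - u a)%R) => h1.
have hF : holo_disk F.
  apply: holoB; last exact: holo_cst.
  exact: (holo_comp (self_map_sigma ha) hu).
have F0 : F 0 = 0 by rewrite /F sigma0 subrr.
have d1 := sigma_cderiv ha (disk0 : disk (0 : R[i])); rewrite mulr0 subr0 expr1n divr1 in d1.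
have d2 : has_cderiv u (sigma a 0) (cderiv u a) by rewrite sigma0; exact: holo_cderiv.
have d3 := has_cderivB (has_cderiv_comp d1 d2) (has_cderiv_cst (u a) 0).
have := A2norm_cauchy hF F0 d3; rewrite subr0 => h2.
have L0 := Lw_gt0 hw.
have lE : Lw (phi a) * cmod (cderiv u a * - (1 - cmod a ^+ 2)%:C%C) = u_part a.
  by rewrite /u_part cmodM cmodN cmod_real (ger0_norm (disk_sqr_le ha)); ring.
rewrite -lee_fin -lE EFinM.
have ua0 : (0 <= (Lw (phi a))%:E)%E by rewrite lee_fin ltW.
apply: le_trans (lee_wpmul2l ua0 h2) _; rewrite muleCA.
have k0 : (0 <= (64 : R)%:E)%E by rewrite lee_fin.
apply: le_trans (lee_wpmul2l k0 h1) _; rewrite -EFinM lee_fin; lra.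
Qed.

(** By [Lw_dist] the weight at phi(sigma_a(z)) is at least that at phi(a) minus 32 Lam(z), which is
    bounded for |z| <= rho; so it is large when the weight at phi(a) is. *)
Lemma near_phi_disc (rho s : R) : rho < 1 -> s < 1 -> exists2 s' : R, s' < 1 &
  forall a z, disk a -> s' < cmod (phi a) -> cmod z <= rho -> s < cmod (phi (sigma a z)).
Proof.
move=> r1 s1; pose s0 := Num.max 0 s.
have s00 : 0 <= s0 by rewrite le_max lexx.
have s01 : s0 < 1 by rewrite gt_max ltr01.
have [t t1 ht] := @Lw_large R (ln (2 / (1 - s0 ^+ 2)) + 32 * (- ln (1 - rho)) + 1).
exists t => // a z ha ta zr.
have hz : disk z by exact: le_lt_trans zr r1.
have := Lw_dist (self_map_comp (self_map_sigma ha) hphi) hz.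
rewrite /= sigma0 => hd; have := ht _ (disk_phi ha) ta.
have hL : Lam z <= - ln (1 - rho).
  by rewrite lerN2 ler_ln ?posrE ?subr_gt0 // lerB.
rewrite ltNge; apply: contraPN => hv; apply/negP; rewrite -ltNge.
have hv0 : cmod (phi (sigma a z)) <= s0 by rewrite le_max hv orbT.
have d1 := disk_sqr (disk_phi (sigma_disk ha hz)).
have hb : Lw (phi (sigma a z)) <= ln (2 / (1 - s0 ^+ 2)).
  have d2 : 0 < 1 - s0 ^+ 2 by rewrite subr_gt0 expr_lt1.
  rewrite /Lw ler_ln ?posrE ?divr_gt0 // ler_wpM2l // lef_pV2 ?posrE // lerB //.
  by rewrite lerXn2r ?nnegrE ?cmod_ge0.
move: hd; rewrite ler_norml => /andP[hd _]; lra.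
Qed.

(** Moebius invariance of the Bloch density, through which bounds at sigma_a(v) enter growth
    estimates centred at 0. *)
Lemma sigma_comp_deriv f a z l : holo_disk f -> disk a -> disk z ->
  has_cderiv (fun v => f (sigma a v)) z l ->
  (1 - cmod z ^+ 2) * cmod l =
  (1 - cmod (sigma a z) ^+ 2) * cmod (cderiv f (sigma a z)).
Proof.
move=> hf ha hz hl.
have d := has_cderiv_comp (sigma_cderiv ha hz) (holo_cderiv hf (sigma_disk ha hz)).
by rewrite (has_cderiv_unique hl d) cmodM mulrCA cmod_sigma_deriv // mulrC.
Qed.

Lemma u_growth a z (g : R) : disk a -> disk z ->
  (forall v, cmod v <= cmod z ->
    (1 - cmod (sigma a v) ^+ 2) * cmod (cderiv u (sigma a v)) <= g) ->
  cmod (u (sigma a z) - u a) <= g * Lam z.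
Proof.
move=> ha hz h; have := @disk_growth R (fun v => u (sigma a v)) z g.
rewrite sigma0; apply => //; first exact: (holo_comp (self_map_sigma ha) hu).
move=> v l vz hl; have hv : disk v by exact: le_lt_trans vz hz.
by rewrite (sigma_comp_deriv hu ha hv hl); exact: h.
Qed.

(** The weight at phi(a) must be replaced by the weight at phi(sigma_a(v)): they differ by at most
    32 Lam, and since [Lw] >= 1/2 this is a factor at most 1 + 64 Lam. Growth along the radius adds
    one more power of Lam. *)
Lemma u_growth_log a z (b : R) : disk a -> disk z ->
  (forall v, cmod v <= cmod z -> u_part (sigma a v) <= b) ->
  Lw (phi a) * cmod (u (sigma a z) - u a) <= 64 * b * (1 + Lam z) ^+ 2.
Proof.
move=> ha hz h; have L0 := Lw_gt0 (disk_phi ha); have Lz := Lam_ge0 z.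
have b0 : 0 <= b.
  by apply: le_trans (h z (lexx _)); exact: (u_part_ge0 (sigma_disk ha hz)).
have := @u_growth a z (b * (1 + 64 * Lam z) / Lw (phi a)) ha hz.
have K v : cmod v <= cmod z ->
    (1 - cmod (sigma a v) ^+ 2) * cmod (cderiv u (sigma a v)) <= b * (1 + 64 * Lam z) / Lw (phi a).
  move=> vz; have hv : disk v by exact: le_lt_trans vz hz.
  have hb := sigma_disk ha hv.
  rewrite ler_pdivlMr //; have := h v vz; rewrite /u_part.
  have D0 : 0 <= (1 - cmod (sigma a v) ^+ 2) * cmod (cderiv u (sigma a v)).
    by rewrite mulr_ge0 ?cmod_ge0 ?disk_sqr_le.
  move: D0; set D := _ * cmod _ => D0 hD.
  have := Lw_dist (self_map_comp (self_map_sigma ha) hphi) hv; rewrite /= sigma0.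
  have := Lw_ge (disk_phi hb); have := Lam_mono vz hz; have := Lam_ge0 v.
  move: hD; set q := Lw (phi (sigma a v)); set p := Lw (phi a) in L0 *.
  set t := Lam v; set m := Lam z in Lz *; rewrite ler_norml => hD t0 tm q2 /andP[h1 h2].
  apply: (@le_trans _ _ (D * (q * (1 + 64 * m)))).
    apply: ler_wpM2l => //; nra.
  by rewrite mulrA ler_wpM2r //; lra.
move=> /(_ K) /(ler_wpM2l (ltW L0)) /le_trans; apply.
have -> : Lw (phi a) * (b * (1 + 64 * Lam z) / Lw (phi a) * Lam z) = b * ((1 + 64 * Lam z) * Lam z).
  by field; rewrite gt_eqF.
by rewrite [64 * b]mulrC -mulrA ler_wpM2l //; nra.
Qed.

(** The difficulty is that u is taken at a but the derivative of phi at b = sigma_a(v). Split |u(a)|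
    <= |u(b)| + g Lam: the first term yields [phi_part] at b, the second is paid for by
    [schwarz_pick], whence 16 g. *)
Lemma conj_growth a z (al g : R) : disk a -> disk z ->
  (forall v, cmod v <= cmod z -> phi_part (sigma a v) <= al) ->
  (forall v, cmod v <= cmod z ->
    (1 - cmod (sigma a v) ^+ 2) * cmod (cderiv u (sigma a v)) <= g) ->
  cmod (u a) * cmod (sigma (phi a) (phi (sigma a z))) <= (al + 16 * g) * (1 + Lam z) ^+ 2.
Proof.
move=> ha hz h1 h2; have hw := disk_phi ha; have Lz := Lam_ge0 z.
have al0 : 0 <= al.
  by apply: le_trans (h1 z (lexx _)); exact: (phi_part_ge0 (sigma_disk ha hz)).
have g0 : 0 <= g.
  apply: le_trans (h2 z (lexx _)); rewrite mulr_ge0 ?cmod_ge0 ?disk_sqr_le //.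
  exact: sigma_disk.
have hs := self_map_comp (self_map_sigma ha) hphi.
pose F v : R[i] := u a * sigma (phi a) (phi (sigma a v)).
have hF : holo_disk F.
  by apply: holoM; [exact: holo_cst|exact: (holo_comp hs (holo_sigma hw))].
have F0 : F 0 = 0 by rewrite /F sigma0 sigmaaa mulr0.
have := @disk_growth R F z (al + 16 * g * Lam z) hF hz.
rewrite F0 subr0 /F cmodM => H; apply: le_trans (H _) _; last first.
  have gL : 0 <= g * Lam z by rewrite mulr_ge0.
  have aL : 0 <= al * Lam z by rewrite mulr_ge0.
  have gL2 : 0 <= g * Lam z * Lam z by rewrite mulr_ge0.
  have aL2 : 0 <= al * Lam z * Lam z by rewrite mulr_ge0.
  rewrite -subr_ge0.
  have -> : (al + 16 * g) * (1 + Lam z) ^+ 2 - (al + 16 * g * Lam z) * Lam z =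
    al + al * Lam z + al * Lam z * Lam z + 16 * g + 32 * (g * Lam z) by ring.
  by rewrite !addr_ge0 // mulr_ge0.
move=> v l vz hl; have hv : disk v by exact: le_lt_trans vz hz.
have hb := sigma_disk ha hv; have hpb := disk_phi hb.
have d1 := holo_cderiv hs.1 hv.
have d2 := has_cderivZ (u a) (has_cderiv_comp d1 (sigma_cderiv hw hpb)).
rewrite (has_cderiv_unique hl d2) {hl d2}; set m := cderiv _ v in d1 *.
have Em := sigma_comp_deriv hphi.1 ha hv d1.
have SP := schwarz_pick hs hv d1; rewrite /= in SP.
have := cmod_sigma_deriv hw hpb; set k := - _ / _ => hk.
have db := disk_sqr hpb; clearbody k m.
have kle : cmod k <= (1 - cmod (phi (sigma a v)) ^+ 2)^-1.
  by rewrite -(ler_pM2l db) hk divff ?gt_eqF // lerBlDr lerDl sqr_ge0.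
set D := (1 - cmod v ^+ 2) * cmod m in Em SP.
have D0 : 0 <= D by rewrite mulr_ge0 ?cmod_ge0 ?disk_sqr_le.
pose q := 1 - cmod (phi (sigma a v)) ^+ 2.
have Dq : D / q <= 16 by rewrite ler_pdivrMr.
have Dq0 : 0 <= D / q by rewrite divr_ge0 // ltW.
have A : cmod (u (sigma a v)) * (D / q) <= al by have := h1 v vz; rewrite /phi_part Em.
apply: (@le_trans _ _ (cmod (u a) * (D / q))).
  rewrite !cmodM; have -> : (1 - cmod v ^+ 2) * (cmod (u a) * (cmod k * cmod m)) =
    cmod (u a) * (D * cmod k) by rewrite /D; ring.
  by rewrite ler_wpM2l ?cmod_ge0 // ler_wpM2l.
have ud : cmod (u (sigma a v) - u a) <= g * Lam z.
  apply: le_trans (_ : g * Lam v <= _); last by rewrite ler_wpM2l // Lam_mono.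
  by apply: u_growth => // t tv; apply: h2; exact: le_trans tv vz.
have ut : cmod (u a) <= cmod (u (sigma a v)) + g * Lam z.
  have := cmod_lerB (u a) (u (sigma a v)); rewrite cmod_distC; lra.
apply: le_trans (ler_wpM2r Dq0 ut) _; rewrite mulrDl.
have gL : 0 <= g * Lam z by rewrite mulr_ge0.
have := ler_wpM2l gL Dq; lra.
Qed.

(** Near the centre [conj_growth] is used with the limsup bounds, on the collar with the global
    constant K built from M. The choice of [e1] collects e1 + 16 e1 + e1, times C, into e. *)
Lemma alpha_le (C x : R) : area_const C -> 0 <= x -> near_le phi_part x ->
  (alpha_t u phi <= (C * x)%:E)%E.
Proof.
move=> hC x0 hx; have C1 := hC.1; have C0 : 0 < C by apply: lt_le_trans C1.
apply/lee_addgt0Pr => e e0; rewrite -EFinD.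
pose e1 := e / (18 * C); have e10 : 0 < e1 by rewrite divr_gt0 // mulr_gt0.
pose K := 2 * M + 16 * (100 * M).
have K0 : 0 <= K by have := M_gt0; rewrite /K; lra.
have [rho r1 H] := A2norm_weight hC K0 e10.
have [s1 s11 h1] := hx e1 e10; have [s2 s21 h2] := u_deriv_small e10.
have [|s s1' hs] := @near_phi_disc rho (Num.max s1 s2) r1; first by rewrite gt_max s11.
apply: (limsup_phi_le _ s1'); first by rewrite addr_ge0 ?mulr_ge0 // ltW.
move=> a ha sa; apply: le_trans (H _ (cmod (u a)) (x + e1 + 16 * e1) (cmod_ge0 _) _ _ _) _.
- by move: e10; lra.
- move=> z hz zr; apply: conj_growth => // v vz.
    have := hs a v ha sa (le_trans vz zr); rewrite gt_max => /andP[t1 t2].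
    by apply: h1 => //; apply: sigma_disk => //; exact: le_lt_trans vz hz.
  have := hs a v ha sa (le_trans vz zr); rewrite gt_max => /andP[t1 t2].
  by apply: h2 => //; apply: sigma_disk => //; exact: le_lt_trans vz hz.
- move=> z hz; apply: conj_growth => // v vz.
    by apply: phi_part_le; apply: sigma_disk => //; exact: le_lt_trans vz hz.
  by apply: u_deriv_le; apply: sigma_disk => //; exact: le_lt_trans vz hz.
rewrite lee_fin.
have -> : C * (x + e1 + 16 * e1 + e1) = C * x + 18 * C * e1 by ring.
by rewrite lerD2l /e1 mulrC divfK // gt_eqF // mulr_gt0.
Qed.

Lemma beta_le (C x : R) : area_const C -> 0 <= x -> near_le u_part x ->
  (beta_t u phi <= (64 * C * x)%:E)%E.
Proof.
move=> hC x0 hx; have C1 := hC.1; have C0 : 0 < C by apply: lt_le_trans C1.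
apply/lee_addgt0Pr => e e0; rewrite -EFinD.
have k0 : 0 < (64 + 1) * C by rewrite mulr_gt0.
pose e1 := e / ((64 + 1) * C); have e10 : 0 < e1 by rewrite divr_gt0.
pose K := 64 * (50 * M).
have K0 : 0 <= K by have := M_gt0; rewrite /K; lra.
have [rho r1 H] := A2norm_weight hC K0 e10.
have [s1 s11 h1] := hx e1 e10.
have [s s1' hs] := near_phi_disc r1 s11.
apply: (limsup_phi_le _ s1'); first by rewrite addr_ge0 ?mulr_ge0 // ltW.
move=> a ha sa; have L0 := Lw_gt0 (disk_phi ha).
apply: le_trans (H _ (Lw (phi a)) (64 * (x + e1)) (ltW L0) _ _ _) _.
- by rewrite !mulr_ge0 // addr_ge0 // ltW.
- move=> z hz zr; apply: u_growth_log => // v vz.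
  apply: h1; last exact: hs (le_trans vz zr).
  by apply: sigma_disk => //; exact: le_lt_trans vz hz.
- move=> z hz; apply: u_growth_log => // v vz.
  by apply: u_part_le; apply: sigma_disk => //; exact: le_lt_trans vz hz.
rewrite lee_fin.
have -> : C * (64 * (x + e1) + e1) = 64 * C * x + (64 + 1) * C * e1 by ring.
by rewrite lerD2l /e1 mulrC divfK // gt_eqF.
Qed.

Lemma sigma_far (r s : R) : 0 <= r < 1 -> 0 <= s < 1 -> exists2 q : R, 0 <= q < 1 &
  forall w v, cmod w <= r -> cmod v <= s -> cmod (sigma w v) <= q.
Proof.
move=> /andP[r0 r1] /andP[s0 s1]; pose k := (1 - r ^+ 2) * (1 - s ^+ 2) / 4.
have r2 : 0 < 1 - r ^+ 2 by rewrite subr_gt0 expr_lt1.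
have s2 : 0 < 1 - s ^+ 2 by rewrite subr_gt0 expr_lt1.
have k0 : 0 < k by rewrite divr_gt0 // mulr_gt0.
have k1 : k < 1.
  have := sqr_ge0 r; have := sqr_ge0 s; rewrite /k ltr_pdivrMr // => h1 h2.
  by nra.
exists (Num.sqrt (1 - k)).
  by rewrite sqrtr_ge0 -[ltRHS]sqrtr1 ltr_sqrt //; lra.
move=> w v wr vs; have hw : disk w by exact: le_lt_trans wr r1.
have hv : disk v by exact: le_lt_trans vs s1.
rewrite -(ger0_norm (cmod_ge0 (sigma w v))) -sqrtr_sqr ler_wsqrtr //.
suff : k <= 1 - cmod (sigma w v) ^+ 2 by lra.
rewrite sigma_sqr // /k.
have n0 : 0 < cmod (1 - cconj w * v) by rewrite cmod_gt0 one_sub_conj_neq0.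
apply: ler_pM => //.
- by rewrite mulr_ge0 // ltW.
- by apply: ler_pM; rewrite ?(ltW r2) ?(ltW s2) // lerB // lerXn2r ?nnegrE ?cmod_ge0.
- rewrite lef_pV2 ?posrE ?exprn_gt0 // (_ : (4 : R) = 2 ^+ 2); last by ring.
  by rewrite lerXn2r ?nnegrE ?cmod_ge0 // one_sub_conj_le.
Qed.

(** Where |phi(z)| <= s, sigma_w(phi(z)) stays in a fixed smaller disk for all |w| <= r, so a high
    power beats the bounds by M; elsewhere [npow_peak] gives 2 [phi_part] and the term with u' is
    small. The exponent is the same for all such w. *)
Lemma sigma_pow_small (r x e : R) : 0 <= r < 1 -> 0 <= x -> 0 < e -> near_le phi_part x ->
  exists n, forall w z l, cmod w <= r -> disk z ->
    has_cderiv (wcomp u phi (fun v => sigma w v ^+ n.+1)) z l ->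
    (1 - cmod z ^+ 2) * cmod l <= 2 * x + e.
Proof.
move=> hr x0 e0 hx; have e4 : 0 < e / 4 by rewrite divr_gt0.
have [s1 s11 h1] := hx _ e4; have [s2 s21 h2] := u_deriv_small e4.
pose s := Num.max 0 (Num.max s1 s2).
have hs : 0 <= s < 1 by rewrite le_max lexx /= !gt_max ltr01 s11.
have [q hq Hq] := sigma_far hr hs; have /andP[q0 q1] := hq.
have k0 : 0 < 100 * M + 1 by have := M_gt0; lra.
have ek : 0 < e / 4 / (100 * M + 1) by rewrite divr_gt0.
have [N1 HN1] := pow_small hq ek; have [N2 HN2] := npow_small hq ek.
exists (N1 + N2)%N => w z l wr hz hl; set n := (N1 + N2).+1 in hl.
have hw : disk w by apply: le_lt_trans wr _; case/andP: hr.
have hv := disk_phi hz; have hsv := sigma_disk hw hv.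
rewrite (has_cderiv_unique hl (wcomp_cderiv hz (has_cderivX n (sigma_cderiv hw hv)))).
set k := - _ / _; set S := sigma w (phi z).
have D0 : 0 <= (1 - cmod z ^+ 2) * cmod (cderiv u z) by rewrite mulr_ge0 ?cmod_ge0 ?disk_sqr_le.
have A0 := phi_part_ge0 hz.
have E2 : (1 - cmod z ^+ 2) * cmod (u z * (n%:R * S ^+ n.-1 * k * cderiv phi z)) =
    n%:R * cmod S ^+ n.-1 * (1 - cmod S ^+ 2) * phi_part z.
  have cE (b c : R[i]) : cmod (n%:R * b ^+ n.-1 * c) = n%:R * cmod b ^+ n.-1 * cmod c.
    by rewrite !cmodM cmodX cmod_natr.
  rewrite -phi_part_weight // cE -(cmod_sigma_deriv hw hv) -/k; ring.
have E1 : (1 - cmod z ^+ 2) * cmod (cderiv u z * S ^+ n) =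
    (1 - cmod z ^+ 2) * cmod (cderiv u z) * cmod S ^+ n by rewrite cmodM cmodX mulrA.
apply: le_trans (ler_wpM2l (disk_sqr_le hz) (cmodD _ _)) _; rewrite mulrDr E1 E2.
have S1 : 0 <= cmod S <= 1 by rewrite cmod_ge0 ltW.
have Sq : 0 <= 1 - cmod S ^+ 2 by exact: disk_sqr_le.
have peak := npow_peak n S1.
have [vs|vs] := leP (cmod (phi z)) s.
  have Sle : cmod S <= q by exact: Hq.
  have p1 : cmod S ^+ n <= e / 4 / (100 * M + 1).
    apply: le_trans (HN1 n _); last by rewrite /n -addnS leq_addr.
    by rewrite lerXn2r ?nnegrE ?cmod_ge0.
  have p2 : n%:R * cmod S ^+ n.-1 * (1 - cmod S ^+ 2) <= e / 4 / (100 * M + 1).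
    apply: le_trans (_ : n%:R * cmod S ^+ n.-1 <= _).
      by rewrite ler_piMr ?mulr_ge0 ?exprn_ge0 ?cmod_ge0 // lerBlDr lerDl sqr_ge0.
    apply: le_trans (HN2 n _); last by rewrite /n -addSn leq_addl.
    by rewrite ler_wpM2l // lerXn2r ?nnegrE ?cmod_ge0.
  have u1 := u_deriv_le hz; have u2 := phi_part_le hz.
  have dk : (100 * M + 1) * (e / 4 / (100 * M + 1)) = e / 4 by rewrite mulrC divfK // gt_eqF.
  move: ek p1 p2 dk; set t := e / 4 / _ => t0 p1 p2 dk.
  have b1 : (1 - cmod z ^+ 2) * cmod (cderiv u z) * cmod S ^+ n <= e / 4.
    rewrite -dk; apply: ler_pM; rewrite ?exprn_ge0 ?cmod_ge0 //; lra.
  have b2 : n%:R * cmod S ^+ n.-1 * (1 - cmod S ^+ 2) * phi_part z <= e / 4.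
    rewrite -dk mulrC; apply: ler_pM => //; last by lra.
    by rewrite !mulr_ge0 ?exprn_ge0 ?cmod_ge0.
  lra.
move: vs; rewrite !gt_max => /andP[_ /andP[v1 v2]].
have b1 : (1 - cmod z ^+ 2) * cmod (cderiv u z) * cmod S ^+ n <= e / 4.
  apply: le_trans (h2 z hz v2); rewrite ler_piMr // exprn_ile1 ?cmod_ge0 // ltW //.
have b2 : n%:R * cmod S ^+ n.-1 * (1 - cmod S ^+ 2) * phi_part z <= 2 * (x + e / 4).
  apply: ler_pM => //; last exact: h1.
  by rewrite !mulr_ge0 ?exprn_ge0 ?cmod_ge0.
lra.
Qed.

(* [uC_phi(sigma_w^n)] vanishes at [a] when [w = phi a], and its Bloch seminorm is
   at most about [2 x] for large [n]; on [E(phi,a,t)] its modulus at [sigma_a z]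
   exceeds [t^n |u(sigma_a z)|]. *)
Lemma gamma_le (C x : R) : area_const C -> 0 <= x -> near_le phi_part x ->
  (gamma_t u phi <= (4 * C * x)%:E)%E.
Proof.
move=> hC x0 hx; have C1 := hC.1; have C0 : 0 < C by apply: lt_le_trans C1.
apply/lee_addgt0Pr => e e0; rewrite -EFinD.
have k0 : 0 < 3 * C by rewrite mulr_gt0.
pose e1 := e / (3 * C); have e10 : 0 < e1 by rewrite divr_gt0.
(* The factor 2 undoes the lower bound 1/2 for the power of sigma on [Eset]. *)
pose eta := 2 * (2 * x + e1).
have eta0 : 0 <= eta by rewrite /eta; move: e10; lra.
apply: (@limsup_left1_le _ _ 0) => // r /andP[r0 r1].
have hr : 0 <= r < 1 by rewrite (ltW r0).
(* The exponent depends on r but not on a, so a threshold for t chosen after r suits every a with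
   |phi(a)| <= r, in accordance with the order of the two upper limits. *)
have [n hn] := sigma_pow_small hr x0 e10 hx.
have n0 : 0 < (2 * n.+1%:R)^-1 :> R by rewrite invr_gt0 mulr_gt0.
apply: (@limsup_left1_le _ _ (1 - (2 * n.+1%:R)^-1)); first by rewrite ltrBlDr ltrDl.
move=> t /andP[t0 t1].
have n1 : (2 * n.+1%:R)^-1 <= 1 :> R.
  by rewrite invf_le1 ?mulr_gt0 // -natrM ler1n.
have tn : 1/2 <= t ^+ n.+1.
  have d01 : 0 <= 1 - t <= 1.
    by move: t0 n1; set X := _^-1; lra.
  have := bernoulli n.+1 d01; rewrite subKr; apply: le_trans.
  have h : 1 - t <= (2 * n.+1%:R)^-1 by rewrite lerBlDr -lerBlDl ltW.
  have N0 : 0 <= n.+1%:R :> R by [].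
  have := ler_wpM2l N0 h; rewrite invfM mulrCA divff ?pnatr_eq0 // mulr1.
  by set X := n.+1%:R * (1 - t); lra.
apply: sup0_le; first by rewrite addr_ge0 ?mulr_ge0 // ltW.
move=> _ [a [ha war] <-]; have hw := disk_phi ha.
have bound z : Eset phi a t z -> cmod (u (sigma a z)) <= eta * (1 + Lam z).
  case=> hz tz; have hb := sigma_disk ha hz.
  pose G := wcomp u phi (fun v => sigma (phi a) v ^+ n.+1).
  have hG : holo_disk G.
    apply: holoM => //; apply: (@holo_comp R phi (fun v => sigma (phi a) v ^+ n.+1)) => //.
    by apply: holoX; exact: holo_sigma.
  have := @disk_growth R (fun v => G (sigma a v)) z (2 * x + e1)
    (holo_comp (self_map_sigma ha) hG) hz.
  have G0 : G a = 0 by rewrite /G /wcomp sigmaaa expr0n mulr0.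
  rewrite sigma0 G0 subr0 {2}/G /wcomp cmodM cmodX => H.
  have {}H : cmod (u (sigma a z)) * cmod (sigma (phi a) (phi (sigma a z))) ^+ n.+1 <=
      (2 * x + e1) * Lam z.
    apply: H => v l vz hl; have hv : disk v by exact: le_lt_trans vz hz.
    rewrite (sigma_comp_deriv hG ha hv hl).
    by apply: (hn _ _ _ war (sigma_disk ha hv)); exact: (holo_cderiv hG (sigma_disk ha hv)).
  have pw : 1/2 <= cmod (sigma (phi a) (phi (sigma a z))) ^+ n.+1.
    apply: le_trans tn _; rewrite lerXn2r ?nnegrE ?cmod_ge0 // ?(ltW tz) //.
    by apply: le_trans (ltW t0); rewrite subr_ge0.
  have U0 := cmod_ge0 (u (sigma a z)); have L0 := Lam_ge0 z.
  have := ler_wpM2l U0 pw; rewrite /eta; nra.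
have [|rho r1' H] := hC.2 (eta ^+ 4) (e1 ^+ 4) (exprn_ge0 _ eta0); first by rewrite exprn_gt0.
have b4 z : Eset phi a t z -> 1 * cmod (u (sigma a z)) ^+ 4 <= eta ^+ 4 * (1 + Lam z) ^+ 4.
  move=> hz; rewrite mul1r -exprMn lerXn2r ?nnegrE ?cmod_ge0 //; last exact: bound.
  by rewrite mulr_ge0 // addr_ge0 // Lam_ge0.
have := H (Eset phi a t) (fun z => cmod (u (sigma a z)) ^+ 4) 1 (eta ^+ 4) ler01
  (exprn_ge0 _ eta0) _ _ (fun z hz _ => b4 z hz) b4.
rewrite mul1e => hI.
apply: le_trans (@poweR_root_le R _ 4 (C * (eta + e1)) isT _ _ (le_trans (hI _ _) _)) _.
- by apply: area_int_ge0 => z; rewrite lee_fin exprn_ge0 ?cmod_ge0.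
- by rewrite mulr_ge0 ?addr_ge0 // ltW.
- by move=> z [].
- by move=> z _; rewrite exprn_ge0 ?cmod_ge0.
- by rewrite lee_fin; apply: add_pow_le => //; exact: ltW.
rewrite lee_fin /eta.
have -> : C * (2 * (2 * x + e1) + e1) = 4 * C * x + 3 * C * e1 by ring.
by rewrite lerD2l /e1 mulrC divfK // gt_eqF.
Qed.

Lemma dil_compact_op (r : R) : 0 <= r < 1 -> compact_bloch (fun f => wcomp u phi (dil r f)).
Proof.
move=> hr; have hr' : 0 <= r <= 1 by case/andP: hr => -> /ltW.
have bd f : in_bloch f -> in_bloch (dil r f).
  by move=> bf; have [K _ [hK|hK]] := in_bloch_fin bf; [have := lexx (bloch_norm f); rewrite {2}hK => {}hK|];
    case: (dil_bloch hr' bf.1 hK).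
split.
- by move=> f g _ _ fg z hz; rewrite /wcomp /dil fg //; apply: disk_dil => //; exact: disk_phi.
- by move=> f g a b _ _ z _; rewrite /wcomp /dil; ring.
- by move=> f bf; apply: hT; exact: bd.
- move=> fs K hfs; have [s [g [hs bg H]]] := dilation_compact hr hfs.
  exists s, (wcomp u phi (dil r g)); split => //; first by apply: hT; exact: bd.
  have bdiff k : in_bloch (fun z => dil r (fs (s k)) z - dil r g z).
    by apply: in_blochB; apply: bd => //; case: (hfs (s k)).
  have E k : bloch_norm (fun z => wcomp u phi (dil r (fs (s k))) z - wcomp u phi (dil r g) z)%R =
      bloch_norm (wcomp u phi (fun z => dil r (fs (s k)) z - dil r g z)%R).
    by congr bloch_norm; apply/funext => z; rewrite /wcomp mulrBr.
  apply: le_cvge0 => [k|e e0]; first by rewrite E; apply: bloch_norm_ge0; exact: (hT (bdiff k)).1.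
  have Me : 0 < e / M by rewrite divr_gt0.
  have [N _ HN] := near_infty_natSinv_lt (PosNum Me).
  exists N => k Nk; rewrite E.
  have k0 : 0 < k.+1%:R^-1 :> R by rewrite invr_gt0.
  apply: le_trans (wcomp_bound (bdiff k) (H k) k0) _; rewrite lee_fin mulrC -ler_pdivlMr //.
  by apply: ltW; exact: HN k Nk.
Qed.

Lemma Lam_le_Lw z : disk z -> Lam z <= Lw z.
Proof.
move=> hz; have d1 := disk_sqr hz; have d2 : 0 < 1 - cmod z by rewrite subr_gt0.
rewrite /Lam /Lw -lnV ?posrE // ler_ln ?posrE ?invr_gt0 ?divr_gt0 //.
rewrite ler_pdivlMr // mulrC ler_pdivrMr //.
have -> : 1 - cmod z ^+ 2 = (1 - cmod z) * (1 + cmod z) by ring.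
have z1 : cmod z <= 1 by exact: ltW.
by rewrite mulrC ler_wpM2r ?(ltW d2) //; lra.
Qed.

(** On |w| <= t, with t midway between s and 1, functions in the unit ball are Lipschitz with
    constant K, so a dilation by 1 - d moves them by at most K d. The Cauchy estimate with the
    margin t - s handles derivatives; B collects both costs. *)
Lemma dil_diff_small (s e : R) : 0 <= s < 1 -> 0 < e -> exists2 r : R, 0 <= r < 1 &
  forall f v l, holo_disk f -> (bloch_norm f <= 1%:E)%E -> cmod v <= s ->
    has_cderiv (fun z => f z - dil r f z) v l -> cmod (f v - dil r f v) <= e /\ cmod l <= e.
Proof.
move=> /andP[s0 s1] e0; pose t := (1 + s) / 2; pose K := (1 - t ^+ 2)^-1; pose rho := (1 - s) / 2.
have t1 : t < 1 by rewrite /t; lra.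
have t0 : 0 <= t by rewrite /t; lra.
have st : s <= t by rewrite /t; lra.
have r0 : 0 < rho by rewrite /rho; lra.
have K0 : 0 < K by rewrite invr_gt0 subr_gt0 expr_lt1.
pose B := 16 * (2 * K) / rho + K.
have B0 : 0 < B by rewrite addr_gt0 // divr_gt0 // !mulr_gt0.
pose d := Num.min (1/2) (e / B).
have d0 : 0 < d by rewrite lt_min; apply/andP; split; [lra|exact: divr_gt0].
have d2 : d <= 1/2 by rewrite ge_min lexx.
have dB : d * B <= e by rewrite -ler_pdivlMr // ge_min lexx orbT.
have hr : 0 <= 1 - d < 1 by lra.
have hr' : 0 <= 1 - d <= 1 by lra.
exists (1 - d) => // f v l hf nf vs hl.
have small w : cmod w <= t -> cmod (f w - dil (1 - d) f w) <= K * d.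
  move=> wt; rewrite cmod_distC /dil.
  have rw : cmod ((1 - d)%:C%C * w) = (1 - d) * cmod w by rewrite cmod_dil; case/andP: hr.
  have w0 := cmod_ge0 w.
  have rwt : cmod ((1 - d)%:C%C * w) <= t by rewrite rw; nra.
  have lip := @holo_lipschitz R f K t w ((1 - d)%:C%C * w) hf t1.
  apply: le_trans (lip _ wt rwt) _.
    move=> v' l' hv' hl'; have := bloch_deriv_le hf nf t1 hv' hl'; by rewrite div1r.
  rewrite ler_wpM2l ?(ltW K0) //.
  have -> : (1 - d)%:C%C * w - w = (- d)%:C%C * w by rewrite rmorphB rmorph1 rmorphN /=; ring.
  rewrite cmodM cmod_real normrN ger0_norm ?(ltW d0) // ler_piMr ?(ltW d0) //.
  by rewrite (le_trans wt) // ltW.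
have KB : K * d <= e.
  apply: le_trans dB; rewrite mulrC ler_wpM2l ?(ltW d0) // lerDr divr_ge0 ?(ltW r0) //.
  by rewrite !mulr_ge0 // ltW.
split; first by apply: le_trans (small v (le_trans vs st)) KB.
have near w : cmod (w - v) < rho -> cmod w <= t.
  by move=> hw; have := cmodD (w - v) v; rewrite subrK; move: hw; rewrite /rho /t; lra.
have := @cauchy_disk_est R (fun z => f z - dil (1 - d) f z) v l rho (2 * (K * d)) r0 _ hl _.
move=> H; apply: le_trans (H _ _) _.
- move=> w /near wt; have hw : disk w by exact: le_lt_trans wt t1.
  by apply: holoB => //; exact: holo_dil.
- move=> w /near wt; apply: le_trans (cmodB _ _) _.
  have := small w wt; have := small v (le_trans vs st); lra.
apply: le_trans dB; rewrite /B mulrDr.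
have -> : 16 * (2 * (K * d)) / rho = d * (16 * (2 * K) / rho) by ring.
by rewrite lerDl mulr_ge0 // ltW.
Qed.

Lemma ess_le (x y : R) : 0 <= x -> 0 <= y -> near_le phi_part x -> near_le u_part y ->
  (ess_norm (wcomp u phi) <= (2 * x + 6 * y)%:E)%E.
Proof.
move=> x0 y0 hx hy; apply/lee_addgt0Pr => e e0; rewrite -EFinD.
have e1 : 0 < e / 16 by rewrite divr_gt0.
have [s1 s11 h1] := hx _ e1; have [s2 s21 h2] := hy _ e1.
have w0 := disk_phi (disk0 : disk (0 : R[i])).
(* Including |phi(0)| makes the value at the origin fall under the estimate for |phi| <= s. *)
pose s := Num.max (cmod (phi 0)) (Num.max s1 s2).
have hs : 0 <= s < 1 by rewrite le_max cmod_ge0 /= !gt_max w0 s11.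
pose B := cmod (u 0) + 100 * M + 2 * M.
have M0 := M_gt0; have u0 := cmod_ge0 (u 0).
have B0 : 0 < B by rewrite /B; lra.
have eB : 0 < e / 16 / B by rewrite divr_gt0.
have [r hr Hr] := dil_diff_small hs eB; have hr' : 0 <= r <= 1 by case/andP: hr => -> /ltW.
have Bt : B * (e / 16 / B) = e / 16 by rewrite mulrC divfK // gt_eqF.
move: eB Bt Hr; set t := e / 16 / B => t0 Bt Hr.
have p1 : cmod (u 0) * t <= e / 16.
  by rewrite -Bt ler_wpM2r ?(ltW t0) // /B; lra.
have p2 : 100 * M * t + 2 * M * t <= e / 16.
  by rewrite -Bt -mulrDl ler_wpM2r ?(ltW t0) // /B; lra.
apply: le_trans (_ : op_norm (op_sub (wcomp u phi) (fun f => wcomp u phi (dil r f))) <= _)%E.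
  by apply: ereal_inf_lbound; exists (fun f => wcomp u phi (dil r f)) => //; exact: dil_compact_op.
apply: op_norm_le => f bf nf.
pose h z := f z - dil r f z.
have hh : holo_disk h by apply: holoB; [exact: bf.1|exact: holo_dil bf.1].
have -> : bloch_norm (op_sub (wcomp u phi) (fun f => wcomp u phi (dil r f)) f) =
    bloch_norm (wcomp u phi h).
  by congr bloch_norm; apply/funext => z; rewrite /op_sub /wcomp /h mulrBr.
have -> : 2 * x + 6 * y + e = e / 16 + (2 * x + 6 * y + 15 * (e / 16)) by field.
apply: bloch_norm_le.
  have v0 : cmod (phi 0) <= s by rewrite le_max lexx.
  have [h0 _] := Hr f (phi 0) _ bf.1 nf v0 (holo_cderiv hh w0).
  by rewrite cmodM; apply: le_trans (ler_wpM2l u0 h0) p1.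
move=> z l hz hl; have hv := disk_phi hz.
have dh := holo_cderiv hh hv.
rewrite (has_cderiv_unique hl (wcomp_cderiv hz dh)).
set m := cderiv h (phi z) in dh *.
have A0 := phi_part_ge0 hz; have dv := disk_sqr_le hv.
have D0 : 0 <= (1 - cmod z ^+ 2) * cmod (cderiv u z) by rewrite mulr_ge0 ?cmod_ge0 ?disk_sqr_le.
apply: le_trans (ler_wpM2l (disk_sqr_le hz) (cmodD _ _)) _; rewrite mulrDr.
rewrite -phi_part_weight // cmodM mulrA.
have [vs|vs] := leP (cmod (phi z)) s.
  have [k1 k2] := Hr f (phi z) m bf.1 nf vs dh.
  have b1 : (1 - cmod z ^+ 2) * cmod (cderiv u z) * cmod (h (phi z)) <= 100 * M * t.
    by apply: ler_pM; rewrite ?cmod_ge0 // u_deriv_le.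
  have b2 : cmod m * (1 - cmod (phi z) ^+ 2) * phi_part z <= 2 * M * t.
    rewrite mulrC; apply: ler_pM => //; [by rewrite mulr_ge0 ?cmod_ge0|exact: phi_part_le|].
    by apply: le_trans k2; rewrite ler_piMr ?cmod_ge0 // lerBlDr lerDl sqr_ge0.
  by move: e0 p2 b1 b2; lra.
move: vs; rewrite !gt_max => /andP[_ /andP[v1 v2]].
have [bdr ndr] := dil_bloch hr' bf.1 nf.
have [f0 nf'] := bloch_normP bf.1 nf.
have hm : cmod m * (1 - cmod (phi z) ^+ 2) <= 2.
  have df := holo_cderiv bf.1 hv; have dd := holo_cderiv bdr.1 hv.
  rewrite (has_cderiv_unique dh (has_cderivB df dd)) mulrC.
  apply: le_trans (ler_wpM2l dv (cmodB _ _)) _; rewrite mulrDr.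
  have := nf' _ _ hv df; have := ndr _ _ hv dd; lra.
(* Both f and its dilation are at most 1 + Lam <= 3 [Lw], as 1 <= 2 [Lw] and Lam <= [Lw]. *)
have hL : cmod (h (phi z)) <= 6 * Lw (phi z).
  have g1 := bloch_growth bf.1 nf hv.
  have g2 := bloch_growth bf.1 nf (disk_dil hr' hv).
  have := Lam_le_Lw hv; have := Lw_ge hv; have := Lam_ge0 (phi z).
  have : Lam (r%:C%C * phi z) <= Lam (phi z).
    apply: Lam_mono => //; rewrite cmod_dil; last by case/andP: hr.
    by rewrite ler_piMl ?cmod_ge0 //; case/andP: hr'.
  have := cmodB (f (phi z)) (f (r%:C%C * phi z)); rewrite /h /dil; lra.
have b1 : (1 - cmod z ^+ 2) * cmod (cderiv u z) * cmod (h (phi z)) <= 6 * (y + e / 16).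
  apply: le_trans (ler_wpM2l D0 hL) _.
  have := h2 z hz v2; rewrite /u_part mulrCA; lra.
have b2 : cmod m * (1 - cmod (phi z) ^+ 2) * phi_part z <= 2 * (x + e / 16).
  apply: ler_pM => //; last exact: h1.
  by rewrite mulr_ge0 ?cmod_ge0.
move: e0 b1 b2; lra.
Qed.

End WeightedComposition.

(** An infinite Y makes the claim trivial, so upper bounds may be proved for real majorants without
    first knowing the limits superior to be finite. *)
Lemma lee_mul_nonneg {R : realType} (X Y : \bar R) (C : R) : 0 < C -> (0 <= Y)%E ->
  (forall r : R, 0 <= r -> (Y <= r%:E)%E -> (X <= (C * r)%:E)%E) -> (X <= C%:E * Y)%E.
Proof.
move=> C0; case: Y => [r r0 H|_ _|//].
  by rewrite -EFinM; apply: H.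
by apply: le_trans (leey X) _; rewrite gt0_muley ?lte_fin.
Qed.

Lemma near_le_const {R : realType} (phi : R[i] -> R[i]) (Q : R[i] -> R) (x : R) :
  (forall z, disk z -> Q z <= x) -> near_le phi Q x.
Proof.
move=> h e e0; exists 0 => // z hz _.
by apply: le_trans (h z hz) _; rewrite lerDl ltW.
Qed.

(** * Two-sided bounds for the essential norm *)

Section EssentialNorm.
Context {R : realType}.
Variables (u phi : R[i] -> R[i]).
Hypothesis hu : holo_disk u.
Hypothesis hphi : self_map phi.
Hypothesis hb : bounded_bloch (wcomp u phi).

Lemma ess_norm_ge0 : (0 <= ess_norm (wcomp u phi))%E.
Proof.
apply: le_ereal_inf_tmp => _ [K cK <-]; apply: op_norm_ge0 => f.
exact: (op_sub_in_bloch hb.1 cK).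
Qed.

Lemma op_norm_finite : exists2 M : R, 0 < M & (op_norm (wcomp u phi) <= M%:E)%E.
Proof.
case: hb => hT; have := op_norm_ge0 hT; case: (op_norm _) => [r r0 _|//|//].
by exists (r + 1); rewrite ?lee_fin ?lerDl // ltr_wpDl.
Qed.

Lemma limsup_pow_ge0 : (0 <= limsup_pow u phi)%E.
Proof.
by apply: limn_esup_ge0 => n; apply: bloch_norm_ge0; apply: holoM => //; apply: holoX; exact: hphi.1.
Qed.

Lemma gamma_ge0 : (0 <= gamma_t u phi)%E.
Proof. by do 2 (apply: limsup_left1_ge0 => ?); exact: sup0_ge0. Qed.

Lemma ess_norm_lower : exists e : R, [/\ 0 <= e, ess_norm (wcomp u phi) = e%:E,
  (limsup_pow u phi <= (3 * e)%:E)%E & (limsup_g u phi <= (46 * e)%:E)%E].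
Proof.
have [M M0 hM] := op_norm_finite; have hT := hb.1.
have := ess_norm_ge0.
(* The global bounds 2 M and 50 M, fed to [ess_le], show the essential norm to be finite, so it may
   be treated as a real number e. *)
have : (ess_norm (wcomp u phi) <= (2 * (2 * M) + 6 * (50 * M))%:E)%E.
  apply: (ess_le hu hphi hT M0 hM); rewrite ?mulr_ge0 ?(ltW M0) //.
  - by apply: near_le_const => z; exact: (phi_part_le hu hphi hT hM).
  - by apply: near_le_const => z; exact: (u_part_le hu hphi hT hM).
case E : (ess_norm (wcomp u phi)) => [e|//|//] _ e0; exists e.
have near (d : R) : 0 < d -> exists2 K, compact_bloch K &
    (op_norm (op_sub (wcomp u phi) K) <= (e + d)%:E)%E.
  move=> d0; have ed : (ess_norm (wcomp u phi) < (e + d)%:E)%E by rewrite E lte_fin ltrDl.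
  by have [_ [K cK <-] /ltW hK] := ereal_inf_lt ed; exists K.
split => //.
- apply/lee_addgt0Pr => d d0; have d3 : 0 < d / 3 by rewrite divr_gt0.
  have [K cK hK] := near _ d3.
  apply: le_trans (ess_ge_pow hT cK _ hK) _; first by rewrite addr_ge0 // ltW.
  by rewrite -EFinD lee_fin; lra.
- apply/lee_addgt0Pr => d d0; have d3 : 0 < d / 46 by rewrite divr_gt0.
  have [K cK hK] := near _ d3.
  apply: le_trans (ess_ge_g hphi hT cK _ hK) _; first by rewrite addr_ge0 // ltW.
  by rewrite -EFinD lee_fin; lra.
Qed.

Lemma ess_norm_le_near (x y r : R) : 0 <= r -> near_le phi (phi_part u phi) (x * r) ->
  near_le phi (u_part u phi) (y * r) -> 0 <= x -> 0 <= y -> 2 * x + 6 * y <= 64 * 16 ->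
  (ess_norm (wcomp u phi) <= (64 * 16 * r)%:E)%E.
Proof.
move=> r0 hx hy x0 y0 xy; have [M M0 hM] := op_norm_finite; have hT := hb.1.
apply: le_trans (ess_le hu hphi hT M0 hM _ _ hx hy) _; rewrite ?mulr_ge0 //.
rewrite lee_fin; apply: le_trans (ler_wpM2r r0 xy); lra.
Qed.

(** Each of the four sums of the theorem dominates one quantity controlling [phi_part] and one
    controlling [u_part]; the two disjunctions cover all combinations. The worst case is 64 r and (2
    * 64 + 1) r, for which 2 * 64 + 6 * 129 <= 64 * 16. *)
Lemma ess_norm_upper (r : R) : 0 <= r ->
  ((alpha_t u phi <= r%:E)%E \/ (limsup_pow u phi <= r%:E)%E) ->
  ((beta_t u phi <= r%:E)%E \/ (limsup_g u phi <= r%:E)%E) ->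
  (ess_norm (wcomp u phi) <= (64 * 16 * r)%:E)%E.
Proof.
move=> r0 hA hB; have [M M0 hM] := op_norm_finite; have hT := hb.1.
have nA : near_le phi (phi_part u phi) (64 * r).
  case: hA => h; first exact: (near_of_alpha hphi h).
  apply: near_leW (near_of_pow hu hphi hT hM h); lra.
have nB : near_le phi (u_part u phi) ((64 * 2 + 1) * r).
  case: hB => h; first by apply: near_leW (near_of_beta hu hphi h); lra.
  by apply: near_leW (near_of_g hu hphi hT h nA); lra.
apply: (ess_norm_le_near r0 nA nB); lra.
Qed.

End EssentialNorm.

(* X ≈ Y  is rendered as  c * Y <= X <= C * Y  with constants c, C > 0
   independent of u and phi; all four right-hand sides are compared with
   the essential norm. *)
Theorem theorem3p2 (R : realType) :
  exists c C : R, [/\ 0 < c, 0 < C &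
    forall u phi : R[i] -> R[i],
      holo_disk u -> self_map phi -> bounded_bloch (wcomp u phi) ->
      let X0 := ess_norm (wcomp u phi) in
      let X1 := (limsup_pow u phi + limsup_g u phi)%E in
      let X2 := (alpha_t u phi + beta_t u phi + gamma_t u phi)%E in
      let X3 := (alpha_t u phi + limsup_g u phi + gamma_t u phi)%E in
      let X4 := (limsup_pow u phi + beta_t u phi)%E in
      [/\ (c%:E * X1 <= X0 <= C%:E * X1)%E,
          (c%:E * X2 <= X0 <= C%:E * X2)%E,
          (c%:E * X3 <= X0 <= C%:E * X3)%E &
          (c%:E * X4 <= X0 <= C%:E * X4)%E]].
Proof.
have [C C1 hC0] := @area_weight_bound R; have hC : area_const C by [].
(* The largest lower-bound constant arises for alpha + beta + gamma: 12 C + 64 * 70 C + 48 C, where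
   12 = 4 * 3 and 70 = 46 + 2 * 12. *)
pose D : R := 64 * 64 * 2 * C.
have D0 : 0 < D by rewrite /D; lra.
have k0 : 0 < (64 * 16 : R) by rewrite mulr_gt0.
exists D^-1, (64 * 16); split => //; first by rewrite invr_gt0.
move=> u phi hu hphi hb X0 X1 X2 X3 X4.
have [M M0 hM] := op_norm_finite hb; have hT := hb.1.
have [e [e0 E hp hg]] := ess_norm_lower hu hphi hb.
have nA := near_of_pow hu hphi hT hM hp.
have nB := near_of_g hu hphi hT hg nA.
have t1 : 0 <= 4 * (3 * e) by lra.
have t2 : 0 <= 46 * e + 2 * (4 * (3 * e)) by lra.
have ha := alpha_le hu hphi hT M0 hM hC t1 nA.
have hbt := beta_le hu hphi hT M0 hM hC t2 nB.
have hgm := gamma_le hu hphi hT M0 hM hC t1 nA.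
have Ce : e <= C * e by rewrite ler_peMl.
have lower (X : \bar R) (b : R) : (X <= b%:E)%E -> b <= D * e -> ((D^-1)%:E * X <= X0)%E.
  move=> Xb bD; have D1 : (0 <= (D^-1)%:E)%E by rewrite lee_fin invr_ge0 ltW.
  apply: le_trans (lee_wpmul2l D1 Xb) _.
  by rewrite /X0 E -EFinM lee_fin mulrC ler_pdivrMr // mulrC.
have p0 := limsup_pow_ge0 hu hphi; have gm0 := @gamma_ge0 R u phi.
have g0 : (0 <= limsup_g u phi)%E by exact: limsup_phi_ge0.
have a0 : (0 <= alpha_t u phi)%E by exact: limsup_phi_ge0.
have b0 : (0 <= beta_t u phi)%E by exact: limsup_phi_ge0.
have up := ess_norm_upper hu hphi hb.
have addl (p q : \bar R) : (0 <= q)%E -> (p <= p + q)%E by move=> ?; rewrite leeDl.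
have addr (p q : \bar R) : (0 <= p)%E -> (q <= p + q)%E by move=> ?; rewrite leeDr.
split; apply/andP; split.
- by apply: lower (leeD hp hg) _; rewrite /D; lra.
- apply: (lee_mul_nonneg k0 (adde_ge0 p0 g0)) => r r0 h; apply: (up r r0); right.
    exact: le_trans (addl _ _ g0) h.
  exact: le_trans (addr _ _ p0) h.
- by apply: lower (leeD (leeD ha hbt) hgm) _; rewrite /D; lra.
- apply: (lee_mul_nonneg k0 (adde_ge0 (adde_ge0 a0 b0) gm0)) => r r0 h.
  have {}h := le_trans (addl _ _ gm0) h; apply: (up r r0); left.
    exact: le_trans (addl _ _ b0) h.
  exact: le_trans (addr _ _ a0) h.
- by apply: lower (leeD (leeD ha hg) hgm) _; rewrite /D; lra.
- apply: (lee_mul_nonneg k0 (adde_ge0 (adde_ge0 a0 g0) gm0)) => r r0 h.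
  have {}h := le_trans (addl _ _ gm0) h; apply: (up r r0); [left|right].
    exact: le_trans (addl _ _ g0) h.
  exact: le_trans (addr _ _ a0) h.
- by apply: lower (leeD hp hbt) _; rewrite /D; lra.
- apply: (lee_mul_nonneg k0 (adde_ge0 p0 b0)) => r r0 h; apply: (up r r0); [right|left].
    exact: le_trans (addl _ _ b0) h.
  exact: le_trans (addr _ _ p0) h.
Qed.
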